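(* Let $n\ge 2$ and $c\in\mathbb{R}$. Let $\Gamma\subsetneqq\mathbb{R}^n$ be a non-empty open symmetric cone with vertex at the origin satisfying $\Gamma+\Gamma_n\subset\Gamma$, and let $f:\Gamma\to\mathbb{R}$ be a symmetric function in $C^{0,1}_{loc}(\Gamma)$ such that for every compact $K\subset\Gamma$ there is a constant $c(K)>0$ with $\frac{\partial f}{\partial\lambda_i}\ge c(K)$ a.e. on $K$ for all $1\le i\le n$. Assume $\lambda^*:=(1,-1,\dots,-1)\notin\overline{\Gamma}$. Suppose that $u\in C^2(\overline{B^+}\setminus\{0\})$ and $v\in C^2(\overline{B^+})$ satisfy $\lambda(A[v])(\overline{B^+})\subset\Gamma$, $$\begin{cases} f(\lambda(A[u]))\ge f(\lambda(A[v])) & \text{in } B^+,\\ \frac{\partial u}{\partial x_n}\le c\,e^{u} & \text{on } \partial'B^+\setminus\{0\},\\ \frac{\partial v}{\partial x_n}\ge c\,e^{v} & \text{on } \partial'B^+,\end{cases}$$ and $u>v$ in $B^+$. Then $\liminf_{x\to0}(u-v)(x)>0$.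
   Context: $\mathbb{R}^n_+=\{x\in\mathbb{R}^n: x_n>0\}$; $B$ is the open unit ball of $\mathbb{R}^n$ centered at $0$; $B^+=B\cap\mathbb{R}^n_+$; $\partial'B^+$ is the interior (in $\partial\mathbb{R}^n_+$) of $\partial B^+\cap\partial\mathbb{R}^n_+$, i.e. $\{|x|<1,\ x_n=0\}$. $\Gamma_n=\{\lambda\in\mathbb{R}^n:\lambda_i>0 \text{ for all } i\}$. A set or function is symmetric if it is invariant under permutations of the $\lambda_i$. For a $C^2$ function $v$, $A[v]=e^{-2v}\left(-\nabla^2v+\nabla v\otimes\nabla v-\frac12|\nabla v|^2I\right)$, and $\lambda(M)$ denotes the eigenvalues of the symmetric matrix $M$ (modulo permutations). Since $f$ is defined only on $\Gamma$, writing $f(\lambda(A[u]))$ at a point means in particular that $\lambda(A[u])\in\Gamma$ there. *)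

(* Defs.v *)
From HB Require Import structures.
From mathcomp Require Import all_boot all_order all_algebra all_fingroup.
From mathcomp Require Import all_classical all_reals all_analysis.

Set Implicit Arguments.
Unset Strict Implicit.
Unset Printing Implicit Defensive.

Import Order.TTheory GRing.Theory Num.Theory.
Import numFieldNormedType.Exports.

Local Open Scope classical_set_scope.
Local Open Scope ring_scope.

(* The library norm on 'rV[R]_n is the sup norm; it induces the usual topology,
   but the balls of the statement are Euclidean. *)
Definition enorm (R : realType) (n : nat) (x : 'rV[R]_n) : R :=
  Num.sqrt (\sum_i x 0 i ^+ 2).

(* Points of R^(n+1); the last coordinate has index ord_max. *)
Definition half_ball (R : realType) (n : nat) : set 'rV[R]_n.+1 :=
  [set x | enorm x < 1 /\ 0 < x 0 ord_max].
Arguments half_ball R n : clear implicits.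

Definition flat_boundary (R : realType) (n : nat) : set 'rV[R]_n.+1 :=
  [set x | enorm x < 1 /\ x 0 ord_max = 0].
Arguments flat_boundary R n : clear implicits.

Definition partial (R : realType) (n : nat) (i : 'I_n) (u : 'rV[R]_n -> R)
    (x : 'rV[R]_n) : R :=
  'D_(delta_mx 0 i) (u : 'rV[R]_n -> R^o) x.

Definition extends_continuously (R : realType) (n : nat) (Om S : set 'rV[R]_n)
    (g : 'rV[R]_n -> R) : Prop :=
  exists2 h : 'rV[R]_n -> R,
    {within S, continuous h} & forall x, Om x -> h x = g x.

(* C^2(S) for an open set Om and Om `<=` S `<=` closure Om: u is C^2 in Om, and
   u and its partial derivatives of order at most 2 are continuous up to S. *)
Definition C2_upto (R : realType) (n : nat) (Om S : set 'rV[R]_n)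
    (u : 'rV[R]_n -> R) : Prop :=
  [/\ {within S, continuous u},
      forall x i, Om x -> derivable (u : 'rV[R]_n -> R^o) x (delta_mx 0 i),
      forall x i j, Om x ->
        derivable (partial i u : 'rV[R]_n -> R^o) x (delta_mx 0 j),
      forall i, extends_continuously Om S (partial i u) &
      forall i j, extends_continuously Om S (partial j (partial i u))].

(* Value at x of the continuous extension of g from Om to its closure; at a
   point of the open set Om where g is continuous this is g x. *)
Definition trace_val (R : realType) (n : nat) (Om : set 'rV[R]_n)
    (g : 'rV[R]_n -> R) (x : 'rV[R]_n) : R :=
  lim (g @ within Om (nbhs x)).

Definition grad_upto (R : realType) (n : nat) (Om : set 'rV[R]_n)
    (u : 'rV[R]_n -> R) (x : 'rV[R]_n) : 'rV[R]_n :=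
  \row_i trace_val Om (partial i u) x.

Definition hess_upto (R : realType) (n : nat) (Om : set 'rV[R]_n)
    (u : 'rV[R]_n -> R) (x : 'rV[R]_n) : 'M[R]_n :=
  \matrix_(i, j) trace_val Om (partial j (partial i u)) x.

(* A[v](x), with the derivatives of v taken up to the boundary of Om. *)
Definition conf_hess (R : realType) (n : nat) (Om : set 'rV[R]_n)
    (v : 'rV[R]_n -> R) (x : 'rV[R]_n) : 'M[R]_n :=
  let g := grad_upto Om v x in
  expR (- (2 * v x)) *:
    (- hess_upto Om v x + g^T *m g - (2^-1 * enorm g ^+ 2)%:M).

(* A choice of ordering of the real eigenvalues of M, with multiplicity. The
   default value 0 is only taken when char_poly M does not split over R, which
   does not happen for symmetric M. *)
Definition eigs (R : realType) (n : nat) (M : 'M[R]_n) : 'rV[R]_n :=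
  xget 0 [set l : 'rV[R]_n | char_poly M = \prod_i ('X - (l 0 i)%:P)].

(* Lebesgue-null subsets of R^n: countable covers by closed boxes of
   arbitrarily small total volume. *)
Definition lebesgue_null (R : realType) (n : nat) (A : set 'rV[R]_n) : Prop :=
  forall e : R, 0 < e -> exists a b : nat -> 'rV[R]_n,
    [/\ forall k i, a k 0 i <= b k 0 i,
        A `<=` \bigcup_k [set x | forall i, a k 0 i <= x 0 i <= b k 0 i] &
        (\sum_(0 <= k <oo) (\prod_i (b k 0 i - a k 0 i))%:E <= e%:E)%E].

Definition ae_on (R : realType) (n : nat) (K : set 'rV[R]_n)
    (P : 'rV[R]_n -> Prop) : Prop :=
  lebesgue_null [set x | K x /\ ~ P x].

Definition symmetric_set (R : realType) (n : nat) (G : set 'rV[R]_n) : Prop :=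
  forall (s : 'S_n) l, G l -> G (col_perm s l).

Definition is_cone (R : realType) (n : nat) (G : set 'rV[R]_n) : Prop :=
  forall (t : R) l, 0 < t -> G l -> G (t *: l).

Definition positive_cone (R : realType) (n : nat) : set 'rV[R]_n :=
  [set l | forall i, 0 < l 0 i].

Definition admissible_cone (R : realType) (n : nat) (G : set 'rV[R]_n) : Prop :=
  [/\ G != set0, G != setT, open G, symmetric_set G & is_cone G]
  /\ (forall l m, G l -> positive_cone m -> G (l + m)).

Definition symmetric_on (R : realType) (n : nat) (G : set 'rV[R]_n)
    (f : 'rV[R]_n -> R) : Prop :=
  forall (s : 'S_n) l, G l -> f (col_perm s l) = f l.

Definition loc_lipschitz_on (R : realType) (n : nat) (G : set 'rV[R]_n)
    (f : 'rV[R]_n -> R) : Prop :=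
  forall K : set 'rV[R]_n, compact K -> K `<=` G ->
    [lipschitz (f : 'rV[R]_n -> R^o) l | l in K].

(* Existence of the partial derivatives a.e. is part of the condition; for a
   locally Lipschitz f it is automatic. *)
Definition loc_strictly_increasing (R : realType) (n : nat)
    (G : set 'rV[R]_n) (f : 'rV[R]_n -> R) : Prop :=
  forall K : set 'rV[R]_n, compact K -> K `<=` G ->
    exists2 c : R, 0 < c & forall i, ae_on K (fun l =>
      derivable (f : 'rV[R]_n -> R^o) l (delta_mx 0 i) /\ c <= partial i f l).

Definition lambda_star (R : realType) (n : nat) : 'rV[R]_n.+1 :=
  \row_i (if i == 0 then 1 else -1).
Arguments lambda_star R n : clear implicits.

(* Main.v *)
(* Write g = u - v, which is at least 0 up to the flat boundary.

   If a barrier phi touches g from below at an interior point, then A[u] is A[v]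
   minus a multiple of the Hessian of phi, up to errors controlled by the first
   jet of phi. A barrier that is very convex in one direction and not too concave
   in the others makes A[u] smaller than A[v] by more than f tolerates, because f
   is locally Lipschitz and strictly increasing. On the flat part of the boundary
   the two boundary conditions bound the normal derivative of g by a multiple of
   g, so a barrier with a large normal derivative cannot touch there. Quadratic
   barriers first give g > 0 on the punctured flat boundary (a Hopf lemma), and
   then barriers of the form - e + a |x|^2 + k |x| + b x_n give g >= rho |x| near 0.

   This linear growth leaves room for the barrier
   delta + e ln |x|^2 + k |x| + b x_n, which is negative near 0. Where it touches
   g, its contribution dominates A[u] and, up to a small relative error, A[u] is
   bounded above by a positive multiple of a matrix with eigenvalues
   (1, -1, ..., -1); this is incompatible with the eigenvalues of A[u] lying in
   Gam. Letting e tend to 0 gives g >= delta near 0. *)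
Require Import Defs.
From mathcomp Require Import all_boot all_order all_algebra all_fingroup.
From mathcomp Require Import all_classical all_reals all_analysis.
From mathcomp Require Import measurable_realfun spectral sesquilinear.
From mathcomp Require complex.
From mathcomp Require Import ring lra.
Import Order.TTheory GRing.Theory Num.Theory.
Import numFieldNormedType.Exports.
Local Open Scope classical_set_scope.
Local Open Scope ring_scope.

(** * Quadratic forms and ordered eigenvalues *)

(** The derivative bound on [f] holds only almost everywhere, so it says nothing on a prescribed
    segment. Its integrated form is recovered by averaging over parallel segments; afterwards [f]
    enters only through two inequalities on boxes of [Gam]. Touching estimates are inequalities
    between quadratic forms, which Weyl monotonicity turns into inequalities between ordered
    eigenvalues.

    In the singular barrier e tends to 0, so the logarithm alone gives no lower bound on the barrier
    gradient that is uniform in e, and the fixed error coming from A[v] could not be absorbed. The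
    term k|x| keeps the radial part of the gradient at least k, with curvature k/|x|, large near 0.
    Its price is paid on the sphere |x| = r by the linear growth: rho r = rho r/4 + rho r/2 + rho
    r/4 is shared by delta, k|x| and b x_n. The growth in turn needs the Hopf lemma, because spheres
    around 0 reach the flat boundary, where at first only g >= 0 is known. Since u may be unbounded
    near 0, the last contradiction is taken in the cone, for which exp(-2u) is a harmless positive
    scale. *)

Definition qf {R : pzRingType} {n} (M : 'M[R]_n) (x : 'rV[R]_n) : R :=
  (x *m M *m x^T) 0 0.

Lemma qfD {R : pzRingType} {n} (M M' : 'M[R]_n) x : qf (M + M') x = qf M x + qf M' x.
Proof. by rewrite /qf mulmxDr mulmxDl mxE. Qed.

Lemma qfN {R : pzRingType} {n} (M : 'M[R]_n) x : qf (- M) x = - qf M x.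
Proof. by rewrite /qf mulmxN mulNmx mxE. Qed.

Lemma qfB {R : pzRingType} {n} (M M' : 'M[R]_n) x : qf (M - M') x = qf M x - qf M' x.
Proof. by rewrite qfD qfN. Qed.

Lemma qfZ {R : comPzRingType} {n} k (M : 'M[R]_n) x : qf (k *: M) x = k * qf M x.
Proof. by rewrite /qf -scalemxAr -scalemxAl mxE. Qed.

Lemma qfE {R : pzRingType} {n} (M : 'M[R]_n) x :
  qf M x = \sum_i \sum_j x 0 i * M i j * x 0 j.
Proof.
rewrite /qf mxE exchange_big; apply: eq_bigr => j _ /=.
rewrite mxE mulr_suml; apply: eq_bigr => i _; by rewrite mxE.
Qed.

Definition sqn {R : pzRingType} {n} (x : 'rV[R]_n) : R := \sum_i x 0 i ^+ 2.
Definition dot {R : pzRingType} {n} (x y : 'rV[R]_n) : R := \sum_i x 0 i * y 0 i.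

Lemma qf_scalar {R : comPzRingType} {n} k (x : 'rV[R]_n) : qf k%:M x = k * sqn x.
Proof.
rewrite /qf mul_mx_scalar -scalemxAl !mxE; congr (_ * _).
by apply: eq_bigr => i _; rewrite mxE -expr2.
Qed.

Lemma qf_tens {R : comPzRingType} {n} (p q x : 'rV[R]_n) :
  qf (p^T *m q) x = dot p x * dot q x.
Proof.
rewrite /qf mulmxA -mulmxA mxE big_ord1 !mxE; congr (_ * _).
  by apply: eq_bigr => i _; rewrite mxE mulrC.
by apply: eq_bigr => i _; rewrite mxE.
Qed.

Lemma qf_delta {R : comPzRingType} {n} (k : 'I_n) (x : 'rV[R]_n) :
  qf (delta_mx k k) x = x 0 k ^+ 2.
Proof.
rewrite qfE (bigD1 k)//= (bigD1 k)//= mxE !eqxx mulr1 -expr2.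
rewrite big1 ?addr0 => [|j jk]; last by rewrite mxE (negbTE jk) andbF mulr0 mul0r.
rewrite big1 ?addr0// => i ik; rewrite big1// => j _.
by rewrite mxE (negbTE ik) mulr0 mul0r.
Qed.

Section Spectrum.
Import complex.
Local Open Scope sesquilinear_scope.
Context {R : rcfType}.
Notation C := (R[i]%C).
Notation toC := (real_complex R).

(* The eigenvalues in decreasing order; the diagonalization is over R[i], where
   the spectral theorem is available. *)
Definition sorted_spec {n} (M : 'M[R]_n) (l : 'rV[R]_n) : Prop :=
  (forall i j : 'I_n, (i <= j)%N -> l 0 j <= l 0 i) /\
  exists2 P : 'M[C]_n, P \is unitarymx &
    map_mx toC M = P^t* *m diag_mx (map_mx toC l) *m P.

Notation cRe := (@complex.Re R).
Notation cIm := (@complex.Im R).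

Definition nrm2 (z : C) : R := cRe z ^+ 2 + cIm z ^+ 2.

Lemma nrm2_ge0 z : 0 <= nrm2 z.
Proof. by rewrite addr_ge0 ?sqr_ge0. Qed.

Lemma nrm2_eq0 z : (nrm2 z == 0) = (z == 0).
Proof.
by case: z => a b; rewrite /nrm2 paddr_eq0 ?sqr_ge0// !sqrf_eq0 eq_complex.
Qed.

Lemma Re_sum I (r : seq I) (F : I -> C) :
  cRe (\sum_(i <- r) F i) = \sum_(i <- r) cRe (F i).
Proof. by elim/big_rec2: _ => [//|i y1 y2 _ <-]; case: (F i) y2 => a b []. Qed.

Lemma ReMr (k : R) (x y : C) :
  cRe (x * toC k * (Num.conj y)) = k * (cRe x * cRe y + cIm x * cIm y).
Proof. by case: x => a b; case: y => c d /=; ring. Qed.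

(** Lets inequalities between real quadratic forms be used on complex vectors: taking the real part
    removes the products of a real part with an imaginary part. *)
Lemma qf_complex {n} (M : 'M[R]_n) (x : 'rV[C]_n) :
  qf M (map_mx cRe x) + qf M (map_mx cIm x) =
  cRe ((x *m map_mx toC M *m x^t*) 0 0).
Proof.
rewrite !qfE mxE Re_sum exchange_big/= [X in _ + X]exchange_big/= -big_split.
apply: eq_bigr => j _ /=.
rewrite [(_ *m _) 0 j]mxE mulr_suml Re_sum -big_split; apply: eq_bigr => i _ /=.
by rewrite !mxE ReMr; ring.
Qed.

Lemma qf_spectral {n} (M : 'M[R]_n) (l : 'rV[R]_n) (P : 'M[C]_n) (x : 'rV[C]_n) :
  map_mx toC M = P^t* *m diag_mx (map_mx toC l) *m P ->
  qf M (map_mx cRe x) + qf M (map_mx cIm x) =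
  \sum_i l 0 i * nrm2 ((x *m P^t*) 0 i).
Proof.
move=> MP; rewrite qf_complex MP.
have -> : x *m (P^t* *m diag_mx (map_mx toC l) *m P) *m x^t* =
    (x *m P^t*) *m diag_mx (map_mx toC l) *m (x *m P^t*)^t*.
  by rewrite trmx_mul map_mxM trmxCK !mulmxA.
rewrite mul_mx_diag mxE Re_sum; apply: eq_bigr => i _.
by rewrite !mxE ReMr /nrm2 !expr2.
Qed.

(** The spectral theorem gives real eigenvalues in no particular order. Sorting them yields a
    permutation, and the rows of the unitary matrix are permuted by it as well. *)
Lemma sorted_spec_exists {n} (M : 'M[R]_n) : M^T = M -> exists l, sorted_spec M l.
Proof.
move=> Msym.
have Mherm : map_mx toC M \is hermsymmx.
  apply: realsym_hermsym.
    apply/is_hermitianmxP; rewrite expr0 scale1r map_mx_id//.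
    by rewrite map_trmx Msym.
  by apply/mxOverP => i j; rewrite mxE; apply/complex_realP; exists (M i j).
have /hermitian_normalmx /orthomx_spectralP := Mherm.
rewrite invmx_unitary ?spectral_unitarymx //.
have := spectral_unitarymx (map_mx toC M).
have := hermitian_spectral_diag_real Mherm.
move: (spectralmx _) (spectral_diag _) => P d dreal Pu Md.
pose l0 : 'rV[R]_n := \row_i cRe (d 0 i).
have dl0 : d = map_mx toC l0.
  apply/rowP => i; rewrite !mxE; apply/esym/RRe_real.
  by move/mxOverP : dreal => /(_ 0 i).
pose t := [tuple l0 0 i | i < n].
have [s ts] : exists s : 'S_n, sort (>=%R) t = [tuple tnth t (s i) | i < n].
  by apply/tuple_permP; rewrite perm_sort.
exists (col_perm s l0); split.
  move=> i j ij.
  have cE (k : 'I_n) : col_perm s l0 0 k = l0 0 (s k) by rewrite [LHS]mxE.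
  have E (k : 'I_n) : l0 0 (s k) = nth 0 (sort (>=%R) t) k.
    by rewrite ts (nth_map k) ?size_enum_ord// nth_ord_enum !tnth_mktuple.
  rewrite !cE !E.
  have := @sorted_leq_nth _ (>=%R) _ _ 0 (sort (>=%R) t).
  apply => //.
  - by move=> x y z /= yx xz; apply: (le_trans xz).
  - by move=> x; exact: lexx.
  - by apply: sort_sorted => x y; exact: le_total.
  - by rewrite inE ts size_map size_enum_ord.
  - by rewrite inE ts size_map size_enum_ord.
exists (row_perm s P).
  rewrite row_permE; apply: mul_unitarymx; last exact: Pu.
  apply/unitarymxP.
  by rewrite tr_perm_mx map_perm_mx -perm_mxM mulgV perm_mx1.
rewrite Md dl0; apply/matrixP => i j; rewrite !mul_mx_diag !mxE.
rewrite (reindex_inj (@perm_inj _ s)); apply: eq_bigr => k _.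
by rewrite !mxE.
Qed.

(** The bridge to [eigs], which is specified through the characteristic polynomial alone. *)
Lemma sorted_spec_char_poly {n} (M : 'M[R]_n) l :
  sorted_spec M l -> char_poly M = \prod_i ('X - (l 0 i)%:P).
Proof.
move=> [_ [P Pu MP]].
apply: (map_poly_inj toC); rewrite map_char_poly MP.
rewrite -(invmx_unitary Pu).
have -> : char_poly (invmx P *m diag_mx (map_mx toC l) *m P) =
          char_poly (diag_mx (map_mx toC l)).
  have PP : (map_mx polyC (invmx P)) *m map_mx polyC P = 1%:M.
    by rewrite -map_mxM mulVmx ?unitarymx_unit// map_mx1.
  rewrite /char_poly /char_poly_mx !map_mxM.
  have -> : 'X%:M - map_mx polyC (invmx P) *m map_mx polyC (diag_mx (map_mx toC l))
       *m map_mx polyC P = map_mx polyC (invmx P) *m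
     ('X%:M - map_mx polyC (diag_mx (map_mx toC l))) *m map_mx polyC P.
    rewrite mulmxBr mulmxBl; congr (_ - _).
    by rewrite mul_mx_scalar -scalemxAl PP scalemx1.
  by rewrite !det_mulmx mulrAC -det_mulmx PP det1 mul1r.
rewrite char_poly_trig ?diag_mx_is_trig// rmorph_prod/=.
by apply: eq_bigr => i _; rewrite rmorphB/= map_polyX map_polyC/= !mxE eqxx mulr1n.
Qed.

Lemma sorted_spec_trace {n} (M : 'M[R]_n) l : sorted_spec M l -> \tr M = \sum_i l 0 i.
Proof.
move=> [_ [P /unitarymxP Pu MP]]; apply: (@complexI R).
rewrite -[LHS](@trace_map_mx _ _ toC) MP mxtrace_mulC mulmxA Pu mul1mx mxtrace_diag rmorph_sum.
by apply: eq_bigr => i _; rewrite mxE.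
Qed.

Lemma sorted_specD {n} (M : 'M[R]_n) l t :
  sorted_spec M l -> sorted_spec (M + t%:M) (l + const_mx t).
Proof.
move=> [lS [P Pu MP]]; split=> [i j ij|]; first by rewrite !mxE lerD2r lS.
exists P; [exact: Pu|rewrite map_mxD MP map_mxD raddfD/= mulmxDr mulmxDl; congr (_ + _)].
rewrite map_scalar_mx map_const_mx diag_const_mx mul_mx_scalar -scalemxAl.
move/unitarymxP: Pu => /mulmx1C ->; by rewrite scalemx1.
Qed.

Lemma sorted_specZ {n} (M : 'M[R]_n) l k : 0 <= k ->
  sorted_spec M l -> sorted_spec (k *: M) (k *: l).
Proof.
move=> k0 [lS [P Pu MP]]; split=> [i j ij|]; first by rewrite !mxE ler_wpM2l ?lS.
exists P; first exact: Pu.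
by rewrite map_mxZ MP map_mxZ/= linearZ/= -scalemxAr -scalemxAl.
Qed.

(* Courant-Fischer by a dimension count: the span of the first k+1 eigenvectors
   of M meets the span of the last n-k eigenvectors of M'. *)
Lemma weyl {n} (M M' : 'M[R]_n) l l' :
  sorted_spec M l -> sorted_spec M' l' -> (forall x, qf M x <= qf M' x) ->
  forall k, l 0 k <= l' 0 k.
Proof.
move=> [lS [P Pu MP]] [lS' [P' Pu' MP']] MM' k.
have rowsub_unitary (m : nat) (f : 'I_m -> 'I_n) (Q : 'M[C]_n) : injective f ->
    Q \is unitarymx -> rowsub f Q \is unitarymx.
  move=> finj /unitarymxP QQ; apply/unitarymxP.
  apply/matrixP => i j; have /matrixP/(_ (f i) (f j)) := QQ.
  rewrite !mxE (inj_eq finj) => <-; by apply: eq_bigr => q _; rewrite !mxE.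
pose f (i : 'I_k.+1) : 'I_n := widen_ord (ltn_ord k) i.
have finj : injective f by move=> i j /(congr1 val) /= /val_inj.
have ltg (i : 'I_(n - k)) : (k + i < n)%N by rewrite -ltn_subRL.
pose g (i : 'I_(n - k)) : 'I_n := Ordinal (ltg i).
have ginj : injective g by move=> i j /(congr1 val) /= /addnI /val_inj.
have rA := mxrank_unitary (rowsub_unitary _ f P finj Pu).
have rB := mxrank_unitary (rowsub_unitary _ g P' ginj Pu').
have := mxrank_sum_cap (rowsub f P) (rowsub g P').
rewrite rA rB addSn subnKC 1?ltnW// => rk.
have capN0 : (rowsub f P :&: rowsub g P')%MS != 0.
  apply/eqP => cap0; move: rk; rewrite cap0 mxrank0 addn0 => rk.
  by have := rank_leq_col (rowsub f P + rowsub g P')%MS; rewrite rk ltnn.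
have /rowV0Pn[x xcap x0] := capN0.
move: xcap; rewrite sub_capmx => /andP[/submxP[a xa] /submxP[b xb]].
have proj (Q : 'M[C]_n) (m : nat) (h : 'I_m -> 'I_n) (c : 'rV_m) i :
    Q \is unitarymx -> x = c *m rowsub h Q -> (forall j, h j <> i) ->
    (x *m Q^t*) 0 i = 0.
  move=> /unitarymxP QQ -> hi; rewrite -mulmxA mul_rowsub_mx QQ mxE big1// => j _.
  by rewrite !mxE; case: eqP => [/hi//|_]; rewrite mulr0.
have y0 (i : 'I_n) : (k < i)%N -> (x *m P^t*) 0 i = 0.
  move=> ki; apply: (proj _ _ f a) => // j /(congr1 val) /= ji.
  by have := ltn_ord j; rewrite ji ltnS leqNgt ki.
have z0 (i : 'I_n) : (i < k)%N -> (x *m P'^t*) 0 i = 0.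
  move=> ki; apply: (proj _ _ g b) => // j /(congr1 val) /= ji.
  by move: ki; rewrite -ji ltnNge leq_addr.
have one (Q : 'M[C]_n) : Q \is unitarymx -> \sum_i nrm2 ((x *m Q^t*) 0 i) =
    qf 1%:M (map_mx cRe x) + qf 1%:M (map_mx cIm x).
  move=> Qu; rewrite (qf_spectral _ (const_mx 1) Q); last first.
    rewrite map_mx1 map_const_mx diag_const_mx mulmx1.
    by have /unitarymxP/mulmx1C -> := Qu.
  by apply: eq_bigr => i _; rewrite [X in _ = X * _]mxE mul1r.
have Spos : 0 < \sum_i nrm2 ((x *m P^t*) 0 i).
  rewrite lt_neqAle sumr_ge0 ?andbT => [|i _]; last exact: nrm2_ge0.
  apply: contra x0; rewrite eq_sym psumr_eq0 => [/allP xP|i _]; last exact: nrm2_ge0.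
  have xP0 : x *m P^t* = 0.
    by apply/rowP => i; rewrite [RHS]mxE; have := xP i (mem_index_enum _); rewrite nrm2_eq0 => /eqP.
  by rewrite -[x]mulmx1 -(mulmx1C (unitarymxP Pu)) mulmxA xP0 mul0mx.
(* The common vector x is complex, so the hypothesis is applied to its real and imaginary parts and
   the two inequalities are added. *)
have := lerD (MM' (map_mx cRe x)) (MM' (map_mx cIm x)).
rewrite (qf_spectral _ _ _ _ MP) (qf_spectral _ _ _ _ MP').
have L : l 0 k * (\sum_i nrm2 ((x *m P^t*) 0 i)) <=
    \sum_i l 0 i * nrm2 ((x *m P^t*) 0 i).
  rewrite mulr_sumr ler_sum// => i _; have [ki|ik] := ltnP k i.
    by rewrite y0// (eqP (_ : nrm2 0 == 0)) ?mulr0// nrm2_eq0.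
  by rewrite ler_wpM2r ?nrm2_ge0 ?lS.
have L' : \sum_i l' 0 i * nrm2 ((x *m P'^t*) 0 i) <=
    l' 0 k * (\sum_i nrm2 ((x *m P'^t*) 0 i)).
  rewrite mulr_sumr ler_sum// => i _; have [ki|ik] := ltnP i k.
    by rewrite z0// (eqP (_ : nrm2 0 == 0)) ?mulr0// nrm2_eq0.
  by rewrite ler_wpM2r ?nrm2_ge0 ?lS'.
move=> LL'; have := le_trans (le_trans L LL') L'.
by rewrite (one _ Pu') -(one _ Pu) ler_pM2r.
Qed.

(** The matrix is a reflection up to sign: its square is the identity, so its eigenvalues are 1 or
    -1, and by the trace the numbers [l 0 i + 1] sum to 2. Hence exactly one eigenvalue is 1, and
    the ordering puts it first. *)
Lemma sorted_spec_lambda_star {n} (q : 'rV[R]_n.+1) l : sqn q = 1 ->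
  sorted_spec (2 *: (q^T *m q) - 1%:M) l ->
  forall i, l 0 i <= (if i == 0 then 1 else -1).
Proof.
move=> q1 lS.
have qq : q *m q^T = 1%:M.
  apply/matrixP => i j; rewrite !ord1 !mxE eqxx -q1.
  by apply: eq_bigr => k _; rewrite !mxE.
have JJ : (2 *: (q^T *m q) - 1%:M) *m (2 *: (q^T *m q) - 1%:M) = 1%:M.
  rewrite mulmxBr mulmx1 mulmxBl mul1mx -scalemxAr -scalemxAl mulmxA -(mulmxA _ q).
  rewrite qq mulmx1 scalerA; apply/matrixP => i j; rewrite !mxE; ring.
have l1 i : l 0 i = 1 \/ l 0 i = -1.
  have : eigenvalue (2 *: (q^T *m q) - 1%:M) (l 0 i).
    rewrite eigenvalue_root_char (sorted_spec_char_poly _ _ lS).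
    by rewrite /root horner_prod; apply/prodf_eq0; exists i; rewrite // !hornerE subrr.
  move=> /eigenvalueP [w wJ w0].
  have : w *m ((2 *: (q^T *m q) - 1%:M) *m (2 *: (q^T *m q) - 1%:M)) = (l 0 i ^+ 2) *: w.
    by rewrite mulmxA wJ -scalemxAl wJ scalerA.
  rewrite JJ mulmx1 => /eqP; rewrite -{1}[w]scale1r -subr_eq0 -scalerBl scaler_eq0.
  by rewrite (negbTE w0) orbF subr_eq0 eq_sym sqrf_eq1 => /orP[] /eqP; [left|right].
have tr : \sum_i (l 0 i + 1) = 2.
  rewrite big_split/= -(sorted_spec_trace _ _ lS) sumr_const card_ord raddfB/=.
  by rewrite linearZ/= mxtrace_mulC qq !mxtrace1; ring.
move=> i; have [->|i0] := eqVneq i 0; first by case: (l1 0) => ->; lra.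
case: (l1 i) => li; last by rewrite li.
have l0 : l 0 0 = 1 by case: (l1 0) => // l0; have := lS.1 0 i (leq0n _); lra.
have : 2 <= \sum_(j | j != 0) (l 0 j + 1).
  rewrite (bigD1 i)//= li -[X in X <= _]addr0 lerD// sumr_ge0// => j _.
  by case: (l1 j) => ->; lra.
by move: tr; rewrite (bigD1 0)//= l0; lra.
Qed.
End Spectrum.

(** The vector l itself shows that the polynomial splits, so [eigs] does not take its default value;
    factorization into linear factors is unique up to order. *)
Lemma sorted_spec_eigs {R : realType} {n} (M : 'M[R]_n) l :
  sorted_spec M l -> exists s : 'S_n, l = col_perm s (eigs M).
Proof.
move=> /sorted_spec_char_poly Ml.
have : char_poly M = \prod_i ('X - (eigs M 0 i)%:P).
  by rewrite /eigs; case: xgetP => [x -> //|/(_ l)].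
rewrite Ml => E.
have : perm_eq [tuple l 0 i | i < n] [tuple eigs M 0 i | i < n].
  apply: prod_XsubC_eq; rewrite !big_tuple.
  under eq_bigr do rewrite tnth_mktuple.
  under [RHS]eq_bigr do rewrite tnth_mktuple.
  exact: E.
move=> /tuple_permP[s ls]; exists s; apply/rowP => i; rewrite mxE.
have /val_inj/(congr1 (fun t => tnth t i)) := ls.
by rewrite !tnth_mktuple.
Qed.

(** * Growth of f on boxes *)

(** Take the supremum m of the points x with [G s <= G x]. The Lipschitz bound keeps m in this set,
    and local growth to the right of m would push past it unless m = t. *)
Lemma le_of_right_local_growth {R : realType} (G : R -> R) (s t K : R) :
  s <= t -> 0 < K ->
  (forall x y, s <= x <= t -> s <= y <= t -> `|G x - G y| <= K * `|x - y|) ->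
  (forall x, s <= x < t -> exists2 h0, 0 < h0 & forall h, 0 < h < h0 -> G x <= G (x + h)) ->
  G s <= G t.
Proof.
move=> st K0 GK loc.
pose A := [set x | s <= x <= t /\ G s <= G x].
have As : A s by split=> //; rewrite lexx.
have ubA : ubound A t by move=> x [/andP[]].
have supA : has_sup A by split; [exists s | exists t].
pose m := sup A.
have sm : s <= m by apply: ub_le_sup => //; exists t.
have mt : m <= t by apply: ge_sup => //; exists s.
have Gm : G s <= G m.
  apply/ler_addgt0Pl => e e0.
  have eK : 0 < e / K by rewrite divr_gt0.
  have [a [/andP[sa ta] Ga] ma] := sup_adherent eK supA.
  have am : a <= m by apply: ub_le_sup => //; [exists t | split=> //; rewrite sa].
  have := GK a m; rewrite sa ta sm mt => /(_ isT isT).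
  rewrite ler_norml => /andP[_]; rewrite distrC ger0_norm ?subr_ge0//.
  have : K * (m - a) < K * (e / K) by rewrite ltr_pM2l// /m; lra.
  rewrite mulrCA divff ?gt_eqF// mulr1; lra.
have [->//|m_neq_t] := eqVneq t m.
have mt' : m < t by rewrite lt_neqAle eq_sym m_neq_t.
have [h0 h00 hG] := loc m (introT andP (conj sm mt')).
pose h := Num.min (h0 / 2) (t - m).
have h_gt0 : 0 < h by rewrite lt_min divr_gt0//= subr_gt0.
have hh0 : h < h0 by rewrite gt_min; apply/orP; left; rewrite ltr_pdivrMr//; lra.
have hmt : h <= t - m by rewrite ge_min lexx orbT.
have Amh : A (m + h).
  split; first by apply/andP; split; lra.
  by apply: le_trans Gm _; apply: hG; rewrite h_gt0.
have : m + h <= m by apply: ub_le_sup => //; exists t.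
lra.
Qed.

(* The increment of g is compared with c times the length; on an open set of
   small measure covering V one only knows |g'| <= L, and the deficit L + c
   there is paid for by the measure of that set. *)
Lemma lipschitz_growth {R : realType} (g : R -> R) (s t L c M : R) (V : set R) :
  s <= t -> 0 <= c -> 0 <= L ->
  (forall x y, s <= x <= t -> s <= y <= t -> `|g x - g y| <= L * `|x - y|) ->
  measurable V -> (lebesgue_measure V <= M%:E)%E ->
  (forall x, s <= x < t -> ~ V x -> derivable (g : R -> R^o) x 1 /\ c <= 'D_1 (g : R -> R^o) x) ->
  c * (t - s) - (L + c) * M <= g t - g s.
Proof.
move=> st c0 L0 gL mV VM gV.
(* The slack e is spent twice: on an open set containing V of measure at most M + e, and on the
   slope, since a derivative at least c only makes nearby difference quotients exceed c - e. *)
suff main (e : R) : 0 < e -> (c - e) * (t - s) - (L + c) * (M + e) <= g t - g s.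
  pose D := t - s + L + c + 1.
  have D0 : 0 < D by rewrite /D; lra.
  apply/ler_addgt0Pl => e e0; have := main (e / D); rewrite divr_gt0// => /(_ isT).
  have : e / D * (t - s + L + c) <= e.
    by rewrite mulrAC ler_pdivrMr// ler_pM2l// /D; lra.
  by move: (e / D) => d; nra.
move=> e0.
have Vfin : (lebesgue_measure V < +oo)%E by rewrite (le_lt_trans VM) ?ltry.
have [U [oU VU UV]] := lebesgue_regularity_outer mV Vfin e0.
have mU : measurable U by exact: open_measurable.
have UM : (lebesgue_measure U <= (M + e)%:E)%E.
  rewrite -(setDUK VU) (le_trans (measureU2 _ _ _))//; first exact: measurableD.
  by rewrite EFinD leeD// ltW.
pose mu := @lebesgue_measure R.
pose psi x := fine (mu (U `&` `[s, x])).
have le_mu (X Y : set R) : measurable X -> measurable Y -> X `<=` Y -> (mu X <= mu Y)%E.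
  by move=> mX mY XY; apply: le_measure; rewrite ?inE.
have mUx x : measurable (U `&` `[s, x]) by apply: measurableI.
have UxM x : (mu (U `&` `[s, x]%classic) <= (M + e)%:E)%E.
  by apply: le_trans UM; apply: le_mu => //; exact: subIsetl.
have psiE x : mu (U `&` `[s, x]%classic) = (psi x)%:E.
  by rewrite /psi fineK// ge0_fin_numE ?(le_lt_trans (UxM x)) ?ltry.
have psi_ge0 x : 0 <= psi x by rewrite -lee_fin -psiE.
have psi_le x : psi x <= M + e by rewrite -lee_fin -psiE.
have mu_oc x y : x <= y -> mu `]x, y]%classic = (y - x)%:E.
  move=> xy; rewrite /mu lebesgue_measure_itv/= lte_fin; case: ltP => // yx.
  have -> : x = y by apply: le_anti; rewrite xy yx.
  by rewrite subrr.
have psi_incr x y : x <= y -> psi x <= psi y.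
  move=> xy; rewrite -lee_fin -!psiE; apply: le_mu => //.
  by apply: setIS => z /=; rewrite !in_itv/= => /andP[-> /le_trans->].
have psi_lip x y : s <= x -> x <= y -> psi y <= psi x + (y - x).
  move=> sx xy; rewrite -lee_fin EFinD -!psiE -mu_oc//.
  apply: (@le_trans _ _ (mu ((U `&` `[s, x]) `|` `]x, y])%classic)); last by apply: measureU2; [exact: mUx|exact: measurable_itv].
  apply: le_mu => //; first exact: measurableU.
  move=> z [Uz] /=; rewrite in_itv/= => /andP[sz zy].
  have [zx|xz] := leP z x; [left|right]; last by rewrite /= in_itv/= xz zy.
  by split => //; rewrite /= in_itv/= sz zx.
have psi_U x y : s <= x -> x <= y -> `]x, y]%classic `<=` U -> psi x + (y - x) <= psi y.
  move=> sx xy xyU; rewrite -lee_fin EFinD -!psiE -mu_oc//.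
  have dis : (U `&` `[s, x]) `&` `]x, y] = set0 :> set R.
    apply/seteqP; split=> // z [[_]] /=; rewrite !in_itv/= => /andP[_ zx] /andP[xz _].
    by have := le_lt_trans zx xz; rewrite ltxx.
  rewrite -(measureU mu (mUx x) (measurable_itv `]x, y]) dis).
  apply: le_mu => //; first exact: measurableU.
  move=> z [[Uz]|xz] /=.
    by rewrite in_itv/= => /andP[sz zx]; split => //; rewrite /= in_itv/= sz (le_trans zx).
  split; first exact: xyU.
  by move: xz; rewrite /= !in_itv/= => /andP[xz ->]; rewrite (le_trans sx (ltW xz)).
(* [psi] measures the part of U passed so far. Inside U it has slope 1, so the last term outweighs
   both the possible fall of g at rate L and the subtracted slope c - e; outside U the derivative of
   g suffices. Hence G grows locally to the right everywhere. *)
pose G x := g x - (c - e) * (x - s) + (L + c) * psi x.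
have : G s <= G t.
  apply: (@le_of_right_local_growth _ G s t (L + `|c - e| + (L + c) + 1)) => //.
  - by have := normr_ge0 (c - e); lra.
  - suff H x y : s <= x <= t -> s <= y <= t -> x <= y ->
        `|G x - G y| <= (L + `|c - e| + (L + c) + 1) * `|x - y|.
      move=> x y xst yst; have [xy|/ltW yx] := leP x y; first exact: H.
      by rewrite distrC (distrC x); apply: H.
    move=> xst yst xy.
    have -> : G x - G y = (g x - g y) - (c - e) * (x - y) + (L + c) * (psi x - psi y).
      by rewrite /G; ring.
    apply: le_trans (ler_normD _ _) _; rewrite normrM (ger0_norm (_ : 0 <= L + c)) ?addr_ge0//.
    have A1 : `|g x - g y - (c - e) * (x - y)| <= L * `|x - y| + `|c - e| * `|x - y|.
      by apply: le_trans (ler_normB _ _) _; rewrite normrM lerD2r gL.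
    have A2 : `|psi x - psi y| <= `|x - y|.
      move: xst yst => /andP[sx _] _.
      rewrite distrC (distrC x) !ger0_norm ?subr_ge0 ?psi_incr//.
      by rewrite lerBlDl psi_lip.
    have : (L + c) * `|psi x - psi y| <= (L + c) * `|x - y| by rewrite ler_wpM2l ?addr_ge0.
    by have := normr_ge0 (x - y); lra.
  - move=> x xst; have [sx xt] := andP xst; have [Ux|nUx] := pselect (U x).
      have : nbhs x U by exact: open_nbhs_nbhs.
      move=> /nbhs_ballP[r /= r0 xrU].
      exists (Num.min r (t - x)); first by rewrite lt_min r0 subr_gt0.
      move=> h /andP[h0]; rewrite lt_min => /andP[hr htx].
      have := psi_U x (x + h) sx; rewrite lerDl (ltW h0) => /(_ isT).
      have xhU : `]x, x + h]%classic `<=` U.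
        move=> z /=; rewrite in_itv/= => /andP[xz zh]; apply: xrU.
        by rewrite /ball/= distrC ger0_norm ?subr_ge0 1?ltW//; lra.
      move=> /(_ xhU).
      have := gL x (x + h); rewrite sx (ltW xt) => /(_ isT).
      have -> : s <= x + h <= t by apply/andP; split; lra.
      move=> /(_ isT); rewrite distrC [x + h]addrC addrK (distrC x) addrK.
      rewrite (gtr0_norm h0) ler_norml => /andP[+ _].
      rewrite /G [h + x]addrC.
      move: (psi x) (psi (x + h)) (g x) (g (x + h)) => p1 p2 g1 g2 g12 p12.
      have : (L + c) * (p1 + h) <= (L + c) * p2 by rewrite ler_wpM2l ?addr_ge0.
      nra.
    have nVx : ~ V x by move=> /VU.
    have [dg cg] := gV x xst nVx.
    have /cvgr_gt/(_ (c - e)) := dg.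
    have -> : c - e < 'D_1 (g : R -> R^o) x by lra.
    move=> /(_ isT); rewrite near_withinE => /nbhs_ballP[r /= r0 rP].
    exists r => // h /andP[h0 hr].
    have := rP h; rewrite /ball/= sub0r normrN (gtr0_norm h0) => /(_ hr).
    rewrite gt_eqF// => /(_ isT); rewrite /GRing.scale/= mulr1 [h + x]addrC.
    rewrite ltr_pdivlMl// => gh.
    have : (L + c) * psi x <= (L + c) * psi (x + h).
      by rewrite ler_wpM2l ?addr_ge0// psi_incr// lerDl ltW.
    rewrite /G; move: gh; nra.
rewrite /G subrr mulr0 subr0.
have : (L + c) * psi t <= (L + c) * (M + e) by rewrite ler_wpM2l ?addr_ge0.
have : 0 <= (L + c) * psi s by rewrite mulr_ge0 ?addr_ge0.
lra.
Qed.

(** Fubini for a countable family of boxes: if every transverse point y is met by boxes of total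
    weight at least m, the total volume is at least m times the transverse volume. The induction
    integrates one coordinate at a time, and the weights w absorb the widths of the coordinates
    already integrated. *)
Lemma slices {R : realType} {I : eqType} (r : seq I) (a b : nat -> I -> R)
    (p q : I -> R) (w : nat -> R) (m : R) :
  uniq r -> (forall k, 0 <= w k) -> (forall k i, a k i <= b k i) ->
  (forall i, p i <= q i) -> 0 <= m ->
  (forall y : I -> R, (forall i, p i <= y i <= q i) ->
    (m%:E <= \sum_(0 <= k <oo)
      (w k * \prod_(j <- r) \1_(`[a k j, b k j]%classic) (y j))%:E)%E) ->
  ((m * \prod_(j <- r) (q j - p j))%:E <=
    \sum_(0 <= k <oo) (w k * \prod_(j <- r) (b k j - a k j))%:E)%E.
Proof.
elim: r w m => [|j r IH] w m.
  move=> _ w0 ab pq m0 /(_ p); rewrite !big_nil mulr1.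
  under eq_eseriesr do rewrite big_nil.
  under [in X in _ -> X]eq_eseriesr do rewrite big_nil.
  by apply => i; rewrite lexx pq.
rewrite cons_uniq => /andP[jr ur] w0 ab pq m0 H.
rewrite big_cons mulrA.
under eq_eseriesr do rewrite big_cons mulrA.
apply: IH => //.
- by move=> k; rewrite mulr_ge0// subr_ge0.
- by rewrite mulr_ge0// subr_ge0.
move=> y yP.
pose c k := w k * \prod_(i <- r) \1_(`[a k i, b k i]%classic) (y i).
have c0 k : 0 <= c k.
  by rewrite mulr_ge0// prodr_ge0// => i _; rewrite indicE.
have H1 (t : R) : p j <= t <= q j ->
    (m%:E <= \sum_(0 <= k <oo) (c k * \1_(`[a k j, b k j]%classic) t)%:E)%E.
  move=> tP; have := H (fun i => if i == j then t else y i).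
  under eq_eseriesr.
    move=> k _; rewrite big_cons eqxx.
    under eq_big_seq.
      move=> i ir; rewrite (_ : (i == j) = false); last first.
        by apply/negbTE; apply: contra jr => /eqP <-.
    over.
    rewrite mulrCA mulrC -/(c k).
  over.
  by apply => i; case: eqP => [->|].
have mi (u v : R) : measurable `[u, v]%classic by [].
pose mu := @lebesgue_measure R.
(* The pointwise bound [H1] is integrated over t. On the right the sum and the integral are
   exchanged, and each indicator contributes at most the width of its box in direction j. *)
have I1 : ((m * (q j - p j))%:E = \int[mu]_(t in `[p j, q j]) m%:E)%E.
  rewrite integral_cst//= /mu lebesgue_measure_itv/= lte_fin EFinM; congr (_ * _)%E.
  case: ltP => // qp; have -> : p j = q j by apply: le_anti; rewrite pq qp.
  by rewrite subrr.
rewrite I1.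
have mf k : measurable_fun `[p j, q j]%classic
    (EFin \o (fun t : R => c k * \1_(`[a k j, b k j]%classic) t)).
  apply/measurable_EFinP; apply: measurable_funM.
    exact: measurable_cst.
  have := @measurable_indic _ _ R `[p j, q j]%classic `[a k j, b k j]%classic.
  by apply.
apply: (@le_trans _ _ (\int[mu]_(t in `[p j, q j])
    \sum_(0 <= k <oo) (c k * \1_(`[a k j, b k j]%classic) t)%:E)%E).
  apply: ge0_le_integral => //.
  apply: ge0_emeasurable_sum => [k t _ _|k _]; last exact: mf.
  by rewrite lee_fin mulr_ge0 ?c0 ?indicE.
rewrite integral_nneseries//; last first.
  by move=> k t _; rewrite lee_fin mulr_ge0 ?c0 ?indicE.
apply: lee_nneseries => k.
  by move=> _ _; apply: integral_ge0 => t _; rewrite lee_fin mulr_ge0 ?c0 ?indicE.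
move=> _.
under eq_integral do rewrite EFinM.
rewrite ge0_integralZl_EFin//; last first.
  by apply/measurable_EFinP; exact: measurable_indic.
rewrite integral_indic//.
have -> : w k * (b k j - a k j) * \prod_(i <- r) \1_(`[a k i, b k i]%classic) (y i) =
    c k * (b k j - a k j) by rewrite /c mulrAC.
rewrite [X in (_ <= X)%E]EFinM; apply: lee_wpmul2l; first by rewrite lee_fin.
apply: (@le_trans _ _ (mu `[a k j, b k j]%classic)).
  apply: le_measure; last exact: subIsetl.
    by rewrite inE; exact: measurableI.
  by rewrite inE.
rewrite /mu lebesgue_measure_itv/= lte_fin; case: ltP => //.
by rewrite lee_fin subr_ge0.
Qed.

Lemma finite_pos_lb {R : realType} {n} (F : 'I_n -> R) :
  (forall i, 0 < F i) -> exists2 d, 0 < d & forall i, d <= F i.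
Proof.
move=> F0; exists (\big[Num.min/1]_i F i) => [|i]; first by apply: lt_bigmin => //.
exact: bigmin_le_cond.
Qed.

Lemma rV_norm_le {R : realType} {n} (x : 'rV[R]_n) (e : R) : 0 <= e ->
  (forall i, `|x 0 i| <= e) -> `|x| <= e.
Proof.
by move=> e0 xe; rewrite [leLHS]mx_normrE (bigmax_le _ e0)// => -[i j] _; rewrite /= ord1.
Qed.

Lemma rV_coord_le_norm {R : realType} {n} (x : 'rV[R]_n) i : `|x 0 i| <= `|x|.
Proof.
by rewrite [leRHS]mx_normrE; apply/bigmax_geP; right => /=; exists (0, i).
Qed.

Definition box {R : realType} {n} (a b : 'rV[R]_n) : set 'rV[R]_n :=
  [set x | forall i, a 0 i <= x 0 i <= b 0 i].

Lemma compact_box {R : realType} {n} (a b : 'rV[R]_n) : compact (box a b).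
Proof.
have := @rV_compact R n (fun i => `[a 0 i, b 0 i]%classic) (fun i => @segment_compact _ _ _).
by congr compact; apply/seteqP; split => x /= xP i; have := xP i; rewrite /= in_itv.
Qed.

(** If the growth failed by eta on the segment from x, the Lipschitz bound would make it fail on
    every nearby parallel segment. By [lipschitz_growth] each of these would meet the exceptional
    set in measure at least m, and by [slices] any cover of that set by boxes would have volume at
    least [m * vol]; but a cover of volume [m * vol / 2] exists. *)
Lemma coord_growth {R : realType} {n} (f : 'rV[R]_n -> R) (a b x : 'rV[R]_n)
    (i : 'I_n) (L c t : R) : 0 < L -> 0 <= c -> 0 <= t ->
  (forall y z, box a b y -> box a b z -> `|f y - f z| <= L * `|y - z|) ->
  ae_on (box a b) (fun l => derivable (f : 'rV[R]_n -> R^o) l (delta_mx 0 i) /\ c <= partial i f l) ->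
  (forall j, a 0 j < x 0 j < b 0 j) -> x 0 i + t < b 0 i ->
  c * t <= f (x + t *: delta_mx 0 i) - f x.
Proof.
move=> L0 c0 t0 fL fae xab xt.
set e_i : 'rV[R]_n := delta_mx 0 i.
rewrite leNgt; apply/negP => gap.
pose eta := c * t - (f (x + t *: e_i) - f x).
have eta0 : 0 < eta by rewrite subr_gt0.
(* Moving the two end points by at most d costs 2 L d in f, which is kept below half of the deficit
   eta. *)
have [d d0 dP] : exists2 d : R, 0 < d & 2 * L * d <= eta / 2 /\
    forall j, a 0 j <= x 0 j - d /\ x 0 j + d <= b 0 j.
  have [d1 d10 d1P] := @finite_pos_lb R n (fun j => Num.min (x 0 j - a 0 j) (b 0 j - x 0 j))
    (fun j => ltac:(have /andP[? ?] := xab j; by rewrite lt_min !subr_gt0; apply/andP)).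
  exists (Num.min d1 (eta / (4 * L))); first by rewrite lt_min d10 divr_gt0// mulr_gt0.
  split.
    have : Num.min d1 (eta / (4 * L)) <= eta / (4 * L) by rewrite ge_min lexx orbT.
    rewrite ler_pdivlMr ?mulr_gt0//; lra.
  move=> j; have := d1P j; rewrite le_min => /andP[A1 A2].
  have : Num.min d1 (eta / (4 * L)) <= d1 by rewrite ge_min lexx.
  by split; lra.
have [dL dab] := dP.
(* An exceptional set of measure below m costs less than (L + c) m = eta / 2, the other half of the
   deficit. *)
pose m := eta / 2 / (L + c).
have Lc0 : 0 < L + c by rewrite ltr_wpDr.
have m0 : 0 < m by rewrite !divr_gt0.
pose r := [seq j <- enum 'I_n | j != i].
pose p j := x 0 j - d; pose q j := x 0 j + d.
pose vol := \prod_(j <- r) (q j - p j).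
have vol0 : 0 < vol by apply: prodr_gt0 => j _; rewrite /q /p; lra.
have e0 : 0 < m * vol / 2 by rewrite divr_gt0// mulr_gt0.
have [A [B [AB cov sumAB]]] := fae _ e0.
have prodE (F : 'I_n -> R) : \prod_j F j = F i * \prod_(j <- r) F j.
  by rewrite (bigD1 i)//= /r big_filter big_enum_cond.
have := @slices R 'I_n r (fun k j => A k 0 j) (fun k j => B k 0 j) p q
  (fun k => B k 0 i - A k 0 i) m.
have -> : uniq r by rewrite filter_uniq// enum_uniq.
move=> /(_ isT (fun k => ltac:(by rewrite subr_ge0)) AB (fun j => ltac:(by rewrite /p /q; lra)) (ltW m0)).
have -> : (\sum_(0 <= k <oo) ((B k 0 i - A k 0 i) *
    \prod_(j <- r) (B k 0 j - A k 0 j))%:E =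
  \sum_(0 <= k <oo) (\prod_j (B k 0 j - A k 0 j))%:E)%E.
  by apply: eq_eseriesr => k _; rewrite prodE.
move=> slice; suff : (m * vol <= m * vol / 2) by lra.
rewrite -lee_fin; apply: le_trans sumAB; apply: slice => y yP.
(* The trace of the covering boxes on the line through y in direction i; its measure is at most the
   total weight that [slices] assigns to y. *)
pose V := \bigcup_(k in [set k | forall j, j \in r -> A k 0 j <= y j <= B k 0 j])
  `[A k 0 i, B k 0 i]%classic.
have mV : measurable V by apply: bigcup_measurable.
have VS : (lebesgue_measure V <= \sum_(0 <= k <oo) ((B k 0 i - A k 0 i) *
    \prod_(j <- r) \1_(`[A k 0 j, B k 0 j]%classic) (y j))%:E)%E.
  pose F k : set R := if `[< forall j, j \in r -> A k 0 j <= y j <= B k 0 j >]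
    then `[A k 0 i, B k 0 i]%classic else set0.
  have mF k : measurable (F k) by rewrite /F; case: ifP.
  apply: (@le_trans _ _ (\sum_(0 <= k <oo) lebesgue_measure (F k))%E).
    apply: measure_sigma_subadditive => // z [k /= kP kz]; exists k => //.
    by rewrite /F; case: asboolP.
  apply: lee_nneseries => // k _; rewrite /F; case: asboolP => kP; last first.
    rewrite measure0 lee_fin; apply: mulr_ge0; first by rewrite subr_ge0.
    by apply: prodr_ge0 => j _; rewrite indicE.
  rewrite big1_seq ?mulr1 => [|j /andP[_ jr]]; last first.
    by rewrite indicE mem_set//= in_itv/= kP.
  rewrite lebesgue_measure_itv/= lte_fin; case: ltP => // _.
  by rewrite lee_fin subr_ge0.
rewrite leNgt; apply/negP => Sm.
have Vm : (lebesgue_measure V < m%:E)%E := le_lt_trans VS Sm.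
pose pt (tau : R) : 'rV[R]_n := \row_j (if j == i then tau else y j).
have ptab tau : x 0 i <= tau <= x 0 i + t -> box a b (pt tau).
  move=> /andP[t1 t2] j; rewrite mxE; case: eqP => [->|_].
    by have /andP[? ?] := xab i; apply/andP; split; lra.
  have := yP j; have := dab j; rewrite /p /q => -[h1 h2] /andP[h3 h4].
  by apply/andP; split; lra.
have VE : lebesgue_measure V = (fine (lebesgue_measure V))%:E.
  by rewrite fineK// ge0_fin_numE// (lt_trans Vm) ?ltry.
have := @lipschitz_growth R (fun tau => f (pt tau)) (x 0 i) (x 0 i + t) L c
  (fine (lebesgue_measure V)) V.
rewrite -VE lexx lerDl => /(_ t0 c0 (ltW L0)).
have gL u v : x 0 i <= u <= x 0 i + t -> x 0 i <= v <= x 0 i + t ->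
    `|f (pt u) - f (pt v)| <= L * `|u - v|.
  move=> ut vt; apply: le_trans (fL _ _ (ptab _ ut) (ptab _ vt)) _.
  rewrite ler_pM2l// rV_norm_le// => j; rewrite !mxE; case: eqP => // _.
  by rewrite subrr normr0.
move=> /(_ gL mV isT) growth.
have Ht : c * (x 0 i + t - x 0 i) - (L + c) * fine (lebesgue_measure V) <=
    f (pt (x 0 i + t)) - f (pt (x 0 i)).
  apply: growth => tau taut nV.
  have taut' : x 0 i <= tau <= x 0 i + t by have /andP[-> /ltW ->] := taut.
  have [dpt cpt] : derivable (f : 'rV[R]_n -> R^o) (pt tau) e_i /\ c <= partial i f (pt tau).
    apply: contrapT => bad; apply: nV.
    have [|k _ /= kP] := cov (pt tau); first by split => //; exact: ptab.
    exists k; last by rewrite /= in_itv/=; have := kP i; rewrite mxE eqxx.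
    move=> j; rewrite mem_filter => /andP[/negbTE ji _].
    by have := kP j; rewrite mxE ji.
  have E : (fun h => h^-1 *: (((fun u => f (pt u) : R^o) \o shift tau) (h *: 1) - f (pt tau))) =
      (fun h => h^-1 *: (((f : 'rV[R]_n -> R^o) \o shift (pt tau)) (h *: e_i) - f (pt tau))).
    apply/funext => h /=; congr (_ *: (f _ - _)).
    apply/rowP => j; rewrite !mxE eqxx /=; case: eqP => _; first by rewrite /GRing.scale/=.
    by rewrite mulr0 add0r.
  by split; [rewrite /derivable E|rewrite /derive E].
have xb : box a b x by move=> j; have /andP[h1 h2] := xab j; rewrite !ltW.
have xtb : box a b (x + t *: e_i).
  move=> j; have /andP[h1 h2] := xab j; rewrite !mxE eqxx /=.
  by case: eqP => [ji|_]; [subst j; rewrite mulr1|rewrite mulr0 addr0]; apply/andP; split; lra.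
have F1 : `|f (pt (x 0 i)) - f x| <= L * d.
  apply: le_trans (fL _ _ (ptab _ _) xb) _; first by rewrite lexx lerDl.
  rewrite ler_pM2l// rV_norm_le ?ltW// => j; rewrite !mxE; case: eqP => [->|_].
    by rewrite subrr normr0 ltW.
  by have := yP j; rewrite /p /q ler_distl; lra.
have F2 : `|f (pt (x 0 i + t)) - f (x + t *: e_i)| <= L * d.
  apply: le_trans (fL _ _ (ptab _ _) xtb) _; first by rewrite lexx lerDl t0.
  rewrite ler_pM2l// rV_norm_le ?ltW// => j; rewrite !mxE eqxx /=; case: eqP => [->|_].
    by rewrite mulr1 subrr normr0 ltW.
  by have := yP j; rewrite mulr0 addr0 /p /q ler_distl; lra.
have Mm : (L + c) * fine (lebesgue_measure V) < eta / 2.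
  have -> : eta / 2 = (L + c) * m by rewrite /m mulrCA divff ?mulr1// gt_eqF.
  by rewrite ltr_pM2l// -lte_fin -VE.
move: Ht F1 F2; rewrite !ler_norml => Ht /andP[F1 F1'] /andP[F2 F2'].
move: eta0 dL Mm; rewrite /eta; lra.
Qed.

Lemma sum_growth {R : realType} {n} (f : 'rV[R]_n -> R) (a b : 'rV[R]_n) (L c : R) :
  0 < L -> 0 <= c ->
  (forall y z, box a b y -> box a b z -> `|f y - f z| <= L * `|y - z|) ->
  (forall i, ae_on (box a b) (fun l => derivable (f : 'rV[R]_n -> R^o) l (delta_mx 0 i)
     /\ c <= partial i f l)) ->
  forall x y : 'rV[R]_n, (forall j, a 0 j < x 0 j) -> (forall j, x 0 j <= y 0 j) ->
    (forall j, y 0 j < b 0 j) -> c * (\sum_j (y 0 j - x 0 j)) <= f y - f x.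
Proof.
move=> L0 c0 fL fae x y ax xy yb.
pose z k : 'rV[R]_n := \row_j (if (j < k)%N then y 0 j else x 0 j).
have z0 : z 0%N = x by apply/rowP => j; rewrite mxE.
have zn : z n = y by apply/rowP => j; rewrite mxE ltn_ord.
suff H k : (k <= n)%N -> c * (\sum_(j < n | (j < k)%N) (y 0 j - x 0 j)) <= f (z k) - f x.
  have := H n (leqnn n); rewrite zn; congr (_ * _ <= _).
  by apply: eq_bigl => j; rewrite ltn_ord.
elim: k => [_|k IH kn]; first by rewrite z0 subrr big_pred0// mulr0.
have {}IH := IH (ltnW kn).
pose i := Ordinal kn.
have zS : z k.+1 = z k + (y 0 i - x 0 i) *: delta_mx 0 i.
  apply/rowP => j; rewrite !mxE eqxx /= ltnS leq_eqVlt.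
  have [->|ji] := eqVneq j i; first by rewrite eqxx/= ltnn mulr1 addrC subrK.
  by rewrite mulr0 addr0; move: ji; rewrite -val_eqE/= => /negbTE ->.
have step : c * (y 0 i - x 0 i) <= f (z k.+1) - f (z k).
  rewrite zS; apply: (coord_growth _ a b _ _ L) => //.
  - by rewrite subr_ge0.
  - move=> j; rewrite mxE; case: ifP => _.
      by rewrite yb (lt_le_trans (ax j)).
    by rewrite ax (le_lt_trans (xy j)).
  - by rewrite mxE /= ltnn addrC subrK.
have -> : \sum_(j < n | (j < k.+1)%N) (y 0 j - x 0 j) =
    (y 0 i - x 0 i) + \sum_(j < n | (j < k)%N) (y 0 j - x 0 j).
  rewrite (bigD1 i)//=; congr (_ + _); apply: eq_bigl => j.
  rewrite ltnS -val_eqE/= leq_eqVlt; case: (ltngtP j k) => //=.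
by rewrite mulrDr; lra.
Qed.

(** The only two consequences of the regularity of f used to compare values: a gain proportional to
    the sum of the increments, which for eigenvalues is a trace, and a Lipschitz bound along (1,
    ..., 1). The margin d supplies the strict inequalities required by [sum_growth]. *)
Lemma box_growth {R : realType} {n} (Gam : set 'rV[R]_n) (f : 'rV[R]_n -> R) :
  loc_lipschitz_on Gam f -> loc_strictly_increasing Gam f ->
  forall (a b : 'rV[R]_n) d, 0 < d ->
  box (a - const_mx d) (b + const_mx d) `<=` Gam ->
  exists c L, [/\ 0 < c, 0 < L,
    forall x y, box a b x -> box a b y -> (forall j, x 0 j <= y 0 j) ->
      c * (\sum_j (y 0 j - x 0 j)) <= f y - f x &
    forall x t, box a b x -> box a b (x + const_mx t) ->
      f (x + const_mx t) - f x <= L * `|t|].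
Proof.
move=> hlip hincr a b d d0 abG.
have [c c0 fae] := hincr _ (compact_box _ _) abG.
have [L L0 fL] : exists2 L, 0 < L & forall y z,
    box (a - const_mx d) (b + const_mx d) y -> box (a - const_mx d) (b + const_mx d) z ->
    `|f y - f z| <= L * `|y - z|.
  have /pinfty_ex_gt0[L L0 HL] := hlip _ (compact_box _ _) abG.
  by exists L => // y z yb zb; exact: (HL (y, z)).
exists c, L; split => //.
- move=> x y xb yb xy.
  apply: (sum_growth f (a - const_mx d) (b + const_mx d) L) => //; first exact: ltW.
  + by move=> j; rewrite !mxE; have /andP[+ _] := xb j; lra.
  + by move=> j; rewrite !mxE; have /andP[_] := yb j; lra.
- have sub z : box a b z -> box (a - const_mx d) (b + const_mx d) z.
    by move=> zb j; rewrite !mxE; have /andP[? ?] := zb j; apply/andP; split; lra.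
  move=> x t xb xtb; apply: le_trans (ler_norm _) _.
  apply: le_trans (fL _ _ (sub _ xtb) (sub _ xb)) _; rewrite ler_pM2l//.
  by rewrite [x + _]addrC addrK rV_norm_le// => j; rewrite mxE.
Qed.

Lemma open_box {R : realType} {n} (Gam : set 'rV[R]_n) x : open Gam -> Gam x ->
  exists2 r, 0 < r & box (x - const_mx r) (x + const_mx r) `<=` Gam.
Proof.
move=> oG Gx; have : nbhs x Gam by exact: open_nbhs_nbhs.
move=> /nbhs_ballP[r /= r0 rG]; exists (r / 2); first by rewrite divr_gt0.
move=> y yb; apply: rG; rewrite -ball_normE/=.
apply: (@le_lt_trans _ _ (r / 2)); last by rewrite ltr_pdivrMr//; lra.
rewrite rV_norm_le// ?divr_ge0 ?ltW// => j; have := yb j; rewrite !mxE ler_distl.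
by move=> /andP[? ?]; apply/andP; split; lra.
Qed.

(** [Gam] absorbs strictly positive vectors; since it is open, x can first be lowered by a small r
    in all coordinates, which makes the remaining increment strictly positive. *)
Lemma cone_ge {R : realType} {n} (Gam : set 'rV[R]_n) (x y : 'rV[R]_n) :
  admissible_cone Gam -> Gam x -> (forall j, x 0 j <= y 0 j) -> Gam y.
Proof.
move=> [[_ _ oG _ _] addG] Gx xy.
have [r r0 rG] := open_box _ _ oG Gx.
have -> : y = (x - const_mx r) + (y - x + const_mx r).
  by apply/rowP => j; rewrite !mxE; ring.
apply: addG => [|j]; last by rewrite !mxE; have := xy j; lra.
by apply: rG => j; rewrite !mxE; apply/andP; split; lra.
Qed.

(** Any point of the box between x and y, even slightly enlarged, lies above [x - const_mx r], hence
    in [Gam], so [box_growth] applies to the whole box. *)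
Lemma cone_le_f {R : realType} {n} (Gam : set 'rV[R]_n) (f : 'rV[R]_n -> R) (x y : 'rV[R]_n) :
  admissible_cone Gam -> loc_lipschitz_on Gam f -> loc_strictly_increasing Gam f ->
  Gam x -> (forall j, x 0 j <= y 0 j) -> f x <= f y.
Proof.
move=> hG hlip hincr Gx xy; have [[_ _ oG _ _] _] := hG.
have [r r0 rG] := open_box _ _ oG Gx.
have [|c [L [c0 _ H _]]] := box_growth Gam f hlip hincr x y r r0.
  move=> z zb; apply: (@cone_ge _ _ _ (x - const_mx r)) => //.
    by apply: rG => j; rewrite !mxE; apply/andP; split; lra.
  by move=> j; have := zb j; rewrite !mxE => /andP[].
have bx : box x y x by move=> j; rewrite lexx xy.
have by_ : box x y y by move=> j; rewrite lexx xy.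
rewrite -subr_ge0; apply: le_trans (H x y bx by_ xy).
by apply: mulr_ge0; [exact: ltW|apply: sumr_ge0 => j _; rewrite subr_ge0].
Qed.

(** * Loewner order and the cone *)

Lemma sorted_spec_cone {R : realType} {n} (Gam : set 'rV[R]_n) (M : 'M[R]_n) l :
  symmetric_set Gam -> sorted_spec M l -> Gam (eigs M) -> Gam l.
Proof. by move=> sG /sorted_spec_eigs[s ->]; exact: sG. Qed.

Lemma sorted_spec_f {R : realType} {n} (Gam : set 'rV[R]_n) (f : 'rV[R]_n -> R)
    (M : 'M[R]_n) l :
  symmetric_set Gam -> symmetric_on Gam f -> sorted_spec M l -> Gam l -> f (eigs M) = f l.
Proof.
move=> sG fs /sorted_spec_eigs[s ls] Gl.
have -> : eigs M = col_perm s^-1 l.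
  by apply/rowP => j; rewrite ls !mxE permKV.
exact: fs.
Qed.

Lemma mxtrace_delta {R : pzRingType} {n} (k : 'I_n) : \tr (delta_mx k k : 'M[R]_n) = 1.
Proof.
rewrite /mxtrace (bigD1 k)//= mxE eqxx big1 ?addr0// => i ik.
by rewrite mxE (negbTE ik).
Qed.

(* Lowering one direction of M by s * B costs at least c * s * B in f, by the
   trace identity, which beats the gain L * s from adding s * I. *)
Lemma f_strict_decrease {R : realType} {n} (Gam : set 'rV[R]_n) (f : 'rV[R]_n -> R)
    (M0 : 'M[R]_n) :
  admissible_cone Gam -> symmetric_on Gam f -> loc_lipschitz_on Gam f ->
  loc_strictly_increasing Gam f -> M0^T = M0 -> Gam (eigs M0) ->
  exists B d, [/\ 0 < B, 0 < d & forall (M M' : 'M[R]_n) k s,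
    M^T = M -> M'^T = M' -> (forall x, `|qf M x - qf M0 x| <= d * sqn x) ->
    0 < s <= d -> (forall x, qf M' x <= qf M x + s * (sqn x - B * x 0 k ^+ 2)) ->
    Gam (eigs M') -> f (eigs M') < f (eigs M)].
Proof.
move=> hG hsym hlip hincr M0s GM0; have [[_ _ oG sG _] _] := hG.
have [l0 l0S] := sorted_spec_exists M0 M0s.
have Gl0 := sorted_spec_cone _ _ _ sG l0S GM0.
have [r r0 rG] := open_box _ _ oG Gl0.
pose e := r / 2.
have e0 : 0 < e by rewrite divr_gt0.
have re : r = e + e by rewrite /e; field.
have [|c [L [c0 L0 growth lip]]] :=
    box_growth Gam f hlip hincr (l0 - const_mx e) (l0 + const_mx e) e e0.
  move=> z zb; apply: rG => j; have := zb j; rewrite !mxE re => /andP[? ?].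
  by apply/andP; split; lra.
(* With this value c s B = L s + s: lowering one direction by s B beats the gain L s by the strict
   margin s. *)
pose B := (L + 1) / c.
have B0 : 0 < B by rewrite divr_gt0 ?addr_gt0.
(* Keeps the eigenvalues of M, of the lowered matrix and of its shift by s in the box of half-width
   e around [l0]; in particular s B <= e / 4. *)
pose d := Num.min (e / 4) (e / 4 / B).
have d0 : 0 < d by rewrite lt_min; apply/andP; split; [exact: divr_gt0|apply: divr_gt0 => //; exact: divr_gt0].
have de : d <= e / 4 by rewrite ge_min lexx.
have dB : d * B <= e / 4 by rewrite -ler_pdivlMr// ge_min lexx orbT.
exists B, d; split => // M M' k s Ms M's MM0 /andP[s0 sd] M'M GM'.
have [l lS] := sorted_spec_exists M Ms.
(* M is lowered in direction k alone. All its ordered eigenvalues decrease, and the decreases add up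
   to s B by the trace, so each is at most s B. *)
pose M1 := M - (s * B) *: delta_mx k k.
have M1s : M1^T = M1.
  by rewrite /M1 linearB linearZ/= trmx_delta Ms.
have [l1 l1S] := sorted_spec_exists M1 M1s.
have [l' l'S] := sorted_spec_exists M' M's.
have ll0 j : l 0 j <= l0 0 j + d.
  have := weyl _ _ _ _ lS (sorted_specD _ _ d l0S).
  have A x : qf M x <= qf (M0 + d%:M) x.
    by rewrite qfD qf_scalar; have := MM0 x; rewrite ler_distl => /andP[_]; lra.
  by move=> /(_ A j); rewrite !mxE.
have l0l j : l0 0 j <= l 0 j + d.
  have := weyl _ _ _ _ l0S (sorted_specD _ _ d lS).
  have A x : qf M0 x <= qf (M + d%:M) x.
    by rewrite qfD qf_scalar; have := MM0 x; rewrite ler_distl => /andP[+ _]; lra.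
  by move=> /(_ A j); rewrite !mxE.
have l1l j : l1 0 j <= l 0 j.
  apply: (weyl _ _ _ _ l1S lS) => x; rewrite /M1 qfB qfZ qf_delta gerBl.
  by rewrite mulr_ge0 ?sqr_ge0// mulr_ge0// ltW.
have sB : 0 < s * B by rewrite mulr_gt0.
have trE : \sum_j (l 0 j - l1 0 j) = s * B.
  rewrite sumrB -(sorted_spec_trace _ _ lS) -(sorted_spec_trace _ _ l1S).
  by rewrite /M1 raddfB/= linearZ/= mxtrace_delta; ring.
have ll1 j : l 0 j - l1 0 j <= s * B.
  rewrite -trE (bigD1 j)//= lerDl sumr_ge0// => i _; by rewrite subr_ge0.
have sBe : s * B <= e / 4 by apply: le_trans dB; rewrite ler_pM2r.
have bl : box (l0 - const_mx e) (l0 + const_mx e) l.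
  by move=> j; rewrite !mxE; have := ll0 j; have := l0l j => ? ?; apply/andP; split; lra.
have bl1 : box (l0 - const_mx e) (l0 + const_mx e) l1.
  move=> j; rewrite !mxE; have := ll0 j; have := l0l j; have := l1l j; have := ll1 j.
  by move=> ? ? ? ?; apply/andP; split; lra.
have bl1s : box (l0 - const_mx e) (l0 + const_mx e) (l1 + const_mx s).
  move=> j; rewrite !mxE; have := ll0 j; have := l0l j; have := l1l j; have := ll1 j.
  by move=> ? ? ? ?; apply/andP; split; lra.
have boxG z : box (l0 - const_mx e) (l0 + const_mx e) z -> Gam z.
  move=> zb; apply: rG => j; have := zb j; rewrite !mxE re => /andP[? ?].
  by apply/andP; split; lra.
have l'l1 j : l' 0 j <= (l1 + const_mx s) 0 j.
  apply: (weyl _ _ _ _ l'S (sorted_specD _ _ s l1S)) => x.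
  rewrite /M1 qfD qfB qfZ qf_delta qf_scalar; apply: le_trans (M'M x) _; lra.
have Gl' := sorted_spec_cone _ _ _ sG l'S GM'.
rewrite (sorted_spec_f Gam f _ _ sG hsym l'S Gl').
rewrite (sorted_spec_f Gam f _ _ sG hsym lS (boxG _ bl)).
have F1 := cone_le_f Gam f _ _ hG hlip hincr Gl' l'l1.
have F2 := lip _ _ bl1 bl1s.
have F3 := growth _ _ bl1 bl l1l.
rewrite trE (gtr0_norm s0) in F2 F3.
have : c * (s * B) = L * s + s by rewrite /B; field; rewrite gt_eqF.
lra.
Qed.

(** A ball of radius r around [lambda_star] misses [Gam]. By Weyl, the ordered eigenvalues of M / K
    are at most those of 2 q^T q - 1 plus r / 4, hence at most [lambda_star] plus r / 4. Were they
    in [Gam], upward stability would put [lambda_star] plus r / 2 there too, although it lies in the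
    ball. *)
Lemma cone_avoids_lambda_star {R : realType} {n} (Gam : set 'rV[R]_n.+1) :
  admissible_cone Gam -> ~ closure Gam (lambda_star R n) ->
  exists2 th, 0 < th & forall (M : 'M[R]_n.+1) q K, M^T = M -> sqn q = 1 -> 0 < K ->
    (forall x, qf M x <= K * (2 * dot q x ^+ 2 - sqn x + th * sqn x)) ->
    ~ Gam (eigs M).
Proof.
move=> hG hstar; have [[_ _ oG sG cG] addG] := hG.
have [r r0 rG] : exists2 r, 0 < r & forall z, ball (lambda_star R n) r z -> ~ Gam z.
  apply: contrapT => H; apply: hstar => V /nbhs_ballP[r /= r0 rV].
  apply: contrapT => GV; apply: H; exists r => // z zr Gz; apply: GV.
  by exists z; split => //; exact: rV.
exists (r / 4) => [|M q K Ms q1 K0 MK GM]; first by rewrite divr_gt0.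
have [l lS] := sorted_spec_exists M Ms.
have Gl := sorted_spec_cone _ _ _ sG lS GM.
have Ki : 0 < K^-1 by rewrite invr_gt0.
pose J : 'M[R]_n.+1 := 2 *: (q^T *m q) - 1%:M.
have Js : J^T = J by rewrite /J linearB linearZ/= trmx_mul trmxK trmx1.
have [lj ljS] := sorted_spec_exists J Js.
have ljstar := sorted_spec_lambda_star _ _ q1 ljS.
have lt_ j : (K^-1 *: l) 0 j <= (lj + const_mx (r / 4)) 0 j.
  apply: (weyl _ _ _ _ (sorted_specZ _ _ _ (ltW Ki) lS) (sorted_specD _ _ (r / 4) ljS)) => x.
  rewrite qfZ ler_pdivrMl// qfD qfB qfZ qf_tens !qf_scalar.
  by apply: le_trans (MK x) _; rewrite ler_pM2l//; lra.
apply: (rG (lambda_star R n + const_mx (r / 2))).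
  rewrite -ball_normE/= opprD addNKr normrN.
  apply: (@le_lt_trans _ _ (r / 2)); last by rewrite ltr_pdivrMr//; lra.
  by rewrite rV_norm_le ?divr_ge0 ?ltW// => j; rewrite mxE ger0_norm// divr_ge0// ltW.
apply: (@cone_ge _ _ _ (K^-1 *: l)) => //; first exact: cG.
move=> j; have := lt_ j; have := ljstar j; rewrite !mxE.
by move: (K^-1 * l 0 j) (lj 0 j) => u w; case: (j == 0); lra.
Qed.

(** * One-sided limits, first and second order expansions *)

Lemma nbhs_of_norm {R : realType} {V : normedModType R} (x : V) (P : set V) d : 0 < d ->
  (forall y, `|y - x| < d -> P y) -> nbhs x P.
Proof.
move=> d0 dP; apply/nbhs_normP; exists d => // y /= yx; apply: dP.
by rewrite distrC.
Qed.

Definition tends_in {R : realType} {n} (Om : set 'rV[R]_n) (g : 'rV[R]_n -> R)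
    (x : 'rV[R]_n) (l : R) : Prop :=
  forall e, 0 < e -> exists2 d, 0 < d &
    forall y, Om y -> `|y - x| < d -> `|g y - l| <= e.

Lemma tends_inP {R : realType} {n} (Om : set 'rV[R]_n) (g : 'rV[R]_n -> R) x l :
  (g @ within Om (nbhs x) --> l) <-> tends_in Om g x l.
Proof.
split=> [/cvgrPdist_le H e e0|H].
  have := H e e0; rewrite near_withinE => /nbhs_normP[d /= d0 dP].
  exists d => // y Omy yx; rewrite distrC; apply: dP => //.
  by rewrite /= distrC.
apply/cvgrPdist_le => e e0; have [d d0 dP] := H e e0.
rewrite near_withinE; apply: (@nbhs_of_norm R _ x _ d d0) => y yx Omy.
by rewrite distrC; apply: dP.
Qed.

(** Points of the closure make the filter of neighbourhoods traced on [Om] proper, so the limit is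
    unique and equals the value of the continuous extension. *)
Lemma trace_val_lim {R : realType} {n} (Om S : set 'rV[R]_n) (g : 'rV[R]_n -> R) :
  Om `<=` S -> S `<=` closure Om -> extends_continuously Om S g ->
  forall x, S x -> tends_in Om g x (trace_val Om g x) /\ (Om x -> trace_val Om g x = g x).
Proof.
move=> OS SO [h /subspace_continuousP hc hg] x Sx.
have gh : g @ within Om (nbhs x) --> h x.
  apply/tends_inP => e e0; have /tends_inP/(_ e e0)[d d0 dP] := hc x Sx.
  by exists d => // y Oy yx; rewrite -hg//; apply: dP => //; exact: OS.
have pf : ProperFilter (within Om (nbhs x)).
  apply: Build_ProperFilter_ex => P; rewrite /within/= => /(SO x Sx)[y [Oy Py]].
  by exists y; exact: Py.
have E : trace_val Om g x = h x by apply: cvg_lim.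
by rewrite E; split; [apply/tends_inP|exact: hg].
Qed.

Lemma is_derive_line {R : realType} {n} (g : 'rV[R]_n -> R) (y : 'rV[R]_n) i t :
  derivable (g : 'rV[R]_n -> R^o) (y + t *: delta_mx 0 i) (delta_mx 0 i) ->
  is_derive t 1 (fun s => g (y + s *: delta_mx 0 i) : R^o) (partial i g (y + t *: delta_mx 0 i)).
Proof.
move=> dg.
have E : (fun h => h^-1 *: (((fun s => g (y + s *: delta_mx 0 i) : R^o) \o shift t) (h *: 1) -
      g (y + t *: delta_mx 0 i))) =
    (fun h => h^-1 *: (((g : 'rV[R]_n -> R^o) \o shift (y + t *: delta_mx 0 i)) (h *: delta_mx 0 i) -
      g (y + t *: delta_mx 0 i))).
  apply/funext => h /=; congr (_ *: (g _ - _)).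
  by rewrite [h%:A]mulr1 scalerDl addrCA.
by split; [rewrite /derivable E|rewrite /derive E].
Qed.

Lemma mvt_line {R : realType} {n} (g : 'rV[R]_n -> R) (y : 'rV[R]_n) i h :
  (forall s, `|s| <= `|h| ->
    derivable (g : 'rV[R]_n -> R^o) (y + s *: delta_mx 0 i) (delta_mx 0 i)) ->
  exists2 s, `|s| <= `|h| &
    g (y + h *: delta_mx 0 i) - g y = h * partial i g (y + s *: delta_mx 0 i).
Proof.
move=> dg; have dline s sh := is_derive_line g y i s (dg s sh).
have base a b : a <= b -> (forall s, a <= s <= b -> `|s| <= `|h|) ->
    exists2 s, `|s| <= `|h| & g (y + b *: delta_mx 0 i) - g (y + a *: delta_mx 0 i) =
      partial i g (y + s *: delta_mx 0 i) * (b - a).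
  move=> ab abh.
  have drv s : s \in `[a, b] -> is_derive s 1 (fun s => g (y + s *: delta_mx 0 i) : R^o)
      (partial i g (y + s *: delta_mx 0 i)).
    by rewrite in_itv/= => /abh /dline.
  have [s sab E] := MVT_segment ab (fun s sab => drv s (subset_itv_oo_cc sab))
    (derivable_within_continuous (fun s sab => @ex_derive _ _ _ _ _ _ _ (drv s sab))).
  by exists s => //; apply: abh; move: sab; rewrite in_itv.
have [h0|h0] := leP 0 h.
  have [|s sh] := base 0 h h0; first by move=> s /andP[s0 sh]; rewrite !ger0_norm.
  by rewrite scale0r addr0 subr0 => ->; exists s => //; rewrite mulrC.
have [|s sh] := base h 0 (ltW h0).
  by move=> s /andP[s0 sh]; rewrite !ler0_norm ?lerN2// ltW.
rewrite scale0r addr0 => E; exists s => //.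
by rewrite -opprB E; ring.
Qed.

Section C1.
Context {R : realType} {n : nat}.
Variables (Om : set 'rV[R]_n) (oOm : open Om) (g : 'rV[R]_n -> R).
Hypothesis dg : forall x i, Om x -> derivable (g : 'rV[R]_n -> R^o) x (delta_mx 0 i).
Hypothesis cg : forall x i, Om x -> tends_in Om (partial i g) x (partial i g x).

Lemma open_norm_ball x : Om x -> exists2 r, 0 < r & forall y, `|y - x| < r -> Om y.
Proof.
move=> Ox; have : nbhs x Om by exact: open_nbhs_nbhs.
move=> /nbhs_normP[r r0 rO]; exists r => // y yx; apply: rO => /=.
by rewrite distrC.
Qed.

(** Continuous partial derivatives give differentiability: coordinates are changed one at a time and
    the mean value theorem is applied to each change, which is why the error is measured by the sum
    of the [z 0 i] in absolute value. *)
Lemma first_order x e : Om x -> 0 < e -> exists2 d, 0 < d & forall z : 'rV[R]_n, `|z| < d ->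
  `|g (x + z) - g x - \sum_i z 0 i * partial i g x| <= e * \sum_i `|z 0 i|.
Proof.
move=> Ox e0; have [r r0 rO] := open_norm_ball _ Ox.
have /boolp.choice[F HF] : forall i, exists d, 0 < d /\
    forall y, Om y -> `|y - x| < d -> `|partial i g y - partial i g x| <= e.
  by move=> i; have [d d0 dP] := cg x i Ox e e0; exists d.
have [d1 d10 d1F] := finite_pos_lb F (fun i => (HF i).1).
exists (Num.min r d1); first by rewrite lt_min r0.
move=> z; rewrite lt_min => /andP[zr zd].
pose w k : 'rV[R]_n := \row_j (if (j < k)%N then z 0 j else 0).
have w0 : w 0%N = 0 by apply/rowP => j; rewrite !mxE.
have wn : w n = z by apply/rowP => j; rewrite mxE ltn_ord.
suff H k : (k <= n)%N -> `|g (x + w k) - g x - \sum_(j < n | (j < k)%N) z 0 j * partial j g x| <=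
    e * \sum_(j < n | (j < k)%N) `|z 0 j|.
  have := H n (leqnn n); rewrite wn.
  have E (G : 'I_n -> R) : \sum_(j < n | (j < n)%N) G j = \sum_j G j.
    by apply: eq_bigl => j; rewrite ltn_ord.
  by rewrite !E.
elim: k => [_|k IH kn].
  by rewrite w0 addr0 subrr !big_pred0// subr0 normr0 mulr0.
have {}IH := IH (ltnW kn).
pose i := Ordinal kn.
have wS : w k.+1 = w k + z 0 i *: delta_mx 0 i.
  apply/rowP => j; rewrite !mxE eqxx /= ltnS leq_eqVlt.
  have [->|ji] := eqVneq j i; first by rewrite eqxx/= ltnn mulr1 add0r.
  by rewrite mulr0 addr0; move: ji; rewrite -val_eqE/= => /negbTE ->.
have wsmall s : `|s| <= `|z 0 i| -> `|w k + s *: delta_mx 0 i| <= `|z|.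
  move=> sz; apply: rV_norm_le => // j; rewrite !mxE eqxx /=.
  have [->|ji] := eqVneq j i.
    by rewrite ltnn mulr1 add0r (le_trans sz) ?rV_coord_le_norm.
  by rewrite mulr0 addr0; case: ifP; rewrite ?normr0 ?rV_coord_le_norm.
have ball_ s : `|s| <= `|z 0 i| -> `|x + w k + s *: delta_mx 0 i - x| <= `|z|.
  by move=> sz; rewrite -(addrA x) [x + _]addrC addrK wsmall.
have [s sz E] : exists2 s, `|s| <= `|z 0 i| &
    g (x + w k + z 0 i *: delta_mx 0 i) - g (x + w k) =
    z 0 i * partial i g (x + w k + s *: delta_mx 0 i).
  apply: mvt_line => s sz; apply: dg; apply: rO.
  by rewrite (le_lt_trans (ball_ s sz)).
have sumS (G : 'I_n -> R) : \sum_(j < n | (j < k.+1)%N) G j =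
    G i + \sum_(j < n | (j < k)%N) G j.
  rewrite (bigD1 i)//=; congr (_ + _); apply: eq_bigl => j.
  by rewrite ltnS -val_eqE/= leq_eqVlt; case: (ltngtP j k).
rewrite !sumS wS addrA mulrDr.
have -> : g (x + w k + z 0 i *: delta_mx 0 i) - g x -
    (z 0 i * partial i g x + \sum_(j < n | (j < k)%N) z 0 j * partial j g x) =
    z 0 i * (partial i g (x + w k + s *: delta_mx 0 i) - partial i g x) +
    (g (x + w k) - g x - \sum_(j < n | (j < k)%N) z 0 j * partial j g x).
  by rewrite mulrBr -E; ring.
apply: le_trans (ler_normD _ _) _; apply: lerD => //.
rewrite normrM mulrC ler_wpM2r//; apply: (HF i).2.
  by apply: rO; rewrite (le_lt_trans (ball_ s sz)).
by rewrite (lt_le_trans _ (d1F i))// (le_lt_trans (ball_ s sz)).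
Qed.

Lemma is_derive_dir x xi t : Om (x + t *: xi) ->
  is_derive t 1 (fun s => g (x + s *: xi) : R^o) (\sum_i xi 0 i * partial i g (x + t *: xi)).
Proof.
move=> Ox; set y := x + t *: xi; set D := \sum_i _.
have H : (fun h => h^-1 *: (((fun s => g (x + s *: xi) : R^o) \o shift t) (h *: 1) - g y)) @ 0^'
    --> (D : R^o).
  apply/cvgrPdist_le => e e0.
  have S1 : 0 < \sum_i `|xi 0 i| + 1 by rewrite ltr_wpDl// sumr_ge0.
  have [d d0 dP] := first_order y _ Ox (divr_gt0 e0 S1).
  have X1 : 0 < `|xi| + 1 by rewrite ltr_wpDl.
  rewrite near_withinE; apply: (@nbhs_of_norm R _ (0:R) _ (d / (`|xi| + 1))); first exact: divr_gt0.
  move=> h; rewrite subr0 => hd h0.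
  rewrite /= [h%:A]mulr1 [h + t]addrC scalerDl addrA -/y.
  have hxi : `|h *: xi| < d.
    rewrite normrZ; apply: le_lt_trans (_ : `|h| * (`|xi| + 1) < d).
      by rewrite ler_wpM2l// lerDl.
    by rewrite -ltr_pdivlMr.
  have := dP _ hxi.
  have -> : \sum_i (h *: xi) 0 i * partial i g y = h * D.
    by rewrite /D mulr_sumr; apply: eq_bigr => i _; rewrite mxE mulrA.
  have -> : \sum_i `|(h *: xi) 0 i| = `|h| * \sum_i `|xi 0 i|.
    by rewrite mulr_sumr; apply: eq_bigr => i _; rewrite mxE normrM.
  move=> H; have hn : 0 < `|h| by rewrite normr_gt0.
  have -> : D - h^-1 *: (g (y + h *: xi) - g y) = - (h^-1 * (g (y + h *: xi) - g y - h * D)).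
    by rewrite /GRing.scale/=; field.
  rewrite normrN normrM normfV ler_pdivrMl//; apply: le_trans H _.
  rewrite mulrCA ler_pM2l//; rewrite mulrAC ler_pdivrMr// ler_pM2l//.
  by rewrite lerDl.
by split; [apply/cvg_ex; exists D|apply: cvg_lim].
Qed.

End C1.

Lemma is_derive_translate {R : realType} {n} (g : 'rV[R]_n -> R) (c x v : 'rV[R]_n) :
  derivable (g : 'rV[R]_n -> R^o) (x + c) v ->
  is_derive x v (fun z => g (z + c) : R^o) ('D_v (g : 'rV[R]_n -> R^o) (x + c)).
Proof.
move=> dg.
have E : (fun h => h^-1 *: (((fun z => g (z + c) : R^o) \o shift x) (h *: v) - g (x + c))) =
    (fun h => h^-1 *: (((g : 'rV[R]_n -> R^o) \o shift (x + c)) (h *: v) - g (x + c))).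
  by apply/funext => h /=; rewrite addrA.
by split; [rewrite /derivable E|rewrite /derive E].
Qed.

Lemma norm_delta {R : realType} {n} (i : 'I_n) s : `|s *: (delta_mx 0 i : 'rV[R]_n)| <= `|s|.
Proof.
apply: rV_norm_le => // j; rewrite !mxE eqxx/= normrM.
by case: eqP => _; rewrite ?normr1 ?mulr1// normr0 mulr0.
Qed.

Section C2.
Context {R : realType} {n : nat}.
Variables (Om : set 'rV[R]_n) (oOm : open Om) (g : 'rV[R]_n -> R).
Hypothesis dg : forall x i, Om x -> derivable (g : 'rV[R]_n -> R^o) x (delta_mx 0 i).
Hypothesis d2g : forall x i j, Om x -> derivable (partial i g : 'rV[R]_n -> R^o) x (delta_mx 0 j).
Hypothesis c2g : forall x i j, Om x -> tends_in Om (partial j (partial i g)) x (partial j (partial i g) x).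

(** Two mean value steps: in direction i for the increment of g over h in direction j, then in
    direction j for [partial i g]. *)
Lemma double_difference x (i j : 'I_n) h : (forall z, `|z - x| <= 2 * `|h| -> Om z) ->
  exists2 z, `|z - x| <= 2 * `|h| &
    g (x + h *: delta_mx 0 i + h *: delta_mx 0 j) - g (x + h *: delta_mx 0 i) -
      (g (x + h *: delta_mx 0 j) - g x) = h * (h * partial j (partial i g) z).
Proof.
move=> hO.
have near (s t : R) : `|s| <= `|h| -> `|t| <= `|h| ->
    `|x + s *: delta_mx 0 i + t *: delta_mx 0 j - x| <= 2 * `|h|.
  move=> sh th; rewrite -(addrA x) [x + _]addrC addrK.
  apply: le_trans (ler_normD _ _) _; rewrite mulr2n mulrDl mul1r.
  by apply: lerD; [apply: le_trans sh|apply: le_trans th]; exact: norm_delta.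
have near0 (s : R) : `|s| <= `|h| -> `|x + s *: delta_mx 0 i - x| <= 2 * `|h|.
  by move=> sh; have := near s 0 sh; rewrite normr0 scale0r addr0; apply.
pose F z := g (z + h *: delta_mx 0 j) - g z.
have dF s : `|s| <= `|h| -> is_derive (x + s *: delta_mx 0 i) (delta_mx 0 i) (F : 'rV[R]_n -> R^o)
   (partial i g (x + s *: delta_mx 0 i + h *: delta_mx 0 j) - partial i g (x + s *: delta_mx 0 i)).
  move=> sh; apply: is_deriveB.
    by apply: is_derive_translate; apply: dg; apply: hO; exact: near.
  by apply: derivableP; apply: dg; apply: hO; exact: near0.
have [s sh E] := mvt_line F x i h (fun s sh => @ex_derive _ _ _ _ _ _ _ (dF s sh)).
have [|t th E'] := mvt_line (partial i g) (x + s *: delta_mx 0 i) j h.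
  by move=> t th; apply: d2g; apply: hO; exact: near.
exists (x + s *: delta_mx 0 i + t *: delta_mx 0 j); first exact: near.
rewrite -E' -[LHS]/(F (x + h *: delta_mx 0 i) - F x) E; congr (_ * _).
by have := @derive_val _ _ _ _ _ _ _ (dF s sh).
Qed.

(** The double difference is symmetric in i and j, so the two mixed derivatives agree at a pair of
    points arbitrarily close to x; continuity does the rest. *)
Lemma schwarz x i j : Om x -> partial j (partial i g) x = partial i (partial j g) x.
Proof.
have absurd3 (w : R) : 0 < w -> w <= w / 3 + w / 3 -> False by lra.
move=> Ox; set A := LHS; set B := RHS.
apply/eqP; rewrite -subr_eq0 -normr_eq0; apply/negPn/negP => AB.
have e0 : 0 < `|A - B| / 3 by rewrite divr_gt0// lt_neqAle eq_sym AB normr_ge0.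
have [r r0 rO] := open_norm_ball Om oOm _ Ox.
have [d1 d10 d1P] := c2g x i j Ox _ e0.
have [d2 d20 d2P] := c2g x j i Ox _ e0.
pose h := Num.min r (Num.min d1 d2) / 3.
have m0 : 0 < Num.min r (Num.min d1 d2) by rewrite !lt_min r0 d10.
have h0 : 0 < h by rewrite divr_gt0.
have hm : 2 * `|h| < Num.min r (Num.min d1 d2).
  by rewrite gtr0_norm// /h; lra.
have hO z : `|z - x| <= 2 * `|h| -> Om z.
  by move=> zx; apply: rO; move: hm; rewrite !lt_min => /andP[+ _]; exact: le_lt_trans.
have [z1 z1x E1] := double_difference x i j h hO.
have [z2 z2x E2] := double_difference x j i h hO.
have xC : x + h *: delta_mx 0 j + h *: delta_mx 0 i = x + h *: delta_mx 0 i + h *: delta_mx 0 j.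
  exact: addrAC.
have E : partial j (partial i g) z1 = partial i (partial j g) z2.
  move: E1 E2; rewrite xC.
  move: (partial j _ z1) (partial i _ z2) => P Q.
  move: (g (x + h *: delta_mx 0 i + h *: delta_mx 0 j)) (g (x + h *: delta_mx 0 i)).
  move: (g (x + h *: delta_mx 0 j)) (g x) => a b c d E1 E2.
  apply: (mulfI (lt0r_neq0 h0)); apply: (mulfI (lt0r_neq0 h0)).
  by move: E1 E2; lra.
move: hm; rewrite !lt_min => /and3P[_ hd1 hd2].
have F1 := d1P z1 (hO _ z1x) (le_lt_trans z1x hd1).
have F2 := d2P z2 (hO _ z2x) (le_lt_trans z2x hd2).
have : `|A - B| <= `|A - B| / 3 + `|A - B| / 3.
  have {1}-> : A - B = (partial i (partial j g) z2 - B) - (partial j (partial i g) z1 - A).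
    by rewrite E; ring.
  by apply: le_trans (ler_normB _ _) _; apply: lerD; [exact: F2|exact: F1].
have : 0 < `|A - B| by rewrite lt_neqAle eq_sym AB normr_ge0.
exact: absurd3.
Qed.

End C2.

(** If D were negative, [dp] would be negative just to the right of 0, and the mean value theorem
    would give a smaller value of p there. *)
Lemma second_derivative_test {R : realType} (p dp : R -> R) (r D : R) : 0 < r ->
  (forall t : R, `|t| < r -> is_derive t 1 (p : R -> R^o) (dp t)) ->
  (forall t, `|t| < r -> p 0 <= p t) -> is_derive (0 : R) 1 (dp : R -> R^o) D ->
  dp 0 = 0 /\ 0 <= D.
Proof.
move=> r0 dpE pmin d2.
have itvr t : t \in `]- r, r[ -> `|t| < r by rewrite in_itv/= ltr_norml.
have dp0 : dp 0 = 0.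
  have H : is_derive (0 : R) 1 (p : R -> R^o) 0.
    apply: (@derive1_at_min R p (- r) r 0).
    - by rewrite ge0_cp// ?ltW.
    - by move=> t /itvr /dpE [].
    - by rewrite in_itv/= oppr_lt0 r0.
    - by move=> t /itvr; exact: pmin.
  have H' := dpE 0; rewrite normr0 in H'.
  by rewrite -(@derive_val _ _ _ _ _ _ _ (H' r0)) derive_val.
split=> //; rewrite leNgt; apply/negP => D0.
have : (fun h => h^-1 *: (((dp : R -> R^o) \o shift 0) (h *: 1) - dp 0)) @ 0^' --> (D : R^o).
  by rewrite -(@derive_val _ _ _ _ _ _ _ d2); exact: (@ex_derive _ _ _ _ _ _ _ d2).
move=> /cvgr_lt/(_ 0 D0); rewrite near_withinE => /nbhs_normP[d /= d0 dP].
have neg t : 0 < t -> t < d -> dp t < 0.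
  move=> t0 td; have := dP t; rewrite /= sub0r normrN gtr0_norm// => /(_ td).
  rewrite gt_eqF// => /(_ isT); rewrite /GRing.scale/= addr0 mulr1 dp0 subr0.
  by rewrite pmulr_rlt0// invr_gt0.
pose t := Num.min r d / 2.
have m0 : 0 < Num.min r d by rewrite lt_min r0.
have t0 : 0 < t by rewrite divr_gt0.
have tm : t < Num.min r d by rewrite /t; lra.
move: (tm); rewrite lt_min => /andP[tr td].
have drv s : s \in `[0, t] -> is_derive s 1 (p : R -> R^o) (dp s).
  by rewrite in_itv/= => /andP[s0 st]; apply: dpE; rewrite ger0_norm// (le_lt_trans st).
have [s sab E] := MVT t0 (fun s sab => drv s (subset_itv_oo_cc sab))
    (derivable_within_continuous (fun s sab => @ex_derive _ _ _ _ _ _ _ (drv s sab))).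
move: sab; rewrite in_itv/= => /andP[s0 st].
have := pmin t; rewrite gtr0_norm// => /(_ tr); rewrite -subr_ge0 E subr0 pmulr_lge0//.
by rewrite leNgt neg// (lt_trans st).
Qed.

Definition grad {R : realType} {n} (g : 'rV[R]_n -> R) (x : 'rV[R]_n) : 'rV[R]_n :=
  \row_i partial i g x.
Definition hess {R : realType} {n} (g : 'rV[R]_n -> R) (x : 'rV[R]_n) : 'M[R]_n :=
  \matrix_(i, j) partial j (partial i g) x.

Definition C2_on {R : realType} {n} (Om : set 'rV[R]_n) (g : 'rV[R]_n -> R) : Prop :=
  [/\ forall x i, Om x -> derivable (g : 'rV[R]_n -> R^o) x (delta_mx 0 i),
      forall x i j, Om x -> derivable (partial i g : 'rV[R]_n -> R^o) x (delta_mx 0 j),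
      forall x i, Om x -> tends_in Om (partial i g) x (partial i g x) &
      forall x i j, Om x -> tends_in Om (partial j (partial i g)) x (partial j (partial i g) x)].

(* p and H are the gradient and the Hessian form of phi at y. *)
Definition line_jet {R : realType} {n} (phi : 'rV[R]_n -> R) (y p : 'rV[R]_n)
    (H : 'rV[R]_n -> R) : Prop :=
  forall xi : 'rV[R]_n, exists (dphi : R -> R) (r : R), [/\ 0 < r,
    forall t : R, `|t| < r -> is_derive t 1 (fun s => phi (y + s *: xi) : R^o) (dphi t),
    dphi 0 = dot p xi & is_derive (0 : R) 1 (dphi : R -> R^o) (H xi)].

Lemma C2_line_jet {R : realType} {n} (Om : set 'rV[R]_n) (g : 'rV[R]_n -> R) y :
  open Om -> C2_on Om g -> Om y -> line_jet g y (grad g y) (qf (hess g y)).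
Proof.
move=> oOm [dg d2g cg c2g] Oy xi; have [r r0 rO] := open_norm_ball Om oOm _ Oy.
have X1 : 0 < `|xi| + 1 by rewrite ltr_wpDl.
have Ot t : `|t| < r / (`|xi| + 1) -> Om (y + t *: xi).
  move=> tr; apply: rO; rewrite [y + _]addrC addrK normrZ.
  apply: le_lt_trans (_ : `|t| * (`|xi| + 1) < r); first by rewrite ler_wpM2l// lerDl.
  by rewrite -ltr_pdivlMr.
exists (fun t => \sum_i xi 0 i * partial i g (y + t *: xi)), (r / (`|xi| + 1)); split.
- exact: divr_gt0.
- by move=> t tr; apply: (is_derive_dir Om) => //; exact: Ot.
- by rewrite scale0r addr0; apply: eq_bigr => i _; rewrite mxE mulrC.
have Oy0 : Om (y + 0 *: xi) by rewrite scale0r addr0.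
have -> : qf (hess g y) xi =
    \sum_i xi 0 i *: (\sum_j xi 0 j * partial j (partial i g) (y + 0 *: xi) : R^o).
  rewrite scale0r addr0 qfE; apply: eq_bigr => i _; rewrite /GRing.scale/= mulr_sumr; apply: eq_bigr => j _.
  by rewrite mxE; ring.
have -> : (fun t => \sum_i xi 0 i * partial i g (y + t *: xi)) =
    \sum_i (fun t => xi 0 i *: (partial i g (y + t *: xi) : R^o)).
  by apply/funext => t; rewrite fct_sumE.
apply: is_derive_sum => i; apply: is_deriveZ.
by apply: (is_derive_dir Om oOm (partial i g) _ _ y xi 0 Oy0) => [x j|x j]; [exact: d2g|exact: c2g].
Qed.

Lemma line_jetB {R : realType} {n} (f g : 'rV[R]_n -> R) y p q F G :
  line_jet f y p F -> line_jet g y q G ->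
  line_jet (fun z => f z - g z) y (p - q) (fun xi => F xi - G xi).
Proof.
move=> fj gj xi; have [df [r [r0 f1 f2 f3]]] := fj xi; have [dg [s [s0 g1 g2 g3]]] := gj xi.
exists (fun t => df t - dg t), (Num.min r s); split.
- by rewrite lt_min r0.
- by move=> t; rewrite lt_min => /andP[tr ts]; apply: is_deriveB; [exact: f1|exact: g1].
- by rewrite f2 g2 /dot -sumrB; apply: eq_bigr => i _; rewrite !mxE mulrBl.
- exact: is_deriveB.
Qed.

Lemma line_jet_min {R : realType} {n} (f : 'rV[R]_n -> R) y p F r : line_jet f y p F ->
  0 < r -> (forall z, `|z - y| < r -> f y <= f z) -> p = 0 /\ forall xi, 0 <= F xi.
Proof.
move=> fj r0 fmin.
have H xi : dot p xi = 0 /\ 0 <= F xi.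
  have [df [s [s0 f1 <- f3]]] := fj xi.
  have X1 : 0 < `|xi| + 1 by rewrite ltr_wpDl.
  apply: (@second_derivative_test R (fun t => f (y + t *: xi)) df (Num.min s (r / (`|xi| + 1)))) => //.
  - by rewrite lt_min s0 divr_gt0.
  - by move=> t; rewrite lt_min => /andP[ts _]; exact: f1.
  - move=> t; rewrite lt_min => /andP[_ tr]; rewrite scale0r addr0; apply: fmin.
    rewrite [y + _]addrC addrK normrZ.
    apply: le_lt_trans (_ : `|t| * (`|xi| + 1) < r); first by rewrite ler_wpM2l// lerDl.
    by rewrite -ltr_pdivlMr.
split=> [|xi]; last exact: (H xi).2.
apply/rowP => i; rewrite mxE -[RHS](H (delta_mx 0 i)).1 /dot (bigD1 i)//= mxE !eqxx mulr1.
by rewrite big1 ?addr0// => j ji; rewrite mxE (negbTE ji) andbF mulr0.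
Qed.

(** * Geometry of the half ball *)

Lemma continuous_sqn {R : realType} {n} (x0 : 'rV[R]_n) :
  continuous (fun x : 'rV[R]_n => sqn (x - x0)).
Proof.
move=> x; rewrite /sqn.
have H i : (z - x0) 0 i ^+ 2 @[z --> x] --> ((x - x0) 0 i ^+ 2 : R^o).
  have C : (z 0 i - x0 0 i) @[z --> x] --> (x 0 i - x0 0 i : R^o).
    apply: (@cvgB R R^o 'rV[R]_n (nbhs x) _ (fun z : 'rV[R]_n => z 0 i) (fun=> x0 0 i)).
      exact: coord_continuous.
    exact: cvg_cst.
  have E (z : 'rV[R]_n) : (z - x0) 0 i = z 0 i - x0 0 i by rewrite !mxE.
  under eq_fun do rewrite E expr2; rewrite E expr2.
  apply: (@cvgM R 'rV[R]_n (nbhs x) _ (fun z => z 0 i - x0 0 i) (fun z => z 0 i - x0 0 i)); exact: C.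
exact: (@cvg_big R^o 'I_n +%R 0 predT add_continuous 'rV[R]_n (nbhs x) (index_enum _)
  (fun i z => (z - x0) 0 i ^+ 2) (fun i => (x - x0) 0 i ^+ 2) (nbhs_filter x) (fun i _ => H i)).
Qed.

Lemma sqn_ge0 {R : realDomainType} {n} (x : 'rV[R]_n) : 0 <= sqn x.
Proof. by apply: sumr_ge0 => i _; exact: sqr_ge0. Qed.

Lemma coord_sqn {R : realDomainType} {n} (x : 'rV[R]_n) i : x 0 i ^+ 2 <= sqn x.
Proof. by rewrite /sqn (bigD1 i)//= lerDl sumr_ge0// => j _; exact: sqr_ge0. Qed.

Lemma sqn_eq0 {R : realDomainType} {n} (x : 'rV[R]_n) : sqn x = 0 -> x = 0.
Proof.
move=> x0; apply/rowP => i; rewrite mxE; apply/eqP; rewrite -sqrf_eq0 eq_le sqr_ge0 andbT.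
by rewrite -x0; exact: coord_sqn.
Qed.

Lemma dot_sqn {R : realDomainType} {n} (x : 'rV[R]_n) : dot x x = sqn x.
Proof. by apply: eq_bigr => i _; rewrite expr2. Qed.

Lemma sqnD {R : realDomainType} {n} (x y : 'rV[R]_n) : sqn (x + y) = sqn x + 2 * dot x y + sqn y.
Proof.
rewrite /sqn /dot mulr_sumr -!big_split/=; apply: eq_bigr => i _; rewrite !mxE; ring.
Qed.

Lemma sqnZ {R : realDomainType} {n} k (x : 'rV[R]_n) : sqn (k *: x) = k ^+ 2 * sqn x.
Proof. by rewrite /sqn mulr_sumr; apply: eq_bigr => i _; rewrite mxE exprMn. Qed.

Lemma dotZr {R : realDomainType} {n} k (x y : 'rV[R]_n) : dot x (k *: y) = k * dot x y.
Proof. by rewrite /dot mulr_sumr; apply: eq_bigr => i _; rewrite mxE mulrCA. Qed.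

Lemma dotZl {R : realDomainType} {n} k (x y : 'rV[R]_n) : dot (k *: x) y = k * dot x y.
Proof. by rewrite /dot mulr_sumr; apply: eq_bigr => i _; rewrite mxE mulrA. Qed.

Lemma dotDl {R : realDomainType} {n} (x y z : 'rV[R]_n) : dot (x + y) z = dot x z + dot y z.
Proof. by rewrite /dot -big_split; apply: eq_bigr => i _; rewrite mxE mulrDl. Qed.

Lemma dot_delta {R : realDomainType} {n} k (x : 'rV[R]_n) : dot (delta_mx 0 k) x = x 0 k.
Proof.
rewrite /dot (bigD1 k)//= mxE !eqxx mul1r big1 ?addr0// => j jk.
by rewrite mxE (negbTE jk) andbF mul0r.
Qed.

Lemma cauchy_schwarz {R : realFieldType} {n} (x y : 'rV[R]_n) :
  dot x y ^+ 2 <= sqn x * sqn y.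
Proof.
have [x0|x0] := eqVneq (sqn x) 0.
  by rewrite (sqn_eq0 _ x0) /dot big1 ?expr0n ?mul0r ?mulr_ge0 ?sqn_ge0// => i _; rewrite mxE mul0r.
have xp : 0 < sqn x by rewrite lt_neqAle eq_sym x0 sqn_ge0.
have := sqn_ge0 (sqn x *: y - dot x y *: x).
rewrite -scaleNr sqnD !sqnZ dotZl dotZr -[dot y x]/(\sum_i _).
have -> : \sum_i y 0 i * x 0 i = dot x y by apply: eq_bigr => i _; rewrite mulrC.
have -> : sqn x ^+ 2 * sqn y + 2 * (sqn x * (- dot x y * dot x y)) + (- dot x y) ^+ 2 * sqn x =
   sqn x * (sqn x * sqn y - dot x y ^+ 2) by ring.
by rewrite pmulr_rge0// subr_ge0.
Qed.

Lemma qf_bound {R : realFieldType} {n} (E : 'M[R]_n) e xi : (forall i j, `|E i j| <= e) ->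
  `|qf E xi| <= e * n%:R * sqn xi.
Proof.
move=> Ee; rewrite qfE; apply: le_trans (ler_norm_sum _ _ _) _.
(* The right-hand side is spread over all pairs (i, j), so that the inequality 2 a b <= a^2 + b^2
   can be used term by term. *)
have -> : e * n%:R * sqn xi = \sum_(i < n) \sum_(j < n) e * ((xi 0 i ^+ 2 + xi 0 j ^+ 2) / 2).
  have S1 : \sum_(i < n) \sum_(j < n) xi 0 i ^+ 2 = n%:R * sqn xi.
    under eq_bigr do rewrite sumr_const card_ord -mulr_natl.
    by rewrite -mulr_sumr.
  have S2 : \sum_(i < n) \sum_(j < n) xi 0 j ^+ 2 = n%:R * sqn xi.
    by rewrite -[LHS]/(\sum_(i < n) sqn xi) sumr_const card_ord mulr_natl.
  have -> : e * n%:R * sqn xi = e * ((n%:R * sqn xi + n%:R * sqn xi) / 2) by field.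
  rewrite -{1}S1 -S2 -big_split mulr_suml mulr_sumr; apply: eq_bigr => i _.
  by rewrite -big_split mulr_suml mulr_sumr.
apply: ler_sum => i _; apply: le_trans (ler_norm_sum _ _ _) _.
apply: ler_sum => j _; rewrite !normrM mulrAC mulrC ler_pM//.
have := sqr_ge0 (`|xi 0 i| - `|xi 0 j|).
rewrite -(real_normK (num_real (xi 0 i))) -(real_normK (num_real (xi 0 j))); nra.
Qed.

Section HalfBall.
Context {R : realType} {n : nat}.
Notation Hb := (half_ball R n).
Notation N := (@ord_max n).
Implicit Types x y z : 'rV[R]_n.+1.

Lemma enorm_sqn {m} (x : 'rV[R]_m) : enorm x = Num.sqrt (sqn x). Proof. by []. Qed.

Lemma half_ballE x : Hb x <-> sqn x < 1 /\ 0 < x 0 N.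
Proof. by rewrite /half_ball/= enorm_sqn -{1}[1]sqrtr1 ltr_sqrt. Qed.

Lemma open_sqn_lt x0 r : open [set x | sqn (x - x0) < r].
Proof.
apply: (@open_comp _ _ (fun x => sqn (x - x0)) [set t : R | t < r]); last exact: open_lt.
by move=> x _; exact: continuous_sqn.
Qed.

Lemma open_sqn_gt x0 r : open [set x | r < sqn (x - x0)].
Proof.
apply: (@open_comp _ _ (fun x => sqn (x - x0)) [set t : R | r < t]); last exact: open_gt.
by move=> x _; exact: continuous_sqn.
Qed.

Lemma open_half_ball : open Hb.
Proof.
have -> : Hb = [set x | sqn (x - 0) < 1] `&` [set x | 0 < x 0 N].
  by apply/seteqP; split => x; rewrite /= subr0 => /half_ballE.
apply: openI; first exact: open_sqn_lt.
apply: (@open_comp _ _ (fun x => x 0 N) [set t : R | 0 < t]); last exact: open_gt.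
by move=> x _; exact: coord_continuous.
Qed.

Lemma closure_half_ball_ge0 x : closure Hb x -> 0 <= x 0 N.
Proof.
move=> clx; rewrite leNgt; apply/negP => xN.
have [] := clx [set y | y 0 N < 0].
  apply: (@nbhs_of_norm R _ x _ (- x 0 N)); first by rewrite oppr_gt0.
  move=> y yx /=; have := rV_coord_le_norm (y - x) N; rewrite !mxE => h.
  have := le_lt_trans h yx; rewrite ltr_norml => /andP[_]; lra.
by move=> y [/half_ballE[_ y0] /= y1]; have := lt_trans y0 y1; rewrite ltxx.
Qed.

Lemma half_space_approx x (U : set 'rV[R]_n.+1) : nbhs x U ->
  exists2 d, 0 < d & forall t, 0 <= t < d -> U (x + t *: delta_mx 0 N).
Proof.
move=> /nbhs_normP[d /= d0 dU]; exists d => // t /andP[t0 td]; apply: dU => /=.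
rewrite opprD addNKr normrN; apply: le_lt_trans (norm_delta _ _) _.
by rewrite ger0_norm.
Qed.

Lemma up_coord x t : (x + t *: delta_mx 0 N) 0 N = x 0 N + t.
Proof. by rewrite !mxE !eqxx mulr1. Qed.

Lemma nbhs_sqn_lt1 x : sqn x < 1 -> nbhs x [set y | sqn y < 1].
Proof.
move=> x1; apply: open_nbhs_nbhs; split=> //.
have -> : [set y | sqn y < 1] = [set y : 'rV[R]_n.+1 | sqn (y - 0) < 1].
  by apply/seteqP; split => y; rewrite /= subr0.
exact: open_sqn_lt.
Qed.

Lemma closure_half_ballI x : sqn x < 1 -> 0 <= x 0 N -> closure Hb x.
Proof.
move=> x1 xN U xU.
have [d d0 dU] := half_space_approx x _ (filterI xU (nbhs_sqn_lt1 x x1)).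
have [|A B] := dU (d / 2); first by rewrite divr_ge0 ?ltW//=; lra.
exists (x + (d / 2) *: delta_mx 0 N); split=> //; apply/half_ballE; split=> //.
by rewrite up_coord; lra.
Qed.

Lemma half_ball_closure : Hb `<=` closure Hb. Proof. exact: subset_closure. Qed.

Lemma flat_touch (g : 'rV[R]_n.+1 -> R) y b D :
  (forall x, Hb x -> derivable (g : 'rV[R]_n.+1 -> R^o) x (delta_mx 0 N)) ->
  sqn y < 1 -> y 0 N = 0 ->
  tends_in Hb g y (g y) -> tends_in Hb (partial N g) y D ->
  (exists2 t0, 0 < t0 & forall t, 0 < t < t0 -> b * t <= g (y + t *: delta_mx 0 N) - g y) ->
  b <= D.
Proof.
move=> dg y1 yN gc Dc [t0 t00 H]; rewrite leNgt; apply/negP => Db.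
pose e := (b - D) / 2.
have e0 : 0 < e by rewrite /e; lra.
have [d d0 dP] := Dc e e0.
have [d' d'0 d'P] := half_space_approx y _ (nbhs_sqn_lt1 y y1).
have HbE t : 0 < t -> t < d' -> Hb (y + t *: delta_mx 0 N).
  by move=> tp td; apply/half_ballE; rewrite up_coord yN add0r; split=> //; apply: d'P; rewrite ltW.
have nrm (t : R) : 0 < t -> `|y + t *: delta_mx 0 N - y| <= t.
  move=> tp; rewrite [y + _]addrC addrK; apply: le_trans (norm_delta _ _) _.
  by rewrite gtr0_norm.
pose t := Num.min t0 (Num.min d d') / 2.
have m0 : 0 < Num.min t0 (Num.min d d') by rewrite !lt_min t00 d0.
have t_gt0 : 0 < t by rewrite divr_gt0.
have : t < Num.min t0 (Num.min d d') by rewrite /t; lra.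
rewrite !lt_min => /and3P[tt0 td td'].
have drv s : 0 < s -> s <= t -> is_derive s 1 (fun s => g (y + s *: delta_mx 0 N) : R^o)
    (partial N g (y + s *: delta_mx 0 N)).
  by move=> s0 st; apply: is_derive_line; apply: dg; apply: HbE => //; exact: le_lt_trans td'.
have slope s : 0 < s -> s < t ->
    g (y + t *: delta_mx 0 N) - g (y + s *: delta_mx 0 N) <= (D + e) * (t - s).
  move=> s0 st.
  have drv' r : r \in `[s, t] -> is_derive r 1 (fun s => g (y + s *: delta_mx 0 N) : R^o)
      (partial N g (y + r *: delta_mx 0 N)).
    by rewrite in_itv/= => /andP[sr rt]; apply: drv => //; exact: lt_le_trans sr.
  have [r rst ->] := MVT st (fun s sab => drv' s (subset_itv_oo_cc sab))
    (derivable_within_continuous (fun s sab => @ex_derive _ _ _ _ _ _ _ (drv' s sab))).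
  move: rst; rewrite in_itv/= => /andP[sr rt].
  rewrite ler_pM2r ?subr_gt0//.
  have r0 : 0 < r := lt_trans s0 sr.
  have := dP (y + r *: delta_mx 0 N) (HbE r r0 (lt_trans rt td')) (le_lt_trans (nrm r r0) (lt_trans rt td)).
  by rewrite ler_distl => /andP[_].
have K0 : 0 < `|D + e| + 1 by rewrite ltr_wpDl.
have et0 : 0 < e * t / 4 by rewrite divr_gt0// mulr_gt0.
have [d1 d10 d1P] := gc _ et0.
(* Makes both errors, the change of g between heights 0 and s and the missing part |D + e| s of the
   slope, at most e t / 4; the assumption b > D leaves e t to be contradicted. *)
pose s := Num.min (Num.min d1 t) (e * t / 4 / (`|D + e| + 1)) / 2.
have m1 : 0 < Num.min (Num.min d1 t) (e * t / 4 / (`|D + e| + 1)).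
  by rewrite !lt_min d10 t_gt0 divr_gt0.
have s0 : 0 < s by rewrite divr_gt0.
have : s < Num.min (Num.min d1 t) (e * t / 4 / (`|D + e| + 1)) by rewrite /s; lra.
rewrite !lt_min => /andP[/andP[sd1 st]]; rewrite ltr_pdivlMr// => sK.
have F1 := slope s s0 st.
have F2 := d1P _ (HbE s s0 (lt_trans st td')) (le_lt_trans (nrm s s0) sd1).
have F3 : b * t <= g (y + t *: delta_mx 0 N) - g y by apply: H; rewrite t_gt0.
have F4 : - (D + e) * s <= e * t / 4.
  apply: le_trans (ltW sK); rewrite mulrC ler_pM2l//.
  by have := ler_norm (- (D + e)); rewrite normrN; lra.
have F5 : b * t = (D + e) * t + e * t by rewrite /e; field.
move: F2; rewrite ler_norml => /andP[_ F2].
have aux (a1 a2 a3 De tt ss et : R) : a1 - a2 <= De * (tt - ss) -> a2 - a3 <= et / 4 ->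
   De * tt + et <= a1 - a3 -> - De * ss <= et / 4 -> 0 < et -> False by nra.
by apply: (aux _ _ _ _ _ _ _ F1 F2 _ F4 (mulr_gt0 e0 t_gt0)); rewrite -F5.
Qed.

End HalfBall.

Lemma tends_in_eq {R : realType} {n} (Om : set 'rV[R]_n) f g x l :
  (forall y, Om y -> f y = g y) -> tends_in Om f x l -> tends_in Om g x l.
Proof.
move=> fg fl e e0; have [d d0 dP] := fl e e0; exists d => // y Oy yx.
by rewrite -fg//; exact: dP.
Qed.

Lemma tends_in_sub {R : realType} {n} (Om S : set 'rV[R]_n) f x l :
  Om `<=` S -> tends_in S f x l -> tends_in Om f x l.
Proof.
move=> OS fl e e0; have [d d0 dP] := fl e e0; exists d => // y Oy yx.
by apply: dP => //; exact: OS.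
Qed.

Lemma tends_in_unique {R : realType} {n} (Om : set 'rV[R]_n) f (x : 'rV[R]_n) l l' :
  closure Om x -> tends_in Om f x l -> tends_in Om f x l' -> l = l'.
Proof.
move=> clx fl fl'; apply/eqP; rewrite -subr_eq0 -normr_eq0; apply/negPn/negP => ll'.
have e0 : 0 < `|l - l'| / 3 by rewrite divr_gt0// lt_neqAle eq_sym ll' normr_ge0.
have [d d0 dP] := fl _ e0; have [d' d'0 d'P] := fl' _ e0.
have [|y [Oy yx]] := clx [set y | `|y - x| < Num.min d d'].
  by apply: (@nbhs_of_norm R _ x _ (Num.min d d')) => //; rewrite lt_min d0.
move: yx; rewrite /= lt_min => /andP[yd yd'].
have : `|l - l'| <= `|l - l'| / 3 + `|l - l'| / 3.
  have {1}-> : l - l' = (f y - l') - (f y - l) by ring.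
  apply: le_trans (ler_normB _ _) _; apply: lerD; [exact: d'P|exact: dP].
lra.
Qed.

Lemma tends_in_bounded {R : realType} {n} (Om : set 'rV[R]_n) f (x : 'rV[R]_n) l :
  tends_in Om f x l -> exists2 r, 0 < r &
    forall y, Om y -> `|y - x| < r -> `|f y| <= `|l| + 1.
Proof.
move=> fl; have [r r0 rP] := fl 1 ltr01; exists r => // y Oy yx.
rewrite -[f y](subrK l) addrC; apply: le_trans (ler_normD _ _) _.
by rewrite lerD2l rP.
Qed.

Lemma finite_radius {R : realType} {n} {I : finType} (Om : set 'rV[R]_n) (x : 'rV[R]_n)
    (Q : I -> 'rV[R]_n -> Prop) :
  (forall i, exists2 r, 0 < r & forall y, Om y -> `|y - x| < r -> Q i y) ->
  exists2 r, 0 < r & forall y, Om y -> `|y - x| < r -> forall i, Q i y.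
Proof.
move=> H.
have /boolp.choice[F HF] : forall i, exists r, 0 < r /\ forall y, Om y -> `|y - x| < r -> Q i y.
  by move=> i; have [r r0 rP] := H i; exists r.
have [d d0 dF] := finite_pos_lb (fun k : 'I_#|I| => F (enum_val k)) (fun k => (HF _).1).
exists d => // y Oy yx i; apply: (HF i).2 => //.
by apply: lt_le_trans yx _; have := dF (enum_rank i); rewrite enum_rankK.
Qed.

(** * Conformal Hessians up to the boundary *)

Section Traces.
Context {R : realType} {n : nat}.
Notation Hb := (half_ball R n).
Variables (S : set 'rV[R]_n.+1) (u : 'rV[R]_n.+1 -> R).
Hypothesis hu : C2_upto Hb S u.
Hypothesis HS : Hb `<=` S.
Hypothesis Scl : S `<=` closure Hb.

Lemma C2_upto_cont x : S x -> tends_in S u x (u x).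
Proof. by move=> Sx; have [/subspace_continuousP/(_ x Sx)/tends_inP] := hu. Qed.

Lemma grad_upto_tends x i : S x -> tends_in Hb (partial i u) x (grad_upto Hb u x 0 i).
Proof.
by have [_ _ _ hg _] := hu => Sx; rewrite mxE; have [] := trace_val_lim _ _ _ HS Scl (hg i) x Sx.
Qed.

Lemma hess_upto_tends x i j : S x ->
  tends_in Hb (partial j (partial i u)) x (hess_upto Hb u x i j).
Proof.
by have [_ _ _ _ hg] := hu => Sx; rewrite mxE; have [] := trace_val_lim _ _ _ HS Scl (hg i j) x Sx.
Qed.

Lemma grad_upto_in x : Hb x -> grad_upto Hb u x = grad u x.
Proof.
have [_ _ _ hg _] := hu => Hx; apply/rowP => i; rewrite !mxE.
by have [_ ->] := trace_val_lim _ _ _ HS Scl (hg i) x (HS _ Hx).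
Qed.

Lemma hess_upto_in x : Hb x -> hess_upto Hb u x = hess u x.
Proof.
have [_ _ _ _ hg] := hu => Hx; apply/matrixP => i j; rewrite !mxE.
by have [_ ->] := trace_val_lim _ _ _ HS Scl (hg i j) x (HS _ Hx).
Qed.

Lemma C2_upto_on : C2_on Hb u.
Proof.
have [_ dg d2g _ _] := hu; split=> // x i.
  move=> Hx; have := grad_upto_tends x i (HS _ Hx).
  by rewrite grad_upto_in// mxE.
by move=> j Hx; have := hess_upto_tends x i j (HS _ Hx); rewrite hess_upto_in// mxE.
Qed.

(** Inside the half ball this is [schwarz]; it passes to the boundary by uniqueness of limits. *)
Lemma hess_upto_sym x : S x -> (hess_upto Hb u x)^T = hess_upto Hb u x.
Proof.
move=> Sx; apply/matrixP => i j; rewrite mxE.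
apply: (tends_in_unique Hb (partial j (partial i u)) x); first exact: Scl.
  have [dg d2g _ c2g] := C2_upto_on.
  apply: tends_in_eq (hess_upto_tends x j i Sx) => y Hy.
  exact: (schwarz Hb open_half_ball).
exact: hess_upto_tends.
Qed.

Lemma conf_hess_sym x : S x -> (conf_hess Hb u x)^T = conf_hess Hb u x.
Proof.
move=> Sx; rewrite /conf_hess linearZ/=; congr (_ *: _).
by rewrite linearB linearD linearN/= hess_upto_sym// trmx_mul trmxK tr_scalar_mx.
Qed.

Lemma enorm2 {m} (x : 'rV[R]_m) : enorm x ^+ 2 = sqn x.
Proof. by rewrite sqr_sqrtr// sqn_ge0. Qed.

Lemma qf_conf_hess x xi : Hb x -> qf (conf_hess Hb u x) xi =
  expR (- (2 * u x)) * (- qf (hess u x) xi + dot (grad u x) xi ^+ 2 -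
    2^-1 * sqn (grad u x) * sqn xi).
Proof.
move=> Hx; rewrite /conf_hess grad_upto_in// hess_upto_in// enorm2.
by rewrite qfZ qfB qfD qfN qf_tens qf_scalar -expr2.
Qed.

Lemma conf_hess_tends x i j : S x ->
  tends_in Hb (fun y => conf_hess Hb u y i j) x (conf_hess Hb u x i j).
Proof.
move=> Sx.
pose Fg (k : 'I_n.+1) := partial k u.
apply: (@tends_in_eq _ _ _ (fun y => expR (- (2 * u y)) * (- partial j (partial i u) y +
    partial i u y * partial j u y -
    (2^-1 * \sum_k (partial k u y * partial k u y)) *+ (i == j)))).
  move=> y Hy; rewrite /conf_hess grad_upto_in// hess_upto_in// enorm2 !mxE big_ord1 !mxE.
  by congr (_ * (_ - _ * _ *+ _)); apply: eq_bigr => k _; rewrite mxE expr2.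
have -> : conf_hess Hb u x i j = expR (- (2 * u x)) * (- hess_upto Hb u x i j +
    grad_upto Hb u x 0 i * grad_upto Hb u x 0 j -
    (2^-1 * \sum_k (grad_upto Hb u x 0 k * grad_upto Hb u x 0 k)) *+ (i == j)).
  rewrite /conf_hess enorm2; set g := grad_upto _ _ _; set H := hess_upto _ _ _.
  rewrite [LHS]mxE; congr (_ * _); rewrite [LHS]mxE; congr (_ + _).
    rewrite [LHS]mxE; congr (_ + _); first by rewrite mxE.
    by rewrite mxE big_ord1 mxE.
  rewrite [LHS]mxE; congr (- _); rewrite mxE; congr (_ * _ *+ _).
apply/tends_inP.
have Cg k : (partial k u y : R^o) @[y --> within Hb (nbhs x)] --> (grad_upto Hb u x 0 k : R^o).
  by apply/tends_inP; exact: grad_upto_tends.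
have CH : (partial j (partial i u) y : R^o) @[y --> within Hb (nbhs x)] -->
    (hess_upto Hb u x i j : R^o).
  by apply/tends_inP; exact: hess_upto_tends.
have Cu : (u y : R^o) @[y --> within Hb (nbhs x)] --> (u x : R^o).
  by apply/tends_inP; apply: tends_in_sub HS _; exact: C2_upto_cont.
have CS : (\sum_k (partial k u y * partial k u y) : R^o) @[y --> within Hb (nbhs x)] -->
    (\sum_k (grad_upto Hb u x 0 k * grad_upto Hb u x 0 k) : R^o).
  apply: (@cvg_big R^o 'I_n.+1 +%R 0 predT add_continuous _ _ (index_enum _)
    (fun k y => partial k u y * partial k u y)) => k _.
  exact: (cvgM (Cg k) (Cg k)).
apply: cvgM.
  apply: (@cvg_comp _ _ _ (fun y => - (2 * u y)) expR _ (nbhs (- (2 * u x)))); last exact: continuous_expR.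
  by apply: cvgN; apply: cvgM; [exact: cvg_cst|exact: Cu].
apply: cvgB.
  by apply: cvgD; [exact: cvgN CH|exact: (cvgM (Cg i) (Cg j))].
case: (i == j) => /=; last by rewrite !mulr0n; under eq_fun do rewrite mulr0n; exact: cvg_cst.
rewrite !mulr1n; under eq_fun do rewrite mulr1n.
by apply: cvgM; [exact: cvg_cst|exact: CS].
Qed.

Lemma conf_hess_near x e : S x -> 0 < e -> exists2 r, 0 < r &
  forall y, Hb y -> `|y - x| < r -> forall xi,
    `|qf (conf_hess Hb u y) xi - qf (conf_hess Hb u x) xi| <= e * sqn xi.
Proof.
move=> Sx e0; have en0 : 0 < e / n.+1%:R by rewrite divr_gt0.
have [r r0 rP] := @finite_radius R n.+1 ('I_n.+1 * 'I_n.+1)%type Hb x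
  (fun ij y => `|conf_hess Hb u y ij.1 ij.2 - conf_hess Hb u x ij.1 ij.2| <= e / n.+1%:R)
  (fun ij => conf_hess_tends x ij.1 ij.2 Sx _ en0).
exists r => // y Hy yx xi; rewrite -qfB.
have := @qf_bound R n.+1 (conf_hess Hb u y - conf_hess Hb u x) (e / n.+1%:R) xi.
rewrite divfK// => H; apply: H => i j.
have E (A B : 'M[R]_n.+1) : (A - B) i j = A i j - B i j by rewrite !mxE.
by rewrite E; exact: (rP y Hy yx (i, j)).
Qed.

Lemma C2_upto_bounds x : S x -> exists V r, [/\ 1 <= V, 0 < r &
  forall y, Hb y -> `|y - x| < r -> [/\ `|u y| <= V, sqn (grad u y) <= V ^+ 2 &
    forall xi, `|qf (conf_hess Hb u y) xi| <= V * sqn xi]].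
Proof.
move=> Sx.
have [r1 r10 B1] := tends_in_bounded _ _ _ _ (tends_in_sub _ _ _ _ _ HS (C2_upto_cont x Sx)).
have [r2 r20 B2] := @finite_radius R n.+1 'I_n.+1 Hb x
  (fun i y => `|partial i u y| <= `|grad_upto Hb u x 0 i| + 1)
  (fun i => tends_in_bounded _ _ _ _ (grad_upto_tends x i Sx)).
have [r3 r30 B3] := conf_hess_near x 1 Sx ltr01.
pose G := \sum_i (`|grad_upto Hb u x 0 i| + 1) ^+ 2.
have G0 : 0 <= G by apply: sumr_ge0 => i _; exact: sqr_ge0.
pose M := \sum_i \sum_j `|conf_hess Hb u x i j|.
have M0 : 0 <= M by apply: sumr_ge0 => i _; exact: sumr_ge0.
have Mij i j : `|conf_hess Hb u x i j| <= M.
  rewrite /M (bigD1 i)//= (bigD1 j)//= -addrA lerDl addr_ge0//; apply: sumr_ge0 => // k _.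
  exact: sumr_ge0.
(* One constant for all three bounds: G for the squared gradient, M times the dimension plus an
   oscillation 1 for the quadratic form. The final 1 gives V >= 1, hence G <= V <= V^2. *)
pose V := `|u x| + 1 + G + M * n.+1%:R + 1.
have Mn : 0 <= M * n.+1%:R by rewrite mulr_ge0.
have u0 := normr_ge0 (u x).
exists V, (Num.min r1 (Num.min r2 r3)); split.
- by rewrite /V; lra.
- by rewrite !lt_min r10 r20.
move=> y Hy; rewrite !lt_min => /and3P[yr1 yr2 yr3]; split.
- by apply: le_trans (B1 y Hy yr1) _; rewrite /V; lra.
- apply: (@le_trans _ _ G).
    apply: ler_sum => i _; rewrite mxE -(real_normK (num_real _)).
    by rewrite lerXn2r// ?nnegrE ?addr_ge0//; exact: B2.
  have V1 : 1 <= V by rewrite /V; lra.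
  apply: (@le_trans _ _ V); first by rewrite /V; lra.
  by rewrite expr2 ler_peMr//; lra.
- move=> xi.
  have VE : V * sqn xi = (`|u x| + 1 + G) * sqn xi + (M * n.+1%:R * sqn xi + 1 * sqn xi).
    by rewrite /V; ring.
  have P0 : 0 <= (`|u x| + 1 + G) * sqn xi by rewrite mulr_ge0 ?sqn_ge0// !addr_ge0.
  rewrite VE -[qf (conf_hess Hb u y) xi](subrK (qf (conf_hess Hb u x) xi)).
  apply: le_trans (ler_normD _ _) _; rewrite -[leLHS]add0r; apply: lerD => //.
  by rewrite addrC; apply: lerD; [exact: qf_bound|exact: B3].
Qed.

End Traces.

(** * Bounds on products, compact shells, and touching from below at an interior point *)

Lemma le_of_sqr_le {R : realFieldType} (a b : R) : 0 <= b -> a ^+ 2 <= b ^+ 2 -> a <= b.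
Proof. by move=> b0 ab; rewrite leNgt; apply/negP => ba; nra. Qed.

Lemma dot_mul_le {R : realFieldType} {n} (a b x : 'rV[R]_n) v w : 0 <= v -> 0 <= w ->
  sqn a <= v ^+ 2 -> sqn b <= w ^+ 2 -> `|dot a x * dot b x| <= v * w * sqn x.
Proof.
move=> v0 w0 av bw; have sx := sqn_ge0 x.
have H c1 c2 (k : R) : 0 <= k -> sqn c1 <= k ^+ 2 -> c2 = dot c1 x -> c2 ^+ 2 <= k ^+ 2 * sqn x.
  by move=> k0 c1k ->; apply: le_trans (cauchy_schwarz _ _) _; rewrite ler_wpM2r.
have sq : (dot a x * dot b x) ^+ 2 <= (v * w * sqn x) ^+ 2.
  rewrite exprMn; have -> : (v * w * sqn x) ^+ 2 = (v ^+ 2 * sqn x) * (w ^+ 2 * sqn x) by ring.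
  by apply: ler_pM; rewrite ?sqr_ge0//; [apply: (H a)|apply: (H b)].
rewrite ler_norml; apply/andP; split; last by apply: le_of_sqr_le => //; rewrite !mulr_ge0.
by rewrite lerNl; apply: le_of_sqr_le; rewrite ?mulr_ge0// sqrrN.
Qed.

Lemma dot_le {R : realFieldType} {n} (a b : 'rV[R]_n) v w : 0 <= v -> 0 <= w ->
  sqn a <= v ^+ 2 -> sqn b <= w ^+ 2 -> `|dot a b| <= v * w.
Proof.
move=> v0 w0 av bw.
have sq : dot a b ^+ 2 <= (v * w) ^+ 2.
  apply: le_trans (cauchy_schwarz _ _) _; rewrite exprMn.
  by apply: ler_pM; rewrite ?sqn_ge0.
rewrite ler_norml; apply/andP; split; last by apply: le_of_sqr_le => //; rewrite mulr_ge0.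
by rewrite lerNl; apply: le_of_sqr_le; rewrite ?mulr_ge0// sqrrN.
Qed.

Lemma tends_inB {R : realType} {n} (Om : set 'rV[R]_n) f g x l m :
  tends_in Om f x l -> tends_in Om g x m -> tends_in Om (fun y => f y - g y) x (l - m).
Proof.
move=> /tends_inP fl /tends_inP gm; apply/tends_inP.
exact: (@cvgB R R^o _ _ _ f g l m fl gm).
Qed.

Lemma tends_in_cont {R : realType} {n} (Om : set 'rV[R]_n) (f : 'rV[R]_n -> R) x :
  {for x, continuous f} -> tends_in Om f x (f x).
Proof. by move=> cf; apply/tends_inP; apply: cvg_within_filter. Qed.

(** Radii enter squared. A negative [r1] gives a solid piece of ball, [r1 = r2] a piece of sphere,
    and a positive h keeps the set away from the flat boundary. *)
Definition shell {R : realType} {n} (x0 : 'rV[R]_n.+1) (r1 r2 h : R) : set 'rV[R]_n.+1 :=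
  [set x | r1 <= sqn (x - x0) <= r2 /\ h <= x 0 ord_max].

Lemma compact_shell {R : realType} {n} (x0 : 'rV[R]_n.+1) (r1 r2 h : R) :
  compact (shell x0 r1 r2 h).
Proof.
apply: (@subclosed_compact _ _ (box (x0 - const_mx (r2 + 1)) (x0 + const_mx (r2 + 1)))).
- have -> : shell x0 r1 r2 h = (~` [set x | sqn (x - x0) < r1]) `&`
      (~` [set x | r2 < sqn (x - x0)]) `&` (~` [set x | x 0 ord_max < h]).
    apply/seteqP; split=> x /=.
      by move=> [/andP[h1 h2] h3]; rewrite !ltNge h1 h2 h3.
    move=> [[/negP h1 /negP h2] /negP h3]; rewrite -!leNgt in h1 h2 h3.
    by rewrite /shell/= h1 h2.
  apply: closedI; first apply: closedI; apply: open_closedC.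
  + exact: open_sqn_lt.
  + exact: open_sqn_gt.
  + apply: (@open_comp _ _ (fun x : 'rV[R]_n.+1 => x 0 ord_max) [set t : R | t < h]); last exact: open_lt.
    by move=> x _; exact: coord_continuous.
- exact: compact_box.
- move=> x [/andP[_ h2] _] j; rewrite !mxE.
  have s2 := le_trans (sqn_ge0 _) h2.
  have := le_trans (coord_sqn (x - x0) j) h2; rewrite !mxE => hx.
  have H : (x 0 j - x0 0 j) ^+ 2 <= (r2 + 1) ^+ 2.
    by apply: le_trans hx _; have := sqr_ge0 r2; rewrite !expr2; nra.
  have A1 : x 0 j - x0 0 j <= r2 + 1 by apply: le_of_sqr_le => //; lra.
  have A2 : - (x 0 j - x0 0 j) <= r2 + 1 by apply: le_of_sqr_le; [lra|rewrite sqrrN].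
  by apply/andP; split; lra.
Qed.

Lemma shell_min {R : realType} {n} (x0 : 'rV[R]_n.+1) (r1 r2 h : R) (G : 'rV[R]_n.+1 -> R) z :
  (forall x, shell x0 r1 r2 h x -> tends_in (shell x0 r1 r2 h) G x (G x)) ->
  shell x0 r1 r2 h z ->
  exists2 y, shell x0 r1 r2 h y & forall x, shell x0 r1 r2 h x -> G y <= G x.
Proof.
move=> Gc Dz.
have Gcont : {within shell x0 r1 r2 h, continuous G}.
  by apply/subspace_continuousP => x Dx; apply/tends_inP; exact: Gc.
have [|y] := @EVT_min_rV R n.+1 G (shell x0 r1 r2 h) _ (compact_shell _ _ _ _) Gcont.
  by exists z.
by rewrite inE => Dy ymin; exists y => // x Dx; apply: ymin; rewrite inE.
Qed.

Lemma shell_positive_lb {R : realType} {n} (x0 : 'rV[R]_n.+1) (r1 r2 h : R)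
    (G : 'rV[R]_n.+1 -> R) :
  (forall x, shell x0 r1 r2 h x -> tends_in (shell x0 r1 r2 h) G x (G x)) ->
  (forall x, shell x0 r1 r2 h x -> 0 < G x) ->
  exists2 m, 0 < m & forall x, shell x0 r1 r2 h x -> m <= G x.
Proof.
move=> Gc G0; have [[z Dz]|Dn] := pselect (exists z, shell x0 r1 r2 h z).
  by have [y Dy ymin] := shell_min _ _ _ _ _ _ Gc Dz; exists (G y) => //; exact: G0.
by exists 1 => // x Dx; case: Dn; exists x.
Qed.

(** Expansion of the square and of the squared norm for the gradient q + p: the cross terms are
    twice [dv * dp] and once [- dvp * s], whence the factor 3. *)
Lemma touch_alg {R : realFieldType} (hu hv dv dp dvp gv gp s H V w : R) :
  dv * dp <= V * w * s -> - dvp * s <= V * w * s -> H + hv <= hu ->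
  - hu + (dv + dp) ^+ 2 - 2^-1 * (gv + 2 * dvp + gp) * s <=
  - hv + dv ^+ 2 - 2^-1 * gv * s - H + dp ^+ 2 - 2^-1 * gp * s + 3 * V * w * s.
Proof. by rewrite !expr2; lra. Qed.

(** Here e stands for exp(-2(u - v)) with 0 <= u - v <= w, and q for the form of A[v]: replacing the
    conformal factor of v by that of u costs only O(w). *)
Lemma damp_alg {R : realFieldType} (e q s w V : R) : 1 - 2 * w <= e -> e <= 1 ->
  `|q| <= V * s -> 0 <= s -> 0 <= V -> e * q <= q + 2 * w * V * s.
Proof.
rewrite ler_norml => e1 e2 /andP[q1 q2] s0 V0.
have A : (1 - e) * (- q) <= (1 - e) * (V * s) by apply: ler_wpM2l; lra.
have B : (1 - e) * (V * s) <= 2 * w * (V * s) by apply: ler_wpM2r; [exact: mulr_ge0|lra].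
move: A B; lra.
Qed.

Lemma gap_alg {R : realFieldType} (P S H s X w V : R) : P <= w * s -> 0 <= S ->
  w * (X - s) <= H ->
  - H + P - S + 3 * V * w * s <= (2 + 3 * V) * w * s - w * X.
Proof. by lra. Qed.

Lemma sum_alg {R : realFieldType} (Fq E Z X Y CX CY q T : R) : Fq <= q + T ->
  E * Z <= E * (X - Y) -> E * X <= CX -> CY <= E * Y -> Fq + E * Z <= q + (T + CX - CY).
Proof. by lra. Qed.

(* The matrix form of a touching from below at an interior point: A and A' stand
   for A[v] and A[u], h and h' for the Hessians, q and q + p for the gradients. *)
Lemma touch_qf {R : realType} {n} (A A' h h' : 'M[R]_n) (q p : 'rV[R]_n) (a a' V w : R)
    (H : 'rV[R]_n -> R) : 0 <= V -> 0 <= w ->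
  (forall x, qf A x = expR (- (2 * a)) * (- qf h x + dot q x ^+ 2 - 2^-1 * sqn q * sqn x)) ->
  (forall x, qf A' x = expR (- (2 * a')) *
     (- qf h' x + dot (q + p) x ^+ 2 - 2^-1 * sqn (q + p) * sqn x)) ->
  sqn q <= V ^+ 2 -> sqn p <= w ^+ 2 -> (forall x, H x + qf h x <= qf h' x) ->
  forall x, qf A' x <= expR (- (2 * a')) *
    (expR (2 * a) * qf A x - H x + dot p x ^+ 2 - 2^-1 * sqn p * sqn x + 3 * V * w * sqn x).
Proof.
move=> V0 w0 AE A'E qV pw hH x.
rewrite A'E; apply: ler_wpM2l; first exact: expR_ge0.
rewrite AE mulrA -expRD subrr expR0 mul1r dotDl sqnD.
have D2 : - dot q p * sqn x <= V * w * sqn x.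
  apply: ler_wpM2r; first exact: sqn_ge0.
  by apply: le_trans (dot_le _ _ _ _ V0 w0 qV pw); rewrite -normrN ler_norm.
exact: touch_alg (le_trans (ler_norm _) (dot_mul_le _ _ x _ _ V0 w0 qV pw)) D2 (hH x).
Qed.

(** The single amplitude w bounds the gradient of the barrier, the gap u - v and the concavity of
    the barrier. All errors are then multiples of w, while the convexity in direction k is w B with
    B at choice, so [f_strict_decrease] applies with s proportional to w. *)
Lemma touch_f_lt {R : realType} {n} (Gam : set 'rV[R]_n) (f : 'rV[R]_n -> R)
    (M0 : 'M[R]_n) (k : 'I_n) (V : R) :
  admissible_cone Gam -> symmetric_on Gam f -> loc_lipschitz_on Gam f ->
  loc_strictly_increasing Gam f -> M0^T = M0 -> Gam (eigs M0) -> 1 <= V ->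
  exists B r : R, [/\ 0 < B, 0 < r & forall (A A' h h' : 'M[R]_n) (q p : 'rV[R]_n) (a a' w : R)
    (H : 'rV[R]_n -> R),
    A^T = A -> A'^T = A' -> (forall x, `|qf A x - qf M0 x| <= r * sqn x) ->
    (forall x, qf A x = expR (- (2 * a)) * (- qf h x + dot q x ^+ 2 - 2^-1 * sqn q * sqn x)) ->
    (forall x, qf A' x = expR (- (2 * a')) *
       (- qf h' x + dot (q + p) x ^+ 2 - 2^-1 * sqn (q + p) * sqn x)) ->
    `|a| <= V -> sqn q <= V ^+ 2 -> (forall x, `|qf A x| <= V * sqn x) ->
    0 < w <= r -> sqn p <= w ^+ 2 -> 0 <= a' - a <= w ->
    (forall x, H x + qf h x <= qf h' x) ->
    (forall x : 'rV[R]_n, w * (B * x 0 k ^+ 2 - sqn x) <= H x) ->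
    Gam (eigs A') -> f (eigs A') < f (eigs A)].
Proof.
move=> hGam hf_sym hf_lip hf_incr M0s GM0 V1.
have [B1 [d [B10 d0 dec]]] := f_strict_decrease Gam f M0 hGam hf_sym hf_lip hf_incr M0s GM0.
have V0 : 0 <= V by lra.
pose C := expR (2 * (V + 1)).
have C0 : 0 < C by exact: expR_gt0.
(* Total error per unit of w: 2 V from the change of conformal factor and, multiplied by the bound C
   on exp(-2u), 1 from the concavity of the barrier, 1 from the square of its gradient and 3 V from
   the cross terms. *)
pose th := 2 * V + C * (2 + 3 * V).
have th0 : 0 < th.
  have : 0 < C * (2 + 3 * V) by apply: mulr_gt0 => //; lra.
  by rewrite /th; lra.
have BC0 : 0 < B1 * th * C by rewrite !mulr_gt0.
have r0 : 0 < Num.min (Num.min 1 d) (d / th) by rewrite !lt_min ltr01 d0 divr_gt0.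
(* The factor C compensates the lower bound 1 / C on exp(-2u), and th the scaling s = w th, so that
   at least s B1 survives in direction k. *)
exists (B1 * th * C), (Num.min (Num.min 1 d) (d / th)); split => //.
move=> A A' h h' q p a a' w H As A's near AE A'E aV qV AV /andP[w0].
rewrite !le_min => /andP[/andP[w1 wd'] wd] pw /andP[g0 gw] hH HB GA'.
have a'V : `|a'| <= V + 1.
  rewrite -[a'](subrK a); apply: le_trans (ler_normD _ _) _.
  by rewrite addrC lerD// ger0_norm// (le_trans gw).
pose s := w * th.
have s0 : 0 < s by rewrite mulr_gt0.
have sd : s <= d by rewrite /s -ler_pdivlMr.
have [a'l a'u] : - (V + 1) <= a' /\ a' <= V + 1 by apply/andP; rewrite -ler_norml.
have E1 : expR (- (2 * a')) <= C by rewrite ler_expR; lra.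
have E2 : C^-1 <= expR (- (2 * a')) by rewrite /C -expRN ler_expR; lra.
have E3 : 1 - 2 * w <= expR (- (2 * (a' - a))).
  by apply: le_trans (expR_ge1Dx _); lra.
have E4 : expR (- (2 * (a' - a))) <= 1.
  by rewrite -[leRHS]expR0 ler_expR; lra.
have E5 : expR (- (2 * a')) * expR (2 * a) = expR (- (2 * (a' - a))).
  by rewrite -expRD; congr expR; ring.
apply: (dec A A' k s) => //.
- move=> x; apply: le_trans (near x) _; apply: ler_wpM2r; first exact: sqn_ge0.
  by rewrite !ge_min lexx !orbT.
- by rewrite s0 sd.
move=> x; apply: le_trans (touch_qf A A' h h' q p a a' V w H V0 (ltW w0) AE A'E qV pw hH x) _.
have sx := sqn_ge0 x.
have P1 : dot p x ^+ 2 <= w * sqn x.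
  apply: le_trans (cauchy_schwarz _ _) _; apply: ler_wpM2r => //.
  by apply: le_trans pw _; rewrite expr2 ler_piMr// ltW.
have P2 : 0 <= 2^-1 * sqn p * sqn x by rewrite !mulr_ge0 ?sqn_ge0.
have Q1 := damp_alg _ _ _ _ _ E3 E4 (AV x) sx V0.
have Q2 : expR (- (2 * a')) * ((2 + 3 * V) * w * sqn x) <= C * ((2 + 3 * V) * w * sqn x).
  apply: ler_wpM2r => //; apply: mulr_ge0 => //; apply: mulr_ge0; last exact: ltW.
  by rewrite addr_ge0// mulr_ge0.
have Q3 : s * B1 * x 0 k ^+ 2 <= expR (- (2 * a')) * (w * (B1 * th * C * x 0 k ^+ 2)).
  have -> : s * B1 * x 0 k ^+ 2 = C^-1 * (w * (B1 * th * C * x 0 k ^+ 2)).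
    by rewrite /s; field; rewrite gt_eqF.
  apply: ler_wpM2r => //; apply: mulr_ge0; first exact: ltW.
  by apply: mulr_ge0; [exact: ltW|exact: sqr_ge0].
have Q4 : expR (- (2 * a')) * (- H x + dot p x ^+ 2 - 2^-1 * sqn p * sqn x + 3 * V * w * sqn x)
   <= expR (- (2 * a')) * ((2 + 3 * V) * w * sqn x - w * (B1 * th * C * x 0 k ^+ 2)).
  by apply: ler_wpM2l; [exact: expR_ge0|exact: gap_alg].
have -> : s * (sqn x - B1 * x 0 k ^+ 2) = 2 * w * V * sqn x + C * ((2 + 3 * V) * w * sqn x)
    - s * B1 * x 0 k ^+ 2 by rewrite /s /th; ring.
apply: le_trans (sum_alg _ _ _ _ _ _ _ _ _ Q1 Q4 Q2 Q3).
by rewrite le_eqVlt; apply/orP; left; apply/eqP; rewrite -E5; ring.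
Qed.

Lemma line_in_open {R : realType} {n} (O : set 'rV[R]_n) (y xi : 'rV[R]_n) : open O -> O y ->
  exists2 r, 0 < r & forall t, `|t| < r -> O (y + t *: xi).
Proof.
move=> oO Oy; have [r r0 rO] := open_norm_ball O oO _ Oy.
have X1 : 0 < `|xi| + 1 by rewrite ltr_wpDl.
exists (r / (`|xi| + 1)); first exact: divr_gt0.
move=> t tr; apply: rO; rewrite [y + _]addrC addrK normrZ.
apply: le_lt_trans (_ : `|t| * (`|xi| + 1) < r); first by rewrite ler_wpM2l// lerDl.
by rewrite -ltr_pdivlMr.
Qed.

Lemma is_derive_quadratic {R : realType} (A B C t : R) :
  is_derive t 1 (fun s : R => A + s * B + s ^+ 2 * C : R^o) (B + t * (2 * C)).
Proof.
pose P : {poly R} := A%:P + B *: 'X + C *: 'X^2.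
have -> : (fun s : R => A + s * B + s ^+ 2 * C) = horner P.
  by apply/funext => s; rewrite /P !hornerD hornerC !hornerZ hornerX hornerXn; ring.
have -> : B + t * (2 * C) = P^`().[t].
  rewrite /P !derivD derivC !derivZ derivX derivXn add0r !hornerD !hornerZ hornerMn hornerC.
  by rewrite hornerXn expr1 -mulr_natl; ring.
exact: is_derive_poly.
Qed.

Lemma line_jet_quadratic {R : realType} {n} (phi : 'rV[R]_n -> R) y p (H : 'rV[R]_n -> R) :
  (forall xi t, phi (y + t *: xi) = phi y + t * dot p xi + t ^+ 2 * (H xi / 2)) ->
  line_jet phi y p H.
Proof.
move=> E xi; exists (fun t => dot p xi + t * H xi), 1; split => //.
- move=> t _; have -> : (fun s : R => phi (y + s *: xi)) =
      (fun s => phi y + s * dot p xi + s ^+ 2 * (H xi / 2)) by apply/funext => s; rewrite E.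
  have -> : dot p xi + t * H xi = dot p xi + t * (2 * (H xi / 2)) by field.
  exact: is_derive_quadratic.
- by rewrite mul0r addr0.
- have -> : (fun t : R => dot p xi + t * H xi) =
      (fun s => dot p xi + s * H xi + s ^+ 2 * 0) by apply/funext => s; rewrite mulr0 addr0.
  have := is_derive_quadratic (dot p xi) (H xi) 0 0.
  by rewrite mul0r addr0.
Qed.

Lemma sqn_line {R : realType} {n} (y xi : 'rV[R]_n) t :
  sqn (y + t *: xi) = sqn y + t * (2 * dot y xi) + t ^+ 2 * sqn xi.
Proof. by rewrite sqnD dotZr sqnZ; ring. Qed.

Lemma continuous_sqn0 {R : realType} {n} : continuous (fun x : 'rV[R]_n => sqn x).
Proof.
have -> : (fun x : 'rV[R]_n => sqn x) = (fun x => sqn (x - 0)) by apply/funext => x; rewrite subr0.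
exact: continuous_sqn.
Qed.

(** * Radial barriers *)

Section Radial.
Context {R : realType} {n : nat}.
Variables (F F1 F2 : R -> R) (b : R).
Hypothesis dF : forall s : R, 0 < s -> is_derive s 1 (F : R -> R^o) (F1 s).
Hypothesis dF1 : forall s : R, 0 < s -> is_derive s 1 (F1 : R -> R^o) (F2 s).
Notation N := (@ord_max n).

(** Along a line |x|^2 is a quadratic polynomial in t, so the chain rule in one variable
    suffices. *)
Lemma line_jet_radial (y : 'rV[R]_n.+1) : 0 < sqn y ->
  line_jet (fun x : 'rV[R]_n.+1 => F (sqn x) + b * x 0 N) y
    ((2 * F1 (sqn y)) *: y + b *: delta_mx 0 N)
    (fun xi => 4 * F2 (sqn y) * dot y xi ^+ 2 + 2 * F1 (sqn y) * sqn xi).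
Proof.
move=> y0 xi.
have opos : open [set x : 'rV[R]_n.+1 | 0 < sqn x].
  have -> : [set x : 'rV[R]_n.+1 | 0 < sqn x] = [set x | 0 < sqn (x - 0)].
    by apply/seteqP; split => x; rewrite /= subr0.
  exact: open_sqn_gt.
have [r r0 rP] := line_in_open _ _ xi opos y0.
pose d := dot y xi; pose k := sqn xi.
pose q (t : R) : R := sqn y + t * (2 * d) + t ^+ 2 * k.
have dq (t : R) : is_derive t 1 (q : R -> R^o) (2 * d + t * (2 * k)) by exact: is_derive_quadratic.
have qpos (t : R) : `|t| < r -> 0 < q t by move=> /rP; rewrite /= sqn_line.
have q0 : q 0 = sqn y by rewrite /q; ring.
exists (fun t => F1 (q t) * (2 * d + t * (2 * k)) + b * xi 0 N), r; split => //.
- move=> t tr.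
  have -> : (fun s => F (sqn (y + s *: xi)) + b * (y + s *: xi) 0 N) =
      (F \o q : R -> R^o) + (fun s => b * y 0 N + s * (b * xi 0 N) + s ^+ 2 * 0).
    apply/funext => s; rewrite /= sqn_line [in RHS]fctE /q.
    have -> : (y + s *: xi) 0 N = y 0 N + s * xi 0 N by rewrite !mxE.
    by congr (_ + _); ring.
  apply: is_deriveD.
    exact: (is_derive1_comp (dF _ (qpos t tr)) (dq t)).
  have := is_derive_quadratic (b * y 0 N) (b * xi 0 N) 0 t.
  by rewrite mulr0 mulr0 addr0.
- rewrite q0 mul0r addr0 dotDl !dotZl dot_delta /d; ring.
- have -> : (fun t => F1 (q t) * (2 * d + t * (2 * k)) + b * xi 0 N) =
      (F1 \o q : R -> R^o) * (fun s => 2 * d + s * (2 * k) + s ^+ 2 * 0) + cst (b * xi 0 N).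
    by apply/funext => s; rewrite /= -[RHS]/(F1 (q s) * (2 * d + s * (2 * k) + s ^+ 2 * 0) + b * xi 0 N) mulr0 addr0.
  have D1 : is_derive (0 : R) 1 (F1 \o q : R -> R^o) (F2 (q 0) * (2 * d + 0 * (2 * k))).
    have q00 : 0 < q 0 by rewrite q0.
    exact: (is_derive1_comp (dF1 _ q00) (dq 0)).
  have D2 := is_derive_quadratic (2 * d) (2 * k) 0 0.
  have D3 := is_deriveD (is_deriveM D1 D2) (is_derive_cst (b * xi 0 N : R^o) (0 : R) 1).
  apply: is_derive_eq; rewrite /= q0 /GRing.scale/= -/d -/k; ring.
Qed.

Lemma continuous_radial (y : 'rV[R]_n.+1) : 0 < sqn y ->
  {for y, continuous (fun x : 'rV[R]_n.+1 => F (sqn x) + b * x 0 N)}.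
Proof.
move=> y0.
have cF : {for sqn y, continuous F}.
  by apply: differentiable_continuous; apply/derivable1_diffP; have [] := dF _ y0.
have C1 : F (sqn x) @[x --> y] --> (F (sqn y) : R^o).
  by apply: (@cvg_comp _ _ _ (fun x : 'rV[R]_n.+1 => sqn x) F _ (nbhs (sqn y))); [exact: continuous_sqn0|exact: cF].
have C2 : (x : 'rV[R]_n.+1) 0 N @[x --> y] --> (y 0 N : R^o) by exact: coord_continuous.
apply: (@cvgD R R^o _ _ _ _ _ _ _ C1).
by apply: cvgM; [exact: cvg_cst|exact: C2].
Qed.

End Radial.

Lemma dotC {R : realDomainType} {n} (x y : 'rV[R]_n) : dot x y = dot y x.
Proof. by apply: eq_bigr => i _; rewrite mulrC. Qed.

Lemma sqn_delta {R : realDomainType} {n} (k : 'I_n) : sqn (delta_mx 0 k : 'rV[R]_n) = 1.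
Proof. by rewrite -dot_sqn dot_delta mxE !eqxx. Qed.

Lemma sqn0 {R : realDomainType} {n} : sqn (0 : 'rV[R]_n) = 0.
Proof. by rewrite /sqn big1// => i _; rewrite mxE expr0n. Qed.

Lemma sqn_gt0 {R : realDomainType} {n} (x : 'rV[R]_n) : x <> 0 -> 0 < sqn x.
Proof. by move=> x0; rewrite lt_neqAle sqn_ge0 andbT eq_sym; apply/eqP => /sqn_eq0. Qed.

Lemma norm_le_of_sqn {R : realType} {n} (x : 'rV[R]_n) r : 0 <= r -> sqn x <= r ^+ 2 -> `|x| <= r.
Proof.
move=> r0 xr; apply: rV_norm_le => // j; have h := le_trans (coord_sqn x j) xr.
rewrite ler_norml; apply/andP; split; last exact: le_of_sqr_le.
by rewrite lerNl; apply: le_of_sqr_le => //; rewrite sqrrN.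
Qed.

Lemma hopf_gradient_alg {R : realFieldType} (m x S s : R) : 0 <= x -> 0 <= m -> m <= 3 / 2 ->
  S <= 1 / 4 -> s ^+ 2 * (m ^+ 2 + 2 * (m * (- 2 * x)) + (- 2) ^+ 2 * S) <= (3 * s) ^+ 2.
Proof.
move=> x0 m0 m1 S1; rewrite exprMn mulrC; apply: ler_wpM2r; first exact: sqr_ge0.
have : 0 <= m * x by exact: mulr_ge0.
have : m ^+ 2 <= (3 / 2) ^+ 2 by rewrite lerXn2r ?nnegrE//; lra.
rewrite !expr2; lra.
Qed.

Lemma le_of_diff {R : realDomainType} (a b h : R) : 0 <= a - b - h -> h + b <= a.
Proof. by rewrite -addrA -opprD subr_ge0 addrC. Qed.

Lemma half_ball_sub_punctured {R : realType} {n} : half_ball R n `<=` closure (half_ball R n) `\ 0.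
Proof.
move=> x Hx; split; first exact: half_ball_closure.
by move=> /= x0; have [_] := (half_ballE x).1 Hx; rewrite x0 mxE ltxx.
Qed.

Lemma punctured_sub {R : realType} {n} : closure (half_ball R n) `\ 0 `<=` closure (half_ball R n).
Proof. by move=> x []. Qed.

Lemma closure_half_ball0 {R : realType} {n} : closure (half_ball R n) 0.
Proof. by apply: closure_half_ballI; rewrite ?sqn0 ?mxE. Qed.

Lemma le_increment {R : realDomainType} (P Q q : R) : P <= Q -> q <= Q + q - P.
Proof. by move=> PQ; rewrite addrAC lerDr subr_ge0. Qed.

Section Profile.
Context {R : realType}.
Implicit Types A e a k s : R.

(* The radial part of the barriers as a function of s = |x|^2. *)
Definition profile A e a k s := A + e * ln s + a * s + k * Num.sqrt s.
Definition profile1 e a k s := e * s^-1 + a + k * (2 * Num.sqrt s)^-1.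
Definition profile2 e k s := - (e * s ^- 2) - k * (4 * s * Num.sqrt s)^-1.

Lemma is_derive_profile A e a k s : 0 < s ->
  is_derive s 1 (profile A e a k : R -> R^o) (profile1 e a k s).
Proof.
move=> s0.
have -> : profile A e a k = (fun t => A + t * a + t ^+ 2 * 0 : R^o) + (e \*: (@ln R : R -> R^o)) +
    (k \*: (@Num.sqrt R : R -> R^o)).
  by apply/funext => t; rewrite /profile -[RHS]/(A + t * a + t ^+ 2 * 0 + e * ln t + k * Num.sqrt t); ring.
have D1 := is_derive_quadratic A a 0 s.
have D2 := is_deriveZ e (is_derive1_ln s0).
have D3 := is_deriveZ k (is_derive1_sqrt s0).
apply: (is_derive_eq (is_deriveD (is_deriveD D1 D2) D3)).
rewrite /profile1 /GRing.scale/=; ring.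
Qed.

Lemma is_derive_profile1 e a k s : 0 < s ->
  is_derive s 1 (profile1 e a k : R -> R^o) (profile2 e k s).
Proof.
move=> s0; have r0 : 0 < Num.sqrt s by rewrite sqrtr_gt0.
have r2 : Num.sqrt s ^+ 2 = s by rewrite sqr_sqrtr// ltW.
have -> : profile1 e a k = (e \*: (fun t => t^-1 : R^o)) + cst (a : R^o) +
    (k \*: (fun t => (2 * Num.sqrt t)^-1 : R^o)) by [].
have D1 := is_deriveV (lt0r_neq0 s0) (is_derive_id (s : R^o) 1).
have D2 : is_derive s 1 (fun t => (2 * Num.sqrt t)^-1 : R^o)
    (- (2 * Num.sqrt s) ^- 2 *: (2 *: (2 * Num.sqrt s)^-1)).
  have n0 : 2 * Num.sqrt s != 0 by rewrite mulf_neq0// gt_eqF.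
  apply: (@is_deriveV R (fun t => 2 * Num.sqrt t) s _ 1 n0).
  exact: (is_deriveZ 2 (is_derive1_sqrt s0)).
apply: (is_derive_eq (is_deriveD (is_deriveD (is_deriveZ e D1) (is_derive_cst (a : R^o) s 1)) (is_deriveZ k D2))).
rewrite /profile2 /GRing.scale/=; move: r0 r2; move: (Num.sqrt s) => r r0 <-; field.
by rewrite gt_eqF.
Qed.

Lemma profile_le A e a k s t : 0 <= e -> 0 <= a -> 0 <= k -> 0 < s -> s <= t ->
  profile A e a k s <= profile A e a k t.
Proof.
move=> e0 a0 k0 s0 st; rewrite /profile !lerD//.
- by rewrite ler_wpM2l// ler_ln// posrE// (lt_le_trans s0).
- by rewrite ler_wpM2l.
- by rewrite ler_wpM2l// ler_wsqrtr.
Qed.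

(* The Hessian of the radial barrier splits as the scalar part 2a, a nonnegative
   tangential part carrying k, and a logarithmic part. *)
Lemma profile_hess e a k s d q : 0 < s ->
  4 * profile2 e k s * d ^+ 2 + 2 * profile1 e a k s * q =
  2 * a * q + k / Num.sqrt s * (q - d ^+ 2 / s) + 2 * e / s * (q - 2 * (d ^+ 2 / s)).
Proof.
move=> s0; have r0 : 0 < Num.sqrt s by rewrite sqrtr_gt0.
have r2 : Num.sqrt s ^+ 2 = s by rewrite sqr_sqrtr// ltW.
rewrite /profile1 /profile2 -r2 sqrtr_sqr (gtr0_norm r0); field.
by rewrite gt_eqF.
Qed.

End Profile.

Lemma radial_gradient_sqn {R : realType} {n} (y : 'rV[R]_n.+1) (m b w : R) : 0 <= m -> 0 <= b ->
  m * Num.sqrt (sqn y) + b <= w -> sqn (m *: y + b *: delta_mx 0 ord_max) <= w ^+ 2.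
Proof.
move=> m0 b0 mw; have r0 := sqrtr_ge0 (sqn y).
have r2 : Num.sqrt (sqn y) ^+ 2 = sqn y by rewrite sqr_sqrtr// sqn_ge0.
apply: le_trans (_ : (m * Num.sqrt (sqn y) + b) ^+ 2 <= _); last first.
  rewrite lerXn2r// ?nnegrE; first by rewrite addr_ge0// mulr_ge0.
  by apply: le_trans mw; rewrite addr_ge0// mulr_ge0.
have yN : y 0 ord_max <= Num.sqrt (sqn y).
  by apply: le_of_sqr_le => //; rewrite r2 coord_sqn.
rewrite sqnD !sqnZ sqn_delta dotZl dotZr dotC dot_delta -{1}r2.
have : m * (b * y 0 ord_max) <= m * (b * Num.sqrt (sqn y)) by rewrite !ler_wpM2l.
move: (Num.sqrt _) (y 0 _) => t z; rewrite !expr2; lra.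
Qed.

Lemma coord_le_sqrt {R : realType} {n} (y : 'rV[R]_n) i : y 0 i <= Num.sqrt (sqn y).
Proof.
apply: le_of_sqr_le; first exact: sqrtr_ge0.
by rewrite sqr_sqrtr ?sqn_ge0// coord_sqn.
Qed.

Lemma norm_le_sqrt {R : realType} {n} (y : 'rV[R]_n) : `|y| <= Num.sqrt (sqn y).
Proof. by apply: norm_le_of_sqn; [exact: sqrtr_ge0|rewrite sqr_sqrtr// sqn_ge0]. Qed.

Lemma sqrt_le_of_sqn {R : realType} {n} (y : 'rV[R]_n) r : 0 <= r -> sqn y <= r ^+ 2 ->
  Num.sqrt (sqn y) <= r.
Proof. by move=> r0 /ler_wsqrtr; rewrite sqrtr_sqr ger0_norm. Qed.

(* With a logarithm-free profile the barrier is convex, uniformly in k. *)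
Lemma convex_barrier_alg {R : realType} {n} (a k B w : R) (y xi : 'rV[R]_n.+1) (i : 'I_n.+1) :
  0 <= a -> 0 <= k -> 0 <= B -> 0 <= w -> w * B <= 2 * a -> 0 < sqn y ->
  w * (B * xi 0 i ^+ 2 - sqn xi) <=
  4 * profile2 0 k (sqn y) * dot y xi ^+ 2 + 2 * profile1 0 a k (sqn y) * sqn xi.
Proof.
move=> a0 k0 B0 w0 wB y0; rewrite profile_hess// mulr0 mul0r mul0r addr0.
have r0 : 0 <= k / Num.sqrt (sqn y) by rewrite divr_ge0// sqrtr_ge0.
have C : 0 <= sqn xi - dot y xi ^+ 2 / sqn y.
  by rewrite subr_ge0 ler_pdivrMr// mulrC cauchy_schwarz.
have := mulr_ge0 r0 C.
have : w * B * xi 0 i ^+ 2 <= 2 * a * sqn xi.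
  by apply: ler_pM; rewrite ?sqr_ge0 ?mulr_ge0// coord_sqn.
have : 0 <= w * sqn xi by rewrite mulr_ge0 ?sqn_ge0.
lra.
Qed.

(** Here t = |y|, c is the component of xi along y, z its last coordinate and q its squared norm;
    [k1] and [e1] are the curvatures of the k|x| and logarithmic parts. The barrier Hessian
    contributes m (2 c^2 - q) - k1 c^2, whose last term has the good sign, and the squared gradient
    contributes m^2 s / 2 times 2 c^2 - q. The rest is error, absorbed by the term with th. *)
Lemma barrier_alg {R : realFieldType} (q c z t s m b e1 k1 yN E V th T : R) :
  0 <= e1 -> 0 <= k1 -> m = e1 + k1 -> 0 <= t -> t ^+ 2 = s -> 0 <= b -> 0 <= yN -> c ^+ 2 <= q -> z ^+ 2 <= q ->
  T <= E * q ->
  E + 3 * V * (m * t + b) + (2 * (m * t) * b + b ^+ 2) <= th * (m + 2^-1 * m ^+ 2 * s) ->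
  T - (k1 * (q - c ^+ 2) + e1 * (q - 2 * c ^+ 2)) + (m * (c * t) + b * z) ^+ 2 -
    2^-1 * (m ^+ 2 * s + 2 * (m * (b * yN)) + b ^+ 2) * q + 3 * V * (m * t + b) * q <=
  (m + 2^-1 * m ^+ 2 * s) * (2 * c ^+ 2 - q + th * q).
Proof.
move=> e0 k0 mE t0 <- b0 y0 cq zq TE HE.
have q0 : 0 <= q by apply: le_trans cq; exact: sqr_ge0.
have m0 : 0 <= m by rewrite mE addr_ge0.
have mtb : 0 <= m * t * b by rewrite !mulr_ge0.
have h1 : 0 <= k1 * c ^+ 2 by rewrite mulr_ge0 ?sqr_ge0.
have h2 : 0 <= m * t * b * (c - z) ^+ 2 by rewrite mulr_ge0 ?sqr_ge0.
have h3 : m * t * b * (c ^+ 2 + z ^+ 2) <= m * t * b * (q + q) by rewrite ler_wpM2l ?lerD.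
have h4 : b ^+ 2 * z ^+ 2 <= b ^+ 2 * q by rewrite ler_wpM2l ?sqr_ge0.
have h5 : 0 <= m * (b * yN) * q by rewrite !mulr_ge0.
have h6 := ler_wpM2r q0 HE.
have h7 : 0 <= b ^+ 2 * q by rewrite mulr_ge0 ?sqr_ge0.
have -> : T - (k1 * (q - c ^+ 2) + e1 * (q - 2 * c ^+ 2)) + (m * (c * t) + b * z) ^+ 2 -
    2^-1 * (m ^+ 2 * t ^+ 2 + 2 * (m * (b * yN)) + b ^+ 2) * q + 3 * V * (m * t + b) * q =
  (m + 2^-1 * m ^+ 2 * t ^+ 2) * (2 * c ^+ 2 - q) + (T - E * q) - k1 * c ^+ 2 -
   m * t * b * (c - z) ^+ 2 + (m * t * b * (c ^+ 2 + z ^+ 2) - m * t * b * (q + q)) +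
   (b ^+ 2 * z ^+ 2 - b ^+ 2 * q) - m * (b * yN) * q - 2^-1 * (b ^+ 2 * q) +
   (E + 3 * V * (m * t + b) + (2 * (m * t) * b + b ^+ 2)) * q by rewrite mE; field.
have -> : (m + 2^-1 * m ^+ 2 * t ^+ 2) * (2 * c ^+ 2 - q + th * q) =
  (m + 2^-1 * m ^+ 2 * t ^+ 2) * (2 * c ^+ 2 - q) + th * (m + 2^-1 * m ^+ 2 * t ^+ 2) * q by ring.
lra.
Qed.

(* m + m^2 |y|^2 / 2 is the size of the barrier part of the conformal Hessian, which
   has the eigenvalue pattern (1, -1, ..., -1) with the radial direction first. *)
Lemma conformal_barrier_alg {R : realType} {n} (e k b m E V th T : R) (y xi : 'rV[R]_n.+1) :
  0 <= e -> 0 <= k -> 0 <= b -> 0 < sqn y -> 0 <= y 0 ord_max ->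
  m = 2 * profile1 e 0 k (sqn y) -> T <= E * sqn xi ->
  E + 3 * V * (m * Num.sqrt (sqn y) + b) + (2 * (m * Num.sqrt (sqn y)) * b + b ^+ 2) <=
    th * (m + 2^-1 * m ^+ 2 * sqn y) ->
  T - (4 * profile2 e k (sqn y) * dot y xi ^+ 2 + m * sqn xi) +
    dot (m *: y + b *: delta_mx 0 ord_max) xi ^+ 2 -
    2^-1 * sqn (m *: y + b *: delta_mx 0 ord_max) * sqn xi +
    3 * V * (m * Num.sqrt (sqn y) + b) * sqn xi <=
  (m + 2^-1 * m ^+ 2 * sqn y) *
    (2 * dot ((Num.sqrt (sqn y))^-1 *: y) xi ^+ 2 - sqn xi + th * sqn xi).
Proof.
move=> e0 k0 b0 y0 yN mE TE HE.
have t0 : 0 < Num.sqrt (sqn y) by rewrite sqrtr_gt0.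
have t2 : Num.sqrt (sqn y) ^+ 2 = sqn y by rewrite sqr_sqrtr// ltW.
have mk : m = 2 * e / sqn y + k / Num.sqrt (sqn y).
  by rewrite mE /profile1; field; rewrite !gt_eqF.
have CN := coord_sqn xi ord_max.
have hE := profile_hess e 0 k (sqn y) (dot y xi) (sqn xi) y0.
rewrite -mE mulr0 mul0r add0r in hE; rewrite hE.
have d1 : dot (m *: y + b *: delta_mx 0 ord_max) xi = m * dot y xi + b * xi 0 ord_max.
  by rewrite dotDl dotZl dotZl dot_delta.
have d2 : sqn (m *: y + b *: delta_mx 0 ord_max) =
    m ^+ 2 * sqn y + 2 * (m * (b * y 0 ord_max)) + b ^+ 2.
  by rewrite sqnD !sqnZ sqn_delta mulr1 dotZl dotZr dotC dot_delta.
rewrite d1 d2 dotZl; pose c := (Num.sqrt (sqn y))^-1 * dot y xi.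
have dc : dot y xi = c * Num.sqrt (sqn y) by rewrite /c mulrAC mulVf ?mul1r// gt_eqF.
have dc2 : dot y xi ^+ 2 / sqn y = c ^+ 2.
  by rewrite dc exprMn t2 mulfK// gt_eqF.
have C : c ^+ 2 <= sqn xi.
  by rewrite -dc2 ler_pdivrMr// mulrC; exact: cauchy_schwarz.
rewrite dc2 -/c dc.
apply: barrier_alg; [..|exact: HE] => //; first exact: divr_ge0 (mulr_ge0 _ e0) (ltW y0).
  exact: divr_ge0 k0 (ltW t0).
Qed.

(** Since m t >= rho / 2, every error is a multiple of m t: E is at most (2 E / rho) m t, the terms
    with V are at most (9/2) V m t, and those with b alone at most m t. Finally m t <= m r, with r
    small against th. *)
Lemma small_radius_alg {R : realFieldType} (E V b m t s r rho th : R) :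
  0 < rho -> rho <= 1 -> 0 <= E -> 0 <= V -> 0 <= m -> 0 <= t -> t <= r -> 0 <= s -> b = rho / 4 ->
  rho / 2 <= m * t -> 0 <= th -> r * (2 * E / rho + 5 * V + 1) <= th ->
  E + 3 * V * (m * t + b) + (2 * (m * t) * b + b ^+ 2) <= th * (m + 2^-1 * m ^+ 2 * s).
Proof.
move=> rho0 rho1 E0 V0 m0 t0 tr s0 bE mt th0 rth.
have h1 : E <= 2 * E / rho * (m * t).
  have {1}-> : E = 2 * E / rho * (rho / 2) by field; rewrite gt_eqF.
  by apply: ler_wpM2l => //; apply: divr_ge0; [exact: mulr_ge0|exact: ltW].
have bmt : b <= m * t / 2 by lra.
have h2 : V * b <= V * (m * t / 2) by rewrite ler_wpM2l.
have mt0 : 0 <= m * t by rewrite mulr_ge0.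
have h3 : m * t * b <= m * t * (1 / 4) by rewrite ler_wpM2l//; lra.
have h4 : b ^+ 2 <= b * 1 by rewrite expr2 ler_wpM2l//; lra.
have D0 : 0 <= 2 * E / rho + 5 * V + 1 by rewrite !addr_ge0 ?mulr_ge0 ?invr_ge0// ltW.
have h5 : m * t * (2 * E / rho + 5 * V + 1) <= m * r * (2 * E / rho + 5 * V + 1).
  by rewrite ler_wpM2r// ler_wpM2l.
have h6 : m * (r * (2 * E / rho + 5 * V + 1)) <= m * th by rewrite ler_wpM2l.
have h7 : 0 <= th * (2^-1 * m ^+ 2 * s) by rewrite !mulr_ge0 ?sqr_ge0.
have h8 : 0 <= V * (m * t) by rewrite mulr_ge0.
lra.
Qed.

(** * Comparison on the half ball *)

Section Comparison.
Context {R : realType} {n : nat}.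
Notation Hb := (half_ball R n).
Notation cl := (closure Hb).
Notation N := (@ord_max n).
Notation eN := (delta_mx 0 N : 'rV[R]_n.+1).
Variables (c : R) (Gam : set 'rV[R]_n.+1) (f : 'rV[R]_n.+1 -> R) (u v : 'rV[R]_n.+1 -> R).
Hypothesis hGam : admissible_cone Gam.
Hypothesis hf_sym : symmetric_on Gam f.
Hypothesis hf_lip : loc_lipschitz_on Gam f.
Hypothesis hf_incr : loc_strictly_increasing Gam f.
Hypothesis hu : C2_upto Hb (cl `\ 0) u.
Hypothesis hv : C2_upto Hb cl v.
Hypothesis hv_adm : forall x, cl x -> Gam (eigs (conf_hess Hb v x)).
Hypothesis hu_adm : forall x, Hb x -> Gam (eigs (conf_hess Hb u x)).
Hypothesis hsub : forall x, Hb x ->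
  f (eigs (conf_hess Hb u x)) >= f (eigs (conf_hess Hb v x)).
Hypothesis hu_bd : forall x, flat_boundary R n x -> x <> 0 ->
  grad_upto Hb u x 0 N <= c * expR (u x).
Hypothesis hv_bd : forall x, flat_boundary R n x ->
  grad_upto Hb v x 0 N >= c * expR (v x).
Hypothesis huv : forall x, Hb x -> u x > v x.

Lemma punctured_in x : sqn x < 1 -> 0 <= x 0 N -> x <> 0 -> (cl `\ 0) x.
Proof. by move=> x1 xN x0; split => //; exact: closure_half_ballI. Qed.

Lemma diff_ge0 x : sqn x < 1 -> 0 <= x 0 N -> x <> 0 -> 0 <= u x - v x.
Proof.
move=> x1 xN x0; rewrite leNgt; apply/negP => g0.
have Sx := punctured_in x x1 xN x0.
have T : tends_in Hb (fun y => u y - v y) x (u x - v x).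
  apply: tends_inB; apply: tends_in_sub.
  - exact: half_ball_sub_punctured.
  - exact: C2_upto_cont hu _ Sx.
  - exact: half_ball_closure.
  - by apply: C2_upto_cont hv _ _; case: Sx.
have [d d0 dP] := T (- (u x - v x) / 2) ltac:(lra).
have [y [Hy yx]] := (punctured_sub _ Sx) [set y | `|y - x| < d] (nbhs_of_norm x _ d d0 (fun y h => h)).
have := dP y Hy yx; rewrite ler_distl => /andP[_]; have := huv y Hy; lra.
Qed.

Lemma conf_hess_v_sym x : cl x -> (conf_hess Hb v x)^T = conf_hess Hb v x.
Proof. exact: (conf_hess_sym _ _ hv half_ball_closure (fun x h => h) x). Qed.

Lemma conf_hess_u_sym x : Hb x -> (conf_hess Hb u x)^T = conf_hess Hb u x.
Proof. by move=> /half_ball_sub_punctured; exact: (conf_hess_sym _ _ hu half_ball_sub_punctured punctured_sub x). Qed.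

(** A touching barrier with these properties would give f(A[u]) < f(A[v]) at y, against [hsub]. B
    and r depend on x0 only, so barriers can be designed after them. *)
Lemma no_interior_touch x0 : cl x0 -> exists B r : R, [/\ 0 < B, 0 < r & forall (y : 'rV[R]_n.+1) w p (H : 'rV[R]_n.+1 -> R),
  Hb y -> `|y - x0| < r -> 0 < w <= r -> sqn p <= w ^+ 2 -> 0 <= u y - v y <= w ->
  grad u y = grad v y + p ->
  (forall xi, H xi + qf (hess v y) xi <= qf (hess u y) xi) ->
  (forall xi : 'rV[R]_n.+1, w * (B * xi 0 N ^+ 2 - sqn xi) <= H xi) -> False].
Proof.
move=> clx0.
have [V [r2 [V1 r20 bnd]]] := C2_upto_bounds _ _ hv half_ball_closure (fun x h => h) x0 clx0.
have [B [d [B0 d0 dec]]] := touch_f_lt Gam f _ N V hGam hf_sym hf_lip hf_incr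
  (conf_hess_v_sym x0 clx0) (hv_adm x0 clx0) V1.
have [r1 r10 near] := conf_hess_near _ _ hv half_ball_closure (fun x h => h) x0 d clx0 d0.
exists B, (Num.min (Num.min r1 r2) d); split => //.
  by rewrite !lt_min r10 r20.
move=> y w p H Hy; rewrite !lt_min => /andP[/andP[yr1 yr2] _] /andP[w0].
rewrite !le_min => /andP[_ wd] pw gw gu hH HB.
have [vV gV qV] := bnd y Hy yr2.
have wd' : 0 < w <= d by rewrite w0.
have Eu x := qf_conf_hess _ _ hu half_ball_sub_punctured punctured_sub y x Hy.
have Ev x := qf_conf_hess _ _ hv half_ball_closure (fun x h => h) y x Hy.
rewrite gu in Eu.
have lt := dec (conf_hess Hb v y) (conf_hess Hb u y) (hess v y) (hess u y) (grad v y) p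
  (v y) (u y) w H (conf_hess_v_sym y (half_ball_closure _ Hy)) (conf_hess_u_sym y Hy) (near y Hy yr1) Ev Eu
  vV gV qV wd' pw gw hH HB (hu_adm y Hy).
by have := lt_le_trans lt (hsub y Hy); rewrite ltxx.
Qed.

Lemma v_bounded x0 : cl x0 -> exists V r : R, [/\ 0 <= V, 0 < r &
  forall y, cl y -> `|y - x0| < r -> `|v y| <= V].
Proof.
move=> clx0; have [r r0 rP] := tends_in_bounded _ _ _ _ (C2_upto_cont _ _ hv x0 clx0).
by exists (`|v x0| + 1), r; split => //; rewrite addr_ge0.
Qed.

Lemma expR_sub1_le (s : R) : 0 <= s <= 1 -> expR s - 1 <= expR 1 * s.
Proof.
move=> /andP[s0 s1]; have := expR_ge1Dx (- s); rewrite expRN.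
have e0 := expR_gt0 s; rewrite -(ler_pM2l e0) divff ?gt_eqF// => H.
have : expR s * s <= expR 1 * s by apply: ler_wpM2r => //; rewrite ler_expR.
by move: H; lra.
Qed.

(** The boundary conditions bound the normal derivative of u - v by c (e^u - e^v), at most |c| e^V
    e^1 (u - v) when 0 <= u - v <= 1; the extra 1 in the constant only makes it positive. A barrier
    steeper than this cannot touch from below. *)
Lemma no_flat_touch x0 : cl x0 -> exists C r : R, [/\ 0 < C, 0 < r & forall (y : 'rV[R]_n.+1) b,
  sqn y < 1 -> y 0 N = 0 -> y <> 0 -> `|y - x0| < r -> 0 <= u y - v y <= 1 ->
  (exists2 t0, 0 < t0 & forall t, 0 < t < t0 ->
     b * t <= (u (y + t *: eN) - v (y + t *: eN)) - (u y - v y)) ->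
  b <= C * (u y - v y)].
Proof.
move=> clx0; have [V [r [V0 r0 vV]]] := v_bounded x0 clx0.
have C0 : 0 < `|c| * (expR V * expR 1) + 1.
  by apply: ltr_wpDl => //; rewrite !mulr_ge0 ?expR_ge0.
exists (`|c| * (expR V * expR 1) + 1), r; split => //.
move=> y b y1 yN y0 yr g01 H; have [g0 g1] := andP g01.
have Sy := punctured_in y y1 ltac:(by rewrite yN) y0.
have cly := punctured_sub y Sy.
have fb : flat_boundary R n y by split => //; rewrite enorm_sqn -[1]sqrtr1 ltr_sqrt.
have [du _ _ _] := C2_upto_on _ _ hu half_ball_sub_punctured punctured_sub.
have [dv _ _ _] := C2_upto_on _ _ hv half_ball_closure (fun x h => h).
have Db : b <= grad_upto Hb u y 0 N - grad_upto Hb v y 0 N.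
  apply: (@flat_touch R n (fun z => u z - v z) y b) => //.
  - by move=> x Hx; apply: derivableB; [exact: du|exact: dv].
  - apply: tends_inB; apply: tends_in_sub.
    + exact: half_ball_sub_punctured.
    + exact: C2_upto_cont hu _ Sy.
    + exact: half_ball_closure.
    + exact: C2_upto_cont hv _ cly.
  - apply: (@tends_in_eq _ _ _ (fun z => partial N u z - partial N v z)).
      by move=> x Hx; rewrite /partial; apply/esym/deriveB; [exact: du|exact: dv].
    apply: tends_inB; first exact: (grad_upto_tends _ _ hu half_ball_sub_punctured punctured_sub).
    exact: (grad_upto_tends _ _ hv half_ball_closure (fun x h => h)).
have D1 := hu_bd y fb y0; have D2 := hv_bd y fb.
apply: le_trans Db _.
apply: (@le_trans _ _ (c * (expR (v y) * (expR (u y - v y) - 1)))).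
  have -> : c * (expR (v y) * (expR (u y - v y) - 1)) = c * expR (u y) - c * expR (v y).
    by rewrite [X in c * X]mulrBr mulr1 -expRD [v y + _]addrC subrK mulrBr.
  by apply: lerB.
have E0 : 0 <= expR (u y - v y) - 1 by rewrite subr_ge0 -expR0 ler_expR.
have E1 := expR_sub1_le _ g01.
have E2 : expR (v y) <= expR V by rewrite ler_expR (le_trans (ler_norm _)) ?vV.
apply: (@le_trans _ _ (`|c| * (expR V * (expR 1 * (u y - v y))))).
  apply: le_trans (_ : `|c| * (expR (v y) * (expR (u y - v y) - 1)) <= _).
    by apply: ler_wpM2r; [rewrite mulr_ge0 ?expR_ge0|exact: ler_norm].
  by apply: ler_wpM2l => //; apply: ler_pM => //; exact: expR_ge0.
by rewrite mulrDl mul1r !mulrA lerDl.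
Qed.

(** Common frame of all barriers. A negative minimum of u - v - phi over the compact shell is not on
    the spherical parts, by the boundary assumption; in the interior or on the flat part it is a
    touching after a shift of phi by a constant. As u - v >= 0, phi dominates u - v there, so
    smallness of phi gives smallness of u - v. *)
Lemma comparison x0 (r1 r2 : R) (phi : 'rV[R]_n.+1 -> R) (p : 'rV[R]_n.+1 -> 'rV[R]_n.+1)
    (H : 'rV[R]_n.+1 -> 'rV[R]_n.+1 -> R) :
  (forall x, shell x0 r1 r2 0 x -> sqn x < 1 /\ x <> 0) ->
  (forall x, shell x0 r1 r2 0 x -> {for x, continuous phi}) ->
  (forall x, shell x0 r1 r2 0 x -> sqn (x - x0) = r1 \/ sqn (x - x0) = r2 -> phi x <= u x - v x) ->
  (forall y, Hb y -> r1 < sqn (y - x0) < r2 -> line_jet phi y (p y) (H y)) ->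
  (forall y, Hb y -> r1 < sqn (y - x0) < r2 -> 0 <= u y - v y <= phi y ->
    grad u y = grad v y + p y ->
    (forall xi, H y xi + qf (hess v y) xi <= qf (hess u y) xi) -> False) ->
  (forall y, sqn y < 1 -> y 0 N = 0 -> r1 < sqn (y - x0) < r2 -> 0 <= u y - v y <= phi y ->
    (exists2 t0, 0 < t0 & forall t, 0 < t < t0 ->
      phi (y + t *: eN) - phi y <= (u (y + t *: eN) - v (y + t *: eN)) - (u y - v y)) ->
    False) ->
  forall x, shell x0 r1 r2 0 x -> phi x <= u x - v x.
Proof.
move=> Dsub phic bdry jet intr flat z Dz; rewrite leNgt; apply/negP => zphi.
pose G x := u x - v x - phi x.
have DS x : shell x0 r1 r2 0 x -> (cl `\ 0) x.
  by move=> Dx; have [x1 x_0] := Dsub x Dx; apply: punctured_in => //; case: Dx.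
have Gc x : shell x0 r1 r2 0 x -> tends_in (shell x0 r1 r2 0) G x (G x).
  move=> Dx; apply: tends_inB; last by apply: tends_in_cont; exact: phic.
  apply: tends_inB; [apply: (tends_in_sub _ (cl `\ 0)) => //|apply: (tends_in_sub _ cl)].
  - exact: C2_upto_cont hu _ (DS x Dx).
  - by move=> w /DS /punctured_sub.
  - by apply: C2_upto_cont hv _ (punctured_sub x (DS x Dx)).
have [y Dy ymin] := shell_min x0 r1 r2 0 G z Gc Dz.
have Gy : u y - v y - phi y < 0 by apply: le_lt_trans (ymin z Dz) _; rewrite subr_lt0.
have [y1 y_0] := Dsub y Dy.
have [/andP[yr1 yr2] yN] := Dy.
have g0 := diff_ge0 y y1 yN y_0.
have strict : r1 < sqn (y - x0) < r2.
  rewrite !lt_neqAle yr1 yr2 !andbT; apply/andP; split; apply/eqP => E.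
    by have := bdry y Dy (or_introl (esym E)); lra.
  by have := bdry y Dy (or_intror E); lra.
have gphi : 0 <= u y - v y <= phi y by rewrite g0/=; lra.
have nbhD : nbhs y [set x | r1 < sqn (x - x0) < r2].
  have -> : [set x | r1 < sqn (x - x0) < r2] =
      [set x | r1 < sqn (x - x0)] `&` [set x | sqn (x - x0) < r2].
    by apply/seteqP; split => x /=; [move=> /andP[]|move=> [-> ->]].
  apply: open_nbhs_nbhs; split; last by apply/andP.
  by apply: openI; [exact: open_sqn_gt|exact: open_sqn_lt].
have Gmin x : r1 < sqn (x - x0) < r2 -> 0 <= x 0 N -> u y - v y - phi y <= u x - v x - phi x.
  by move=> /andP[h1 h2] xN; apply: ymin; split => //; rewrite !ltW.
have [yN0|yN0] := eqVneq (y 0 N) 0.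
  apply: (flat y y1 yN0 strict gphi).
  have [d d0 dP] := half_space_approx y _ nbhD.
  exists d => // t /andP[t0 td].
  have := Gmin (y + t *: eN) (dP t ltac:(by rewrite (ltW t0))).
  rewrite up_coord yN0 add0r (ltW t0) => /(_ isT); lra.
have Hy : Hb y by apply/half_ballE; split => //; rewrite lt_neqAle eq_sym yN0.
have ju := C2_line_jet Hb u y open_half_ball (C2_upto_on _ _ hu half_ball_sub_punctured punctured_sub) Hy.
have jv := C2_line_jet Hb v y open_half_ball (C2_upto_on _ _ hv half_ball_closure (fun x h => h)) Hy.
have jG := line_jetB _ _ _ _ _ _ _ (line_jetB _ _ _ _ _ _ _ ju jv) (jet y Hy strict).
have nbhO : nbhs y ([set x | r1 < sqn (x - x0) < r2] `&` Hb).
  by apply: filterI => //; apply: open_nbhs_nbhs; split => //; exact: open_half_ball.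
have [d /= d0 dP] := (nbhs_normP _ _).1 nbhO.
have [p0 H0] := line_jet_min _ _ _ _ d jG d0 (fun x xd => Gmin x
  (dP x ltac:(by rewrite /= distrC)).1 (ltW ((half_ballE x).1 (dP x ltac:(by rewrite /= distrC)).2).2)).
apply: (intr y Hy strict gphi).
  by apply/eqP; rewrite -subr_eq0 opprD addrA; apply/eqP.
by move=> xi; exact: le_of_diff (H0 xi).
Qed.

(** * Positivity of the difference on the punctured flat boundary *)

Lemma diff_cont (D : set 'rV[R]_n.+1) : D `<=` cl `\ 0 ->
  forall x, D x -> tends_in D (fun y => u y - v y) x (u x - v x).
Proof.
move=> DS x Dx; apply: tends_inB.
  by apply: (tends_in_sub _ (cl `\ 0)) => //; exact: C2_upto_cont hu _ (DS x Dx).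
apply: (tends_in_sub _ cl); first by move=> w /DS /punctured_sub.
by apply: C2_upto_cont hv _ (punctured_sub x (DS x Dx)).
Qed.

Lemma flat_cl x0 : sqn x0 < 1 -> x0 0 N = 0 -> cl x0.
Proof. by move=> x1 xN; apply: closure_half_ballI => //; rewrite xN. Qed.

(** The barrier is s (al x_n^2 + x_n - |x - x0|^2 + tau): the first term supplies convexity in
    direction n, the second the normal derivative, the third makes it negative where the outer
    sphere meets the flat boundary, and tau makes it positive at x0. *)
Lemma hopf x0 : sqn x0 < 1 -> x0 0 N = 0 -> x0 <> 0 -> 0 < u x0 - v x0.
Proof.
move=> x01 x0N x0_0; rewrite ltNge; apply/negP => g0.
have clx0 := flat_cl x0 x01 x0N.
have [B [ri [B0 ri0 intT]]] := no_interior_touch x0 clx0.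
have [C [rf [C0 rf0 flatT]]] := no_flat_touch x0 clx0.
have [d /= d0 dP] := (nbhs_normP _ _).1 (nbhs_sqn_lt1 x0 x01).
have nx0 : 0 < `|x0| by rewrite normr_gt0; apply/eqP.
(* The Hessian form is then s (4 B xi_n^2 - 2 |xi|^2), which exceeds the required 3 s (B xi_n^2 -
   |xi|^2). *)
pose al := 2 * B.
have al0 : 0 < al by rewrite mulr_gt0.
pose rr := Num.min (Num.min ri rf) (Num.min d `|x0|).
have rr0 : 0 < rr by rewrite !lt_min ri0 rf0 d0.
pose r := Num.min (rr / 2) (Num.min (1 / 2) (1 / (4 * al))).
have r0 : 0 < r by rewrite !lt_min !divr_gt0// mulr_gt0.
have rrr : r < rr.
  have : r <= rr / 2 by rewrite ge_min lexx.
  have h : rr / 2 < rr by lra.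
  by move=> /le_lt_trans; apply.
have r12 : r <= 1 / 2 by rewrite !ge_min lexx orbT.
have ral : al * r <= 1 / 4.
  have : r <= 1 / (4 * al) by rewrite !ge_min lexx !orbT.
  rewrite ler_pdivlMr ?mulr_gt0//; lra.
clearbody r.
have near x : sqn (x - x0) <= r ^+ 2 -> `|x - x0| < rr.
  by move=> /(norm_le_of_sqn _ _ (ltW r0)) /le_lt_trans; apply.
have good x : sqn (x - x0) <= r ^+ 2 -> sqn x < 1 /\ x <> 0.
  move=> /near; rewrite !lt_min => /andP[_ /andP[xd xx0]]; split.
    by apply: dP; rewrite /= distrC.
  by move=> xE; move: xx0; rewrite xE sub0r normrN ltxx.
have xNr x : sqn (x - x0) <= r ^+ 2 -> x 0 N <= r.
  move=> h; apply: le_of_sqr_le; first exact: ltW.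
  by apply: le_trans h; have := coord_sqn (x - x0) N; rewrite !mxE x0N subr0.
(* The first bound keeps the barrier negative low on the outer sphere; the second rules out flat
   touching, where s / 2 <= C s tau <= s / 4 would follow. *)
pose tau := Num.min (r ^+ 2 / 4) (1 / (4 * C)).
have r20 : 0 < r ^+ 2 by rewrite exprn_gt0.
have r21 : r ^+ 2 <= 1 / 4.
  have : r ^+ 2 <= (1 / 2) ^+ 2 by rewrite lerXn2r// nnegrE; [exact: ltW|rewrite divr_ge0].
  by rewrite [(1 / 2) ^+ 2]expr2; lra.
have tau0 : 0 < tau by rewrite lt_min !divr_gt0// mulr_gt0.
have tau1 : tau <= r ^+ 2 / 4 by rewrite ge_min lexx.
have tauC : C * tau <= 1 / 4.
  have : tau <= 1 / (4 * C) by rewrite ge_min lexx orbT.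
  rewrite ler_pdivlMr ?mulr_gt0//; lra.
clearbody tau.
(* Below height h on the outer sphere the barrier is at most s (r^2 / 2 - r^2 + r^2 / 4) < 0; the
   part above h is compact in the half ball, where u - v has a positive minimum. *)
pose h := Num.min 1 (r ^+ 2 / (2 * (al + 1))).
have h0 : 0 < h by rewrite lt_min ltr01 divr_gt0// mulr_gt0// addr_gt0.
have hal : (al + 1) * h <= r ^+ 2 / 2.
  have : h <= r ^+ 2 / (2 * (al + 1)) by rewrite ge_min lexx orbT.
  rewrite ler_pdivlMr ?mulr_gt0 ?addr_gt0//; lra.
have h1 : h <= 1 by rewrite ge_min lexx.
clearbody h.
have KH x : shell x0 (r ^+ 2) (r ^+ 2) h x -> Hb x.
  move=> [/andP[_ xr] xh]; apply/half_ballE; split; first by have [] := good x xr.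
  exact: lt_le_trans xh.
have [m m0 mP] := shell_positive_lb x0 (r ^+ 2) (r ^+ 2) h (fun y => u y - v y)
  (diff_cont _ (fun x Kx => half_ball_sub_punctured _ (KH x Kx)))
  (fun x Kx => ltac:(by rewrite subr_gt0; apply: huv; exact: KH)).
(* The value 3 s bounds both the barrier and its gradient. It must not exceed 1 for flat touching, m
   on the upper part of the sphere, and [ri] as the amplitude w of interior touching. *)
pose s := Num.min (1 / 3) (Num.min (m / 3) (ri / 3)).
have s0 : 0 < s by rewrite !lt_min !divr_gt0.
have s1 : 3 * s <= 1.
  have : s <= 1 / 3 by rewrite ge_min lexx.
  lra.
have sm : 3 * s <= m.
  have : s <= m / 3 by rewrite !ge_min lexx orbT.
  lra.
have sri : 3 * s <= ri.
  have : s <= ri / 3 by rewrite !ge_min lexx !orbT.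
  lra.
clearbody s.
pose phi (x : 'rV[R]_n.+1) := s * (al * x 0 N ^+ 2 + x 0 N - sqn (x - x0) + tau).
pose p (y : 'rV[R]_n.+1) : 'rV[R]_n.+1 :=
  s *: ((2 * al * y 0 N + 1) *: eN + (- 2) *: (y - x0)).
pose H (y xi : 'rV[R]_n.+1) : R := s * (2 * al * xi 0 N ^+ 2 - 2 * sqn xi).
have dotp y xi : dot (p y) xi = s * ((2 * al * y 0 N + 1) * xi 0 N - 2 * dot (y - x0) xi).
  by rewrite /p dotZl dotDl dotZl dot_delta dotZl mulNr.
have phiE y xi t : phi (y + t *: xi) = phi y + t * dot (p y) xi + t ^+ 2 * (H y xi / 2).
  rewrite dotp /phi /H.
  have -> : y + t *: xi - x0 = (y - x0) + t *: xi by rewrite addrAC.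
  rewrite sqn_line.
  have -> : (y + t *: xi) 0 N = y 0 N + t * xi 0 N by rewrite !mxE.
  by field.
have phi_le (x : 'rV[R]_n.+1) : 0 <= x 0 N -> sqn (x - x0) <= r ^+ 2 -> phi x <= 3 * s.
  move=> xN xr; rewrite /phi mulrC ler_pM2r//; have := xNr x xr; have := sqn_ge0 (x - x0).
  have : al * x 0 N ^+ 2 <= al * r * r.
    by rewrite -mulrA ler_pM2l// expr2 ler_pM// xNr.
  have : al * r * r <= 1 / 4 * r by rewrite ler_pM2r.
  by move: tau1 r21 r12; lra.
have phic x : {for x, continuous phi}.
  have C2 : (x : 'rV[R]_n.+1) 0 N @[x --> x] --> (x 0 N : R^o) by exact: coord_continuous.
  apply: (@cvgM R 'rV[R]_n.+1 (nbhs x) _ (fun=> s)); first exact: cvg_cst.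
  apply: (@cvgD R R^o); last exact: cvg_cst.
  apply: (@cvgB R R^o); last exact: continuous_sqn.
  apply: (@cvgD R R^o); last exact: C2.
  apply: (@cvgM R 'rV[R]_n.+1 (nbhs x) _ (fun=> al)); first exact: cvg_cst.
  by apply: (@cvgM R 'rV[R]_n.+1 (nbhs x) _ (fun y : 'rV[R]_n.+1 => y 0 N) (fun y : 'rV[R]_n.+1 => y 0 N)).
(* A negative inner squared radius makes the inner sphere empty, and x0 itself belongs to the
   shell. *)
have := comparison x0 (- 1) (r ^+ 2) phi p H.
have Dr x : shell x0 (- 1) (r ^+ 2) 0 x -> sqn (x - x0) <= r ^+ 2 by move=> [/andP[]].
move=> /(_ (fun x Dx => good x (Dr x Dx)) (fun x _ => phic x)).
have bdry x : shell x0 (- 1) (r ^+ 2) 0 x ->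
    sqn (x - x0) = - 1 \/ sqn (x - x0) = r ^+ 2 -> phi x <= u x - v x.
  move=> Dx [E|E]; first by have := sqn_ge0 (x - x0); rewrite E; lra.
  have [x1 x_0] := good x (Dr x Dx); have [_ xN] := Dx.
  have [xh|xh] := leP h (x 0 N).
    apply: le_trans (mP x _); last by split => //; rewrite E lexx.
    by apply: le_trans sm; apply: phi_le => //; exact: Dr.
  apply: le_trans (diff_ge0 x x1 xN x_0); rewrite /phi E.
  rewrite pmulr_rle0//.
  have A1 : al * x 0 N ^+ 2 <= al * h.
    rewrite ler_pM2l// expr2; apply: le_trans (_ : h * 1 <= _); last by rewrite mulr1.
    by apply: ler_pM => //; lra.
  by move: hal tau1 A1 xh r20; lra.
move=> /(_ bdry (fun y _ _ => line_jet_quadratic _ _ _ _ (phiE y))).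
have intr y : Hb y -> - 1 < sqn (y - x0) < r ^+ 2 -> 0 <= u y - v y <= phi y ->
    grad u y = grad v y + p y ->
    (forall xi, H y xi + qf (hess v y) xi <= qf (hess u y) xi) -> False.
  move=> Hy /andP[_ /ltW yr] /andP[gy0 gphi] gE hE.
  have [_ yN] := (half_ballE y).1 Hy.
  have yri : `|y - x0| < ri by have := near y yr; rewrite !lt_min => /andP[/andP[]].
  apply: (intT y (3 * s) (p y) (H y) Hy yri _ _ _ gE hE).
  - by rewrite mulr_gt0.
  - have zN : (y - x0) 0 N = y 0 N by rewrite !mxE x0N subr0.
    rewrite sqnZ sqnD !sqnZ sqn_delta mulr1 dotZl dotZr dot_delta zN.
    have := xNr y yr.
    have : al * y 0 N <= al * r by rewrite ler_pM2l// xNr.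
    have := mulr_gt0 al0 yN.
    move=> a1 a2 a3; apply: hopf_gradient_alg; [exact: ltW|lra|lra|exact: le_trans yr _].
  - by rewrite gy0/=; apply: le_trans gphi _; apply: phi_le => //; exact: ltW.
  - move=> xi; rewrite /H; have := sqn_ge0 xi; have := sqr_ge0 (xi 0 N) => a1 a2.
    have -> : 3 * s * (B * xi 0 N ^+ 2 - sqn xi) = s * (3 * (B * xi 0 N ^+ 2) - 3 * sqn xi) by ring.
    rewrite ler_pM2l// /al; have : 0 <= B * xi 0 N ^+ 2 by rewrite mulr_ge0// ltW.
    by lra.
move=> /(_ intr).
have flat y : sqn y < 1 -> y 0 N = 0 -> - 1 < sqn (y - x0) < r ^+ 2 -> 0 <= u y - v y <= phi y ->
    (exists2 t0, 0 < t0 & forall t, 0 < t < t0 ->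
      phi (y + t *: eN) - phi y <= (u (y + t *: eN) - v (y + t *: eN)) - (u y - v y)) ->
    False.
  move=> y1 yN /andP[_ /ltW yr] /andP[gy0 gphi] [t0 t00 tP].
  have [_ y_0] := good y yr.
  have yrf : `|y - x0| < rf by have := near y yr; rewrite !lt_min => /andP[/andP[]].
  have gy1 : u y - v y <= 1.
    by apply: le_trans gphi _; apply: le_trans s1; apply: phi_le => //; rewrite yN.
  have H1 : exists2 t0, 0 < t0 & forall t, 0 < t < t0 ->
      s / 2 * t <= (u (y + t *: eN) - v (y + t *: eN)) - (u y - v y).
    exists (Num.min t0 (1 / 2)); first by rewrite lt_min t00 divr_gt0.
    move=> t; rewrite lt_min => /andP[tp /andP[tt0 t12]].
    apply: le_trans (tP t _); last by rewrite tp.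
    have zN : (y - x0) 0 N = 0 by rewrite !mxE x0N yN subr0.
    rewrite phiE dotp /H sqn_delta [dot (y - x0) _]dotC dot_delta zN yN.
    rewrite mxE !eqxx /= expr1n !mulr1 !mulr0 add0r subr0 mulr1.
    have -> : phi y + t * s + t ^+ 2 * (s * (2 * al - 2) / 2) - phi y =
        s * (t + t ^+ 2 * (al - 1)) by field.
    rewrite -mulrA ler_pM2l//.
    have : 0 <= t ^+ 2 * al by rewrite mulr_ge0 ?sqr_ge0 ?ltW.
    have : t ^+ 2 <= t * (1 / 2) by rewrite expr2 ler_pM2l// ltW.
    by lra.
  have := flatT y (s / 2) y1 yN y_0 yrf _ H1; rewrite gy0 gy1 => /(_ isT).
  have : C * (u y - v y) <= C * (s * tau).
    rewrite ler_pM2l//; apply: le_trans gphi _; rewrite /phi yN ler_pM2l// expr0n mulr0.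
    by have := sqn_ge0 (y - x0); lra.
  have : s * (C * tau) <= s * (1 / 4) by rewrite ler_pM2l.
  by move: s0; lra.
move=> /(_ flat x0); rewrite /shell/= subrr sqn0 x0N lexx (ltW r20) lerN10 => /(_ (conj isT isT)).
have -> : phi x0 = s * tau by rewrite /phi x0N subrr sqn0; ring.
by move=> /(lt_le_trans (mulr_gt0 s0 tau0)); rewrite ltNge g0.
Qed.

(** On the flat boundary |y + t e_n|^2 = |y|^2 + t^2, so the radial part does not decrease upwards
    and the barrier has slope at least b there, too steep for [flatT] as soon as C times its outer
    value is below b. On the inner sphere the barrier is at most 0 <= u - v. *)
Lemma radial_comparison (A e a k b r1 r C rf : R) :
  0 <= e -> 0 <= a -> 0 <= k -> 0 <= b -> 0 < r1 -> 0 < r < 1 -> 0 < C -> r < rf ->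
  (forall y b, sqn y < 1 -> y 0 N = 0 -> y <> 0 -> `|y - 0| < rf -> 0 <= u y - v y <= 1 ->
    (exists2 t0, 0 < t0 & forall t, 0 < t < t0 ->
      b * t <= (u (y + t *: eN) - v (y + t *: eN)) - (u y - v y)) ->
    b <= C * (u y - v y)) ->
  profile A e a k r1 + b * Num.sqrt r1 <= 0 ->
  (forall x, sqn x = r ^+ 2 -> 0 <= x 0 N -> profile A e a k (r ^+ 2) + b * r <= u x - v x) ->
  profile A e a k (r ^+ 2) <= 1 -> C * profile A e a k (r ^+ 2) < b ->
  (forall y, Hb y -> sqn y < r ^+ 2 ->
    0 <= u y - v y <= profile A e a k (sqn y) + b * y 0 N ->
    grad u y = grad v y + ((2 * profile1 e a k (sqn y)) *: y + b *: eN) ->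
    (forall xi, (4 * profile2 e k (sqn y) * dot y xi ^+ 2 + 2 * profile1 e a k (sqn y) * sqn xi)
      + qf (hess v y) xi <= qf (hess u y) xi) -> False) ->
  forall x, r1 <= sqn x <= r ^+ 2 -> 0 <= x 0 N ->
    profile A e a k (sqn x) + b * x 0 N <= u x - v x.
Proof.
move=> e0 a0 k0 b0 r10 /andP[r0 r_lt1] C0 rrf flatT inner outer Fr1 CF intr x xr xN.
have r2lt1 : r ^+ 2 < 1 by rewrite expr_lt1// ltW.
have D0 (y : 'rV[R]_n.+1) : shell 0 r1 (r ^+ 2) 0 y -> [/\ r1 <= sqn y, sqn y <= r ^+ 2 & 0 <= y 0 N].
  by rewrite /shell/= subr0 => -[/andP[-> ->] ->].
have Dpos (y : 'rV[R]_n.+1) : shell 0 r1 (r ^+ 2) 0 y -> 0 < sqn y.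
  by move=> Dy; have [h _ _] := D0 y Dy; exact: lt_le_trans h.
have yle (y : 'rV[R]_n.+1) : sqn y <= r ^+ 2 -> y 0 N <= r.
  by move=> h; apply: le_trans (coord_le_sqrt y N) _; apply: sqrt_le_of_sqn => //; exact: ltW.
have Dx : shell 0 r1 (r ^+ 2) 0 x by rewrite /shell/= subr0.
apply: (comparison 0 r1 (r ^+ 2) (fun y => profile A e a k (sqn y) + b * y 0 N)
  (fun y => (2 * profile1 e a k (sqn y)) *: y + b *: eN)
  (fun y xi => 4 * profile2 e k (sqn y) * dot y xi ^+ 2 + 2 * profile1 e a k (sqn y) * sqn xi) _ _ _ _ _ _ x Dx).
- move=> y Dy; have [_ yr _] := D0 y Dy; split; first exact: le_lt_trans r2lt1.
  by move=> y0; have := Dpos y Dy; rewrite y0 sqn0 ltxx.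
- move=> y Dy; apply: (continuous_radial _ _ b (fun s => is_derive_profile A e a k s)); exact: Dpos.
- move=> y Dy; have [h1 h2 yN] := D0 y Dy; rewrite subr0 => -[E|E].
    apply: (@le_trans _ _ 0); last first.
      apply: diff_ge0 => //; first exact: le_lt_trans r2lt1.
      by move=> y0; have := Dpos y Dy; rewrite y0 sqn0 ltxx.
    rewrite E; apply: le_trans inner; rewrite lerD2l ler_wpM2l// -E.
    exact: coord_le_sqrt.
  rewrite E; apply: le_trans (outer y E yN).
  by rewrite lerD2l ler_wpM2l// yle.
- move=> y Hy; rewrite subr0 => /andP[yr1 _].
  exact: (line_jet_radial _ _ _ b (fun s => is_derive_profile A e a k s)
    (fun s => is_derive_profile1 e a k s) y (lt_trans r10 yr1)).
- by move=> y Hy; rewrite subr0 => /andP[_ yr]; exact: intr.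
- move=> y y1 yN; rewrite subr0 => /andP[yr1 yr] /andP[g0]; rewrite yN mulr0 addr0 => gF [t0 t00 tP].
  have y0 : y <> 0 by move=> y0; move: (lt_trans r10 yr1); rewrite y0 sqn0 ltxx.
  have FF : profile A e a k (sqn y) <= profile A e a k (r ^+ 2).
    by apply: profile_le => //; [exact: lt_trans yr1|exact: ltW].
  have yrf : `|y - 0| < rf.
    rewrite subr0; apply: le_lt_trans (norm_le_sqrt y) _; apply: le_lt_trans rrf.
    by apply: sqrt_le_of_sqn; exact: ltW.
  have := flatT y b y1 yN y0 yrf; rewrite g0 (le_trans gF (le_trans FF Fr1)) => /(_ isT).
  have H1 : exists2 t0, 0 < t0 & forall t, 0 < t < t0 ->
      b * t <= (u (y + t *: eN) - v (y + t *: eN)) - (u y - v y).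
    exists t0 => // t tt0; apply: le_trans (tP t tt0).
    rewrite /= up_coord yN add0r; have /andP[tp _] := tt0.
    have : profile A e a k (sqn y) <= profile A e a k (sqn (y + t *: eN)).
      apply: profile_le => //; first exact: lt_trans yr1.
      by rewrite sqn_line dotC dot_delta yN !mulr0 addr0 lerDl mulr_ge0 ?sqr_ge0 ?sqn_ge0.
    exact: le_increment.
  move=> /(_ H1) bC.
  have : C * (u y - v y) <= C * profile A e a k (r ^+ 2).
    by rewrite ler_pM2l// (le_trans gF).
  by move=> /(le_trans bC) /le_lt_trans /(_ CF); rewrite ltxx.
Qed.

(** The constant -e makes the barrier nonpositive on a small sphere around 0, where u is not
    controlled. No other coefficient depends on e, so e can tend to 0, and k becomes the growth rate
    rho. *)
Lemma linear_lower_bound : exists rho r : R, [/\ 0 < rho, rho <= 1, 0 < r, r < 1 &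
  forall x, 0 < sqn x -> sqn x <= r ^+ 2 -> 0 <= x 0 N ->
    rho * Num.sqrt (sqn x) <= u x - v x].
Proof.
have [B [ri [B0 ri0 intT]]] := no_interior_touch 0 closure_half_ball0.
have [C [rf [C0 rf0 flatT]]] := no_flat_touch 0 closure_half_ball0.
(* With amplitude w = a [kp], the bound [kp * B <= 2] lets the Hessian 2 a of a|x|^2 provide the
   required convexity w B. *)
have [kp [kp0 kp1 kpB]] : exists kp : R, [/\ 0 < kp, kp <= 1 & kp * B <= 2].
  exists (Num.min 1 (2 / B)); split.
  - by rewrite lt_min ltr01 divr_gt0.
  - by rewrite ge_min lexx.
  - by rewrite -ler_pdivlMr// ge_min lexx orbT.
have [r [r0 rri rrf rkp rC]] : exists r : R,
    [/\ 0 < r, r < ri, r < rf, r <= kp / 8 & C * r <= 1 / 8].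
  exists (Num.min (Num.min (ri / 2) (rf / 2)) (Num.min (kp / 8) (1 / (8 * C)))); split.
  - by rewrite !lt_min !divr_gt0// mulr_gt0.
  - apply: (@le_lt_trans _ _ (ri / 2)); first by rewrite !ge_min lexx.
    by rewrite ltr_pdivrMr//; lra.
  - apply: (@le_lt_trans _ _ (rf / 2)); first by rewrite !ge_min lexx orbT.
    by rewrite ltr_pdivrMr//; lra.
  - by rewrite !ge_min lexx !orbT.
  - have : Num.min (Num.min (ri / 2) (rf / 2)) (Num.min (kp / 8) (1 / (8 * C))) <= 1 / (8 * C).
      by rewrite !ge_min lexx !orbT.
    rewrite ler_pdivlMr ?mulr_gt0//; lra.
have r1 : r < 1 by lra.
have r2lt1 : r ^+ 2 < 1 by rewrite expr_lt1// ltW.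
have r2r : r ^+ 2 <= r by rewrite expr2 ler_piMr// ltW.
have Kpos x : shell 0 (r ^+ 2) (r ^+ 2) 0 x -> [/\ sqn x < 1, 0 <= x 0 N & x <> 0].
  rewrite /shell/= subr0 => -[/andP[h1 h2] xN]; split => //; first exact: le_lt_trans r2lt1.
  by move=> x0; move: h1; rewrite x0 sqn0 leNgt exprn_gt0.
(* The half sphere includes its rim on the flat boundary; positivity there is the Hopf lemma. *)
have gpos x : shell 0 (r ^+ 2) (r ^+ 2) 0 x -> 0 < u x - v x.
  move=> /Kpos[x1 xN x0]; have [xN0|xN0] := eqVneq (x 0 N) 0; first exact: hopf.
  by rewrite subr_gt0; apply: huv; apply/half_ballE; split => //; rewrite lt_neqAle eq_sym xN0.
have [m m0 mP] := shell_positive_lb 0 (r ^+ 2) (r ^+ 2) 0 (fun y => u y - v y)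
  (diff_cont _ (fun x Kx => let: And3 a1 a2 a3 := Kpos x Kx in punctured_in x a1 a2 a3)) gpos.
have [a [a0 a1 am ari]] : exists a : R, [/\ 0 < a, a <= 1, a <= m & a <= ri].
  exists (Num.min 1 (Num.min m ri)); split.
  - by rewrite !lt_min ltr01 m0.
  - by rewrite ge_min lexx.
  - by rewrite !ge_min lexx orbT.
  - by rewrite !ge_min lexx !orbT.
(* The same k multiplies |x| and x_n, so the gradient is at most 2 a r + 2 k <= (3/4) a [kp], within
   the amplitude. *)
have [k [k0 kE]] : exists k : R, 0 < k /\ k = a * kp / 4.
  by exists (a * kp / 4); rewrite divr_gt0// mulr_gt0.
have akp : a * kp <= a by rewrite ler_piMr// ltW.
have akp0 : 0 < a * kp by rewrite mulr_gt0.
have ark : a * r <= a * kp / 8 by rewrite -mulrA ler_pM2l.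
have ar0 : 0 < a * r by rewrite mulr_gt0.
have kr : k * r <= k * 1 by rewrite ler_pM2l// ltW.
have ar2 : a * r ^+ 2 <= a * r by rewrite ler_pM2l.
have main e x : 0 < e -> e <= 1 -> 0 < sqn x -> sqn x <= r ^+ 2 -> 0 <= x 0 N ->
    profile (- e) 0 a k (sqn x) + k * x 0 N <= u x - v x.
  move=> e0 e1 x0 xr xN.
  have t0 : 0 < Num.sqrt (sqn x) by rewrite sqrtr_gt0.
  (* The inner radius: small enough that e outweighs the other terms there, and at most |x| so that
     x lies in the annulus. *)
  have [d [d0 de d1 dx]] : exists d : R, [/\ 0 < d, d <= e / 2, d <= 1 & d <= Num.sqrt (sqn x)].
    exists (Num.min (e / 2) (Num.min 1 (Num.sqrt (sqn x)))); split.
    - by rewrite !lt_min divr_gt0// ltr01.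
    - by rewrite ge_min lexx.
    - by rewrite !ge_min lexx orbT.
    - by rewrite !ge_min lexx !orbT.
  have profE s t : 0 <= t -> s = t ^+ 2 -> profile (- e) 0 a k s = - e + a * t ^+ 2 + k * t.
    by move=> tge0 ->; rewrite /profile sqrtr_sqr ger0_norm// mul0r addr0.
  apply: (radial_comparison (- e) 0 a k k (d ^+ 2) r C rf) => //.
  - exact: ltW.
  - exact: ltW.
  - exact: ltW.
  - by rewrite exprn_gt0.
  - by rewrite r0.
  - rewrite (profE _ d) ?ltW// sqrtr_sqr (gtr0_norm d0).
    have : a * d ^+ 2 <= d.
      by rewrite expr2 mulrA; apply: ler_piMl; [exact: ltW|apply: mulr_ile1 => //; exact: ltW].
    have : k * d <= d / 4.
      by rewrite mulrC ler_pM2l//; lra.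
    lra.
  - move=> y yr yN; apply: le_trans (mP y _); last by rewrite /shell/= subr0 yr lexx.
    rewrite (profE _ r) ?ltW//; lra.
  - rewrite (profE _ r) ?ltW//; lra.
  - rewrite (profE _ r) ?ltW//.
    have -> : C * (- e + a * r ^+ 2 + k * r) = C * r * (a * r + k) - C * e by ring.
    have : C * r * (a * r + k) <= 1 / 8 * (a * r + k) by rewrite ler_pM2r// addr_gt0.
    have : 0 < C * e by rewrite mulr_gt0.
    lra.
  - move=> y Hy yr /andP[g0 gphi] gE hE.
    have [_ yN] := (half_ballE y).1 Hy.
    have y0 : 0 < sqn y by apply: sqn_gt0 => y0; move: yN; rewrite y0 mxE ltxx.
    have yt : Num.sqrt (sqn y) <= r by apply: sqrt_le_of_sqn; exact: ltW.
    have t1 : 0 < Num.sqrt (sqn y) by rewrite sqrtr_gt0.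
    have ty : Num.sqrt (sqn y) ^+ 2 = sqn y by rewrite sqr_sqrtr// ltW.
    have yNt := coord_le_sqrt y N.
    apply: (intT y (a * kp) _ _ Hy _ _ _ _ gE hE).
    + by rewrite subr0; apply: le_lt_trans (norm_le_sqrt y) _; exact: le_lt_trans rri.
    + by rewrite akp0 (le_trans akp).
    + apply: radial_gradient_sqn; [|exact: ltW|].
        by rewrite mulr_ge0// /profile1 mul0r add0r addr_ge0 ?mulr_ge0 ?invr_ge0 ?ltW// mulr_gt0.
      have -> : 2 * profile1 0 a k (sqn y) * Num.sqrt (sqn y) = 2 * (a * Num.sqrt (sqn y)) + k.
        by rewrite /profile1; field; rewrite !gt_eqF.
      have : a * Num.sqrt (sqn y) <= a * r by rewrite ler_pM2l.
      lra.
    + rewrite g0/=; apply: le_trans gphi _; rewrite (profE _ (Num.sqrt (sqn y))) ?ltW//.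
      have : a * Num.sqrt (sqn y) ^+ 2 <= a * r ^+ 2 by rewrite ler_pM2l// ty ltW.
      have : k * Num.sqrt (sqn y) <= k * r by rewrite ler_pM2l.
      have : k * y 0 N <= k * r by rewrite ler_pM2l// (le_trans yNt).
      have : k * r <= k * (1 / 8) by rewrite ler_pM2l//; lra.
      lra.
    + move=> xi; apply: (convex_barrier_alg _ _ _ _ _ _ _ (ltW a0) (ltW k0) (ltW B0) (ltW akp0)) => //.
      by rewrite -mulrA [2 * a]mulrC ler_pM2l.
  - apply/andP; split => //.
    by rewrite -(sqr_sqrtr (ltW x0)) lerXn2r// nnegrE ltW.
exists k, r; split => //; first lra.
move=> x x0 xr xN; apply/ler_addgt0Pl => e e0.
have e'0 : 0 < Num.min e 1 by rewrite lt_min e0 ltr01.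
have e'1 : Num.min e 1 <= 1 by rewrite ge_min lexx orbT.
have e'e : Num.min e 1 <= e by rewrite ge_min lexx.
have := main _ x e'0 e'1 x0 xr xN; rewrite /profile mul0r addr0.
have := mulr_ge0 (ltW a0) (ltW x0).
have := mulr_ge0 (ltW k0) xN.
lra.
Qed.

(** At a touching point the form of A[u] is at most a positive multiple of 2 (y/|y| . xi)^2 - |xi|^2
    + th |xi|^2, which [cone_avoids_lambda_star] forbids. The factor exp(-2u) goes into the multiple
    K, so no bound on u is involved; E bounds exp(2v) A[v]. *)
Lemma no_singular_touch : ~ closure Gam (lambda_star R n) -> exists E V th r : R,
  [/\ 0 <= E, 0 <= V, 0 < th, 0 < r & forall (y : 'rV[R]_n.+1) e k b m, Hb y -> `|y| < r ->
    0 <= e -> 0 < k -> 0 <= b -> m = 2 * profile1 e 0 k (sqn y) ->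
    E + 3 * V * (m * Num.sqrt (sqn y) + b) + (2 * (m * Num.sqrt (sqn y)) * b + b ^+ 2) <=
      th * (m + 2^-1 * m ^+ 2 * sqn y) ->
    grad u y = grad v y + (m *: y + b *: eN) ->
    (forall xi, (4 * profile2 e k (sqn y) * dot y xi ^+ 2 + m * sqn xi)
      + qf (hess v y) xi <= qf (hess u y) xi) -> False].
Proof.
move=> /(cone_avoids_lambda_star Gam hGam)[th th0 thP].
have [V [r [V1 r0 bnd]]] := C2_upto_bounds _ _ hv half_ball_closure (fun x h => h) 0 closure_half_ball0.
have V0 : 0 <= V by apply: le_trans V1.
exists (expR (2 * V) * V), V, th, r; split => //; first by rewrite mulr_ge0 ?expR_ge0.
move=> y e k b m Hy yr e0 k0 b0 mE small gE hE.
have [vV gV qV] : [/\ `|v y| <= V, sqn (grad v y) <= V ^+ 2 &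
    forall xi, `|qf (conf_hess Hb v y) xi| <= V * sqn xi] by apply: bnd => //; rewrite subr0.
have [_ yN] := (half_ballE y).1 Hy.
have y0 : 0 < sqn y by apply: sqn_gt0 => y0; move: yN; rewrite y0 mxE ltxx.
have t0 : 0 < Num.sqrt (sqn y) by rewrite sqrtr_gt0.
have t2 : Num.sqrt (sqn y) ^+ 2 = sqn y by rewrite sqr_sqrtr// ltW.
have m0 : 0 < m.
  by rewrite mE mulr_gt0// /profile1 addr0 ltr_wpDl ?divr_gt0 ?mulr_gt0// divr_ge0// ltW.
have w0 : 0 <= m * Num.sqrt (sqn y) + b by rewrite addr_ge0// mulr_ge0// ltW.
have pw := radial_gradient_sqn y m b _ (ltW m0) b0 (lexx _).
have Eu x := qf_conf_hess _ _ hu half_ball_sub_punctured punctured_sub y x Hy.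
have Ev x := qf_conf_hess _ _ hv half_ball_closure (fun x h => h) y x Hy.
rewrite gE in Eu.
have tq := touch_qf _ _ _ _ _ _ _ _ V _ _ V0 w0 Ev Eu gV pw hE.
apply: (thP (conf_hess Hb u y) ((Num.sqrt (sqn y))^-1 *: y)
  (expR (- (2 * u y)) * (m + 2^-1 * m ^+ 2 * sqn y))) (hu_adm y Hy).
- exact: (conf_hess_u_sym y Hy).
- by rewrite sqnZ exprVn t2 mulVf// gt_eqF.
- rewrite mulr_gt0 ?expR_gt0// addr_gt0// !mulr_gt0 ?exprn_gt0//.
- move=> xi; apply: le_trans (tq xi) _; rewrite -(mulrA (expR _)) ler_pM2l ?expR_gt0//.
  apply: (conformal_barrier_alg _ _ _ _ _ _ _ _ _ _ e0 (ltW k0) b0 y0 (ltW yN) mE _ small).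
  apply: (@le_trans _ _ (expR (2 * v y) * (V * sqn xi))).
    by apply: ler_wpM2l; [exact: expR_ge0|exact: le_trans (ler_norm _) (qV xi)].
  rewrite mulrA; apply: ler_wpM2r; first exact: sqn_ge0.
  apply: ler_wpM2r => //; rewrite ler_expR; apply: ler_wpM2l => //.
  exact: le_trans (ler_norm _) vV.
Qed.

(** On |x| = r the logarithm is at most 0 and the constant, the |x| and the x_n terms add up to at
    most rho r, which [linear_lower_bound] puts below u - v. The coefficient rho / 2 of |x| gives m
    |y| >= rho / 2 for every e, so r is fixed before e. *)
Lemma diff_lower_bound : ~ closure Gam (lambda_star R n) -> exists de r : R, [/\ 0 < de, 0 < r &
  forall x, 0 < sqn x -> sqn x <= r ^+ 2 -> 0 <= x 0 N -> de <= u x - v x].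
Proof.
move=> /no_singular_touch[E [V [th [ri [E0 V0 th0 ri0 intT]]]]].
have [C [rf [C0 rf0 flatT]]] := no_flat_touch 0 closure_half_ball0.
have [rho [rl [rho0 rho1 rl0 rl1 lin]]] := linear_lower_bound.
have D0 : 0 < 2 * E / rho + 5 * V + 1.
  by rewrite ltr_wpDl// addr_ge0 ?mulr_ge0// ?invr_ge0 ltW.
have [r [r0 [rrl rri] rrf rC rD]] : exists r : R,
    [/\ 0 < r, r <= rl /\ r < ri, r < rf, C * r <= 1 / 8 & r * (2 * E / rho + 5 * V + 1) <= th].
  move: D0; move: (2 * E / rho + 5 * V + 1) => D D0.
  exists (Num.min rl (Num.min (Num.min (ri / 2) (rf / 2)) (Num.min (1 / (8 * C)) (th / D)))); split.
  - by rewrite !lt_min rl0 !divr_gt0// mulr_gt0.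
  - split; first by rewrite ge_min lexx.
    apply: (@le_lt_trans _ _ (ri / 2)); first by rewrite !ge_min lexx !orbT.
    by rewrite ltr_pdivrMr//; lra.
  - apply: (@le_lt_trans _ _ (rf / 2)); first by rewrite !ge_min lexx !orbT.
    by rewrite ltr_pdivrMr//; lra.
  - rewrite mulrC -ler_pdivlMr// -mulrA -invfM.
    by rewrite !ge_min lexx !orbT.
  - by rewrite -ler_pdivlMr// !ge_min lexx !orbT.
have r1 : r < 1 by exact: le_lt_trans rl1.
have r20 : 0 < r ^+ 2 by rewrite exprn_gt0.
have lnr : ln (r ^+ 2) <= 0 by rewrite ln_le0// expr_le1// ltW.
have rhor : rho * r <= 1 by rewrite mulr_ile1// ltW.
have rr0 : 0 < rho * r by rewrite mulr_gt0.
exists (rho * r / 4), r; split => //; first by rewrite divr_gt0.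
move=> z z0 zr zN.
have main e : 0 < e -> rho * r / 4 + e * ln (sqn z) <= u z - v z.
  move=> e0.
  (* On the inner sphere the other terms are at most rho r in total, so e ln s <= - rho r makes the
     barrier nonpositive. *)
  have [r1' [r1'0 r1'z r1'e]] : exists s : R, [/\ 0 < s, s <= sqn z & e * ln s <= - (rho * r)].
    exists (Num.min (expR (- (rho * r) / e)) (sqn z)); split.
    - by rewrite lt_min expR_gt0 z0.
    - by rewrite ge_min lexx orbT.
    - rewrite mulrC -ler_pdivlMr// -[leRHS]expRK ler_ln ?posrE ?expR_gt0 ?lt_min ?expR_gt0//.
      by rewrite ge_min lexx.
  have profr : profile (rho * r / 4) e 0 (rho / 2) (r ^+ 2) <= rho * r * (3 / 4).
    rewrite /profile sqrtr_sqr (gtr0_norm r0).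
    have : e * ln (r ^+ 2) <= 0 by rewrite pmulr_rle0.
    lra.
  have sr1' : Num.sqrt r1' <= r.
    by rewrite -(ger0_norm (ltW r0)) -sqrtr_sqr ler_wsqrtr// (le_trans r1'z).
  have : profile (rho * r / 4) e 0 (rho / 2) (sqn z) + rho / 4 * z 0 N <= u z - v z.
    apply: (radial_comparison (rho * r / 4) e 0 (rho / 2) (rho / 4) r1' r C rf) => //.
    - exact: ltW.
    - by rewrite divr_ge0// ltW.
    - by rewrite divr_ge0// ltW.
    - by rewrite r0.
    - rewrite /profile.
      have : rho / 2 * Num.sqrt r1' <= rho / 2 * r by rewrite ler_pM2l// divr_gt0.
      have : rho / 4 * Num.sqrt r1' <= rho / 4 * r by rewrite ler_pM2l// divr_gt0.
      lra.
    - move=> x xr xN; apply: le_trans (lin x _ _ xN).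
      + rewrite xr sqrtr_sqr (gtr0_norm r0); lra.
      + by rewrite xr.
      + by rewrite xr lerXn2r// nnegrE ltW.
    - lra.
    - apply: (@le_lt_trans _ _ (C * (rho * r * (3 / 4)))); first by rewrite ler_pM2l.
      have -> : C * (rho * r * (3 / 4)) = rho * (3 / 4) * (C * r) by ring.
      have : rho * (3 / 4) * (C * r) <= rho * (3 / 4) * (1 / 8) by rewrite ler_pM2l// mulr_gt0.
      lra.
    - move=> y Hy yr _ gE hE.
      have [_ yN] := (half_ballE y).1 Hy.
      have y0 : 0 < sqn y by apply: sqn_gt0 => y0; move: yN; rewrite y0 mxE ltxx.
      have t0 : 0 < Num.sqrt (sqn y) by rewrite sqrtr_gt0.
      have tr : Num.sqrt (sqn y) <= r by apply: sqrt_le_of_sqn; exact: ltW.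
      have es0 : 0 <= e / sqn y by rewrite divr_ge0// ltW.
      have kt0 : 0 < rho / 2 / (2 * Num.sqrt (sqn y)) by rewrite !divr_gt0// mulr_gt0.
      apply: (intT y e (rho / 2) (rho / 4) _ Hy _ (ltW e0) _ _ erefl _ gE hE).
      + by apply: le_lt_trans (norm_le_sqrt y) _; exact: le_lt_trans rri.
      + by rewrite divr_gt0.
      + by rewrite divr_ge0// ltW.
      + apply: (small_radius_alg _ _ _ _ _ _ r rho) => //; try exact: ltW.
        * by rewrite mulr_ge0// /profile1 addr0 addr_ge0// ltW.
        * rewrite /profile1 addr0.
          have -> : 2 * (e / sqn y + rho / 2 / (2 * Num.sqrt (sqn y))) * Num.sqrt (sqn y) =
            2 * (e / sqn y * Num.sqrt (sqn y)) + rho / 2 by field; rewrite !gt_eqF.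
          by rewrite lerDr mulr_ge0// mulr_ge0// ltW.
    - by rewrite r1'z.
  rewrite /profile.
  have : 0 <= rho / 2 * Num.sqrt (sqn z) by rewrite mulr_ge0 ?sqrtr_ge0// divr_ge0// ltW.
  have : 0 <= rho / 4 * z 0 N by rewrite mulr_ge0// divr_ge0// ltW.
  lra.
have lnz : ln (sqn z) <= 0.
  by apply: ln_le0; apply: le_trans zr _; rewrite expr_le1// ltW.
have q0 : 0 < 1 - ln (sqn z) by lra.
apply/ler_addgt0Pl => e e0.
(* The point z is fixed, and this coefficient makes the logarithmic loss at z less than e. *)
have e1 : 0 < e / (1 - ln (sqn z)) by rewrite divr_gt0.
have := main _ e1.
have -> : e / (1 - ln (sqn z)) * ln (sqn z) = e / (1 - ln (sqn z)) - e.
  by field; rewrite gt_eqF.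
lra.
Qed.

End Comparison.

Theorem proposition2p2 (R : realType) (n : nat) (hn : (2 <= n.+1)%N) (c : R)
    (Gam : set 'rV[R]_n.+1) (hGam : admissible_cone Gam)
    (f : 'rV[R]_n.+1 -> R)
    (hf_sym : symmetric_on Gam f)
    (hf_lip : loc_lipschitz_on Gam f)
    (hf_incr : loc_strictly_increasing Gam f)
    (hstar : ~ closure Gam (lambda_star R n))
    (u v : 'rV[R]_n.+1 -> R)
    (hu : C2_upto (half_ball R n) (closure (half_ball R n) `\ 0) u)
    (hv : C2_upto (half_ball R n) (closure (half_ball R n)) v)
    (hv_adm : forall x, closure (half_ball R n) x ->
       Gam (eigs (conf_hess (half_ball R n) v x)))
    (hu_adm : forall x, half_ball R n x ->
       Gam (eigs (conf_hess (half_ball R n) u x)))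
    (hsub : forall x, half_ball R n x ->
       f (eigs (conf_hess (half_ball R n) u x))
         >= f (eigs (conf_hess (half_ball R n) v x)))
    (hu_bd : forall x, flat_boundary R n x -> x <> 0 ->
       grad_upto (half_ball R n) u x 0 ord_max <= c * expR (u x))
    (hv_bd : forall x, flat_boundary R n x ->
       grad_upto (half_ball R n) v x 0 ord_max >= c * expR (v x))
    (huv : forall x, half_ball R n x -> u x > v x) :
  (0 < limf_einf (fun x : 'rV[R]_n.+1 => (u x - v x)%R%:E)
         (within (closure (half_ball R n)) (0%R : 'rV[R]_n.+1)^'))%E.
Proof.
have [de [r [de0 r0 H]]] := diff_lower_bound c Gam f u v hGam hf_sym hf_lip hf_incr hu hv
  hv_adm hu_adm hsub hu_bd hv_bd huv hstar.
rewrite limf_einfE; apply: (@lt_le_trans _ _ de%:E); first by rewrite lte_fin.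
(* The lower limit is a supremum of infima over the sets of the filter; this punctured half
   neighbourhood is a witness on which [H] bounds the infimum below by [de]. *)
pose W : set 'rV[R]_n.+1 := [set x | sqn x < r ^+ 2 /\ x != 0] `&` closure (half_ball R n).
apply: (@le_trans _ _ (ereal_inf ((fun x => (u x - v x)%:E) @` W))).
  apply: le_ereal_inf_tmp => _ [x [[xr x0] clx] <-]; rewrite lee_fin; apply: H.
  - by apply: sqn_gt0; apply/eqP.
  - exact: ltW.
  - exact: closure_half_ball_ge0.
apply: ereal_sup_ubound; exists W => //=.
have : nbhs (0 : 'rV[R]_n.+1) [set x | sqn (x - 0) < r ^+ 2].
  apply: open_nbhs_nbhs; split; first exact: open_sqn_lt.
  by rewrite /= subr0 sqn0 exprn_gt0.
by apply: filterS => x /=; rewrite subr0 => xr x0 clx.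
Qed.
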